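(* Let $\bar u$ be a $1$-kink solution, of speed $c\in(-1,1)$, of the sine-Gordon equation $u_{tt}=u_{xx}-\sin u$ on $\mathbb R$. Then for every $\eta>0$ there is $\varepsilon_0>0$ such that the following holds for every $\varepsilon\in(0,\varepsilon_0)$. Let $u^0=(u_0,v_0)$ be initial data with $$\left\|(u_0,v_0)-(\bar u(0,\cdot),\bar u_t(0,\cdot))\right\|_{H^1(\mathbb R)\times L^2(\mathbb R)}\le\varepsilon,$$ and let $u^t=(u(t,\cdot),u_t(t,\cdot))$ denote the time evolution of $u^0$ under the sine-Gordon equation. Then there is a speed $c'\in(-1,1)$ with $|c'-c|<\eta$ such that for every time $t$, $u^t$ is $\sqrt{\varepsilon}$-close in $H^1\times L^2$ to a $1$-kink state of speed $c'$; that is, for every $t$ there is $\delta\in\mathbb R$ with $$\left\|u^t-\left(U_{c',\delta},\,-c'\,\partial_xU_{c',\delta}\right)\right\|_{H^1\times L^2}\le\sqrt{\varepsilon}.$$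
   Context: For $c\in(-1,1)$ and $\delta\in\mathbb R$ let $U_{c,\delta}(x)=4\arctan\left(\exp\left(\frac{x-\delta}{\sqrt{1-c^2}}\right)\right)$. The $1$-kink solutions of the sine-Gordon equation of speed $c$ are the traveling fronts $u(t,x)=U_{c,\delta}(x-ct)$, $\delta\in\mathbb R$, which increase from $0$ at $x=-\infty$ to $2\pi$ at $x=+\infty$. The state of such a solution at a given time is the pair $(u,u_t)$, which has the form $(U_{c,\delta'},-c\,\partial_xU_{c,\delta'})$ for some $\delta'\in\mathbb R$. The sine-Gordon equation is considered as an evolution for pairs $(u,v)$ with $v=u_t$ on the phase space $X_1=\{(u,v):\sin(u/2)\in H^1(\mathbb R),\ v\in L^2(\mathbb R),\ u(-\infty)=0,\ u(+\infty)=2\pi\}$. *)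

(* Defs.v *)
From mathcomp Require Import all_boot all_order all_algebra.
From mathcomp Require Import all_classical all_reals all_analysis.

Set Implicit Arguments.
Unset Strict Implicit.
Unset Printing Implicit Defensive.

Import Order.TTheory GRing.Theory Num.Theory.
Import numFieldNormedType.Exports.

Local Open Scope ring_scope.
Local Open Scope classical_set_scope.

Section Sobolev.
Context (R : realType).
Implicit Types (f g w phi : R -> R).

Local Notation mu := (@lebesgue_measure R).

Definition L2 : set (R -> R) := [set f | f \in Lfun mu 2%:E].

(* Only meaningful on L2: [fine] sends an infinite seminorm to 0, so every
   bound on a norm below is paired with membership in the space. *)
Definition L2_norm f : R := fine ('N[mu]_2%:E [EFin \o f])%E.

Definition test_function phi : Prop :=
  (forall n x, derivable (derive1n n phi) x 1) /\
  compact (closure [set x | phi x != 0]).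

Definition is_weak_derivative f w : Prop :=
  forall phi, test_function phi ->
    \int[mu]_x (f x * derive1 phi x) = - \int[mu]_x (w x * phi x).

Definition H1 : set (R -> R) :=
  [set f | L2 f /\ exists w, L2 w /\ is_weak_derivative f w].

Definition weak_derivative f : R -> R :=
  xget (cst 0) [set w | L2 w /\ is_weak_derivative f w].

Definition H1L2 : set ((R -> R) * (R -> R)) := H1 `*` L2.

Definition H1L2_norm (z : (R -> R) * (R -> R)) : R :=
  Num.sqrt (L2_norm z.1 ^+ 2 + L2_norm (weak_derivative z.1) ^+ 2
            + L2_norm z.2 ^+ 2).

(* The H1 x L2 norm of z - z' is at most r; neither z nor z' need lie in H1 x L2, only
   their difference. *)
Definition H1L2_close (z z' : (R -> R) * (R -> R)) (r : R) : Prop :=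
  let d := (z.1 \- z'.1, z.2 \- z'.2) in H1L2 d /\ H1L2_norm d <= r.

End Sobolev.

Section SineGordon.
Context (R : realType).
Implicit Types (u v : R -> R -> R).

Local Notation mu := (@lebesgue_measure R).

Definition kink (c delta x : R) : R :=
  4 * atan (expR ((x - delta) / Num.sqrt (1 - c ^+ 2))).

Definition kink_state (c delta : R) : (R -> R) * (R -> R) :=
  (kink c delta, fun x => - c * derive1 (kink c delta) x).

Definition is_kink_solution (c : R) u : Prop :=
  exists delta, forall t x, u t x = kink c delta (x - c * t).

(* The pair (u, u_t) at time t. *)
Definition state_at u (t : R) : (R -> R) * (R -> R) :=
  (u t, fun x => derive1 (u ^~ x) t).

(* The phase space X_1. The first component is represented by its continuous
   representative, so that the limits at infinity are pointwise limits; the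
   second one is an L2 function, meaningful up to null sets. *)
Definition X1 (z : (R -> R) * (R -> R)) : Prop :=
  [/\ continuous z.1,
      H1 (fun x => sin (z.1 x / 2)),
      L2 z.2,
      z.1 x @[x --> -oo] --> (0 : R) &
      z.1 x @[x --> +oo] --> 2 * pi].

(* Finite-energy solutions, global in time: t |-> (u t, v t) is an
   H1 x L2-continuous curve in X_1 with u_t = v in the sense of L2-valued
   differentiability and v_t = u_xx - sin u tested against smooth compactly
   supported functions of x. *)
Definition sine_gordon_solution u v : Prop :=
  [/\ forall t, X1 (u t, v t),
      forall s t, H1 (u s \- u t),
      forall t, H1L2_norm (u s \- u t, v s \- v t) @[s --> t] --> (0 : R),
      forall t, L2_norm (fun x => (u (t + h) x - u t x) / h - v t x)
                  @[h --> 0^'] --> (0 : R) &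
      forall phi, test_function phi -> forall t,
        is_derive t (1 : R) (fun s => \int[mu]_x (v s x * phi x))
          (\int[mu]_x (u t x * derive1n 2 phi x)
           - \int[mu]_x (sin (u t x) * phi x))].

Definition sine_gordon_evolution (u0 v0 : R -> R) u v : Prop :=
  [/\ sine_gordon_solution u v, u 0 = u0 &
      {ae mu, forall x, v 0 x = v0 x}].

End SineGordon.

(* Main.v *)
(** With [k = sqrt (1 - c ^+ 2)], completing squares in the energy plus [c] times
    the momentum (Bogomolny) shows that
      [|| u_t + c u_x ||^2 + || k u_x - 2 sin (u / 2) ||^2]
    is conserved, since the cross term, the integral of [sin (u / 2) u_x], depends
    only on the limits of [u].  It vanishes exactly on the kinks of speed [c] and is
    [O(eps ^+ 2)] for the initial data.  Conversely, if
    [g = u_x - (2 / k) sin (u / 2)] is small in [L2], then [u] solves the first-order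
    kink equation up to [g]; comparing with the kink that takes the value [pi] at
    the same point, and using that this equation contracts on either side away from
    that point, gives a distance to this kink of order [|| g ||].  Hence the speed
    [c' = c] works, with distance [O(eps)] uniformly in time.

    For the weak solutions considered here, the conservation law is obtained from
    the characteristic variables [u_t + u_x] and [u_t - u_x], each of which solves
    a transport equation with source [- sin u]. *)
Require Import Defs.
From HB Require Import structures.
From mathcomp Require Import all_boot all_order all_algebra.
From mathcomp Require Import all_classical all_reals all_analysis.
From mathcomp Require Import measurable_realfun.
From mathcomp Require Import ring lra.

Import Order.TTheory GRing.Theory Num.Theory.
Import numFieldNormedType.Exports.

Local Open Scope ring_scope.
Local Open Scope classical_set_scope.

Set Implicit Arguments.
Unset Strict Implicit.
Unset Printing Implicit Defensive.

(** Solutions are only continuous curves in the energy space and the equation for [u_t] holds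
    against test functions, so neither [u_t] nor [u_x] can serve as a multiplier. In the
    characteristic variables the only unbounded operator is the generator of translations, which are
    isometries of L2: followed along its characteristics, each variable has a first-order expansion
    in time in the L2 norm, and the square of its norm is differentiated from that expansion. In the
    comparison with a kink [U], the contraction rate is proportional to [|cos (U / 2)|] and vanishes
    at the centre. Weighting the squared difference by [2 - |cos (U / 2)|] repairs this, since the
    decrease of the weight itself supplies decay near the centre. The estimate controls the
    nonlinearity only while the difference is at most [1 / 8], hence a continuation argument on each
    half-line. Since the distance obtained is linear in [eps], the bound [sqrt eps] only has to
    absorb constants depending on [c]. *)

Section L2_space.
Context (R : realType).
Implicit Types (f g h : R -> R).
Local Notation mu := (@lebesgue_measure R).

(** * The space L2 and its inner product *)

Definition ip f g : R := \int[mu]_x (f x * g x).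

Lemma L2_Lfun f : L2 f <-> f \in Lfun mu 2%:E.
Proof. by []. Qed.

Lemma L2_measurable f : L2 f -> measurable_fun setT f.
Proof. by rewrite L2_Lfun inE => /andP[/[!inE]]. Qed.

Lemma L2_sqr_integrable f : L2 f -> mu.-integrable setT (EFin \o (fun x => f x ^+ 2)).
Proof. by move/Lfun2_integrable_sqr. Qed.

Lemma L2_Lnorm f : ('N[mu]_2%:E [EFin \o f] = (\int[mu]_x (f x ^+ 2)%:E) `^ 2^-1)%E.
Proof.
rewrite unlock; congr (_ `^ _)%E; apply: eq_integral => x _ /=.
by rewrite powR_mulrn// real_normK// num_real.
Qed.

Lemma L2P f : L2 f <->
  measurable_fun setT f /\ mu.-integrable setT (EFin \o (fun x => f x ^+ 2)).
Proof.
split=> [L2f|[mf /integrableP[_ fi]]].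
  by split; [exact: L2_measurable|exact: L2_sqr_integrable].
rewrite /L2 /= inE; apply/andP; split; rewrite inE//=.
rewrite /finite_norm L2_Lnorm poweR_lty//.
by under eq_integral do rewrite -[X in X%:E]ger0_norm ?sqr_ge0//.
Qed.

Lemma L2_integrableM f g : L2 f -> L2 g -> mu.-integrable setT (EFin \o (fun x => f x * g x)).
Proof. by move=> L2f L2g; have /Lfun1_integrable := Lfun2_mul_Lfun1 L2f L2g. Qed.

Lemma L2_normE f : L2 f -> L2_norm f = Num.sqrt (ip f f).
Proof.
move=> L2f; rewrite /L2_norm L2_Lnorm.
have fi := integrable_fin_num measurableT (L2_sqr_integrable L2f).
rewrite -(fineK fi) /= -[fine _]/(\int[mu]_x (f x ^+ 2)).
by rewrite powR12_sqrt// Rintegral_ge0// => x _; exact: sqr_ge0.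
Qed.

Lemma ip_ge0 f : 0 <= ip f f.
Proof. by apply: Rintegral_ge0 => x _; rewrite -expr2 sqr_ge0. Qed.

Lemma L2_norm_ge0 f : 0 <= L2_norm f.
Proof. by rewrite /L2_norm fine_ge0// Lnorm_ge0. Qed.

Lemma L2_norm2 f : L2 f -> L2_norm f ^+ 2 = ip f f.
Proof. by move=> L2f; rewrite L2_normE// sqr_sqrtr// ip_ge0. Qed.

Lemma L2_lin a f g : L2 f -> L2 g -> L2 (fun x => a * f x + g x).
Proof.
rewrite !L2_Lfun => hf hg.
by have [_ /(_ a f g hf hg)] := @Lfun_submod_closed _ _ _ mu 2%:E (lee1n 2).
Qed.

Lemma L2_0 : L2 (fun=> 0 : R).
Proof. by rewrite L2_Lfun; have [] := @Lfun_submod_closed _ _ _ mu 2%:E (lee1n 2). Qed.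

Lemma L2D f g : L2 f -> L2 g -> L2 (fun x => f x + g x).
Proof. by move=> hf hg; under eq_fun do rewrite -[f _]mul1r; exact: L2_lin. Qed.

Lemma L2Z a f : L2 f -> L2 (fun x => a * f x).
Proof. by move=> hf; under eq_fun do rewrite -[_ * _]addr0; exact: (L2_lin a hf L2_0). Qed.

Lemma L2N f : L2 f -> L2 (fun x => - f x).
Proof. by move=> hf; under eq_fun do rewrite -mulN1r; exact: L2Z. Qed.

Lemma L2B f g : L2 f -> L2 g -> L2 (fun x => f x - g x).
Proof. by move=> hf hg; apply: L2D => //; exact: L2N. Qed.

Lemma ipC f g : ip f g = ip g f.
Proof. by apply: eq_Rintegral => x _; rewrite mulrC. Qed.

Lemma ip_linl a f g h : L2 f -> L2 g -> L2 h ->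
  ip (fun x => a * f x + g x) h = a * ip f h + ip g h.
Proof.
move=> hf hg hh; rewrite /ip -RintegralZl//; last exact: L2_integrableM.
rewrite -RintegralD//; last 2 first.
- have := L2_integrableM (L2Z a hf) hh; apply: eq_integrable => // x _ /=.
  by rewrite mulrA.
- exact: L2_integrableM.
by apply: eq_Rintegral => x _; rewrite mulrDl mulrA.
Qed.

Lemma ipDl f g h : L2 f -> L2 g -> L2 h ->
  ip (fun x => f x + g x) h = ip f h + ip g h.
Proof.
move=> hf hg hh; rewrite -[ip f h]mul1r -ip_linl//.
by congr ip; apply: funext => x; rewrite mul1r.
Qed.

Lemma ipZl a f h : L2 f -> L2 h -> ip (fun x => a * f x) h = a * ip f h.
Proof.
move=> hf hh; rewrite /ip -RintegralZl//; last exact: L2_integrableM.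
by apply: eq_Rintegral => x _; rewrite mulrA.
Qed.

Lemma ipNl f h : L2 f -> L2 h -> ip (fun x => - f x) h = - ip f h.
Proof.
move=> hf hh; rewrite -mulN1r -ipZl//.
by congr ip; apply: funext => x; rewrite mulN1r.
Qed.

Lemma ipBl f g h : L2 f -> L2 g -> L2 h ->
  ip (fun x => f x - g x) h = ip f h - ip g h.
Proof. by move=> hf hg hh; rewrite ipDl ?ipNl//; exact: L2N. Qed.

Lemma ipDr f g h : L2 f -> L2 g -> L2 h ->
  ip h (fun x => f x + g x) = ip h f + ip h g.
Proof. by move=> hf hg hh; rewrite ipC ipDl// !(ipC h). Qed.

Lemma ipZr a f h : L2 f -> L2 h -> ip h (fun x => a * f x) = a * ip h f.
Proof. by move=> hf hh; rewrite ipC ipZl// (ipC h). Qed.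

Lemma ipBr f g h : L2 f -> L2 g -> L2 h ->
  ip h (fun x => f x - g x) = ip h f - ip h g.
Proof. by move=> hf hg hh; rewrite ipC ipBl// !(ipC h). Qed.

Lemma ip_CauchySchwarz f g : L2 f -> L2 g -> `|ip f g| <= L2_norm f * L2_norm g.
Proof.
move=> hf hg.
have key a : 0 <= a ^+ 2 * ip f f + 2 * a * ip f g + ip g g.
  have := ip_ge0 (fun x => a * f x + g x).
  rewrite ip_linl//; last exact: L2_lin.
  rewrite ipDr// ?ipZr ?ipDr ?ipZr//; [|exact: L2Z..].
  by rewrite (ipC g f); lra.
have D : ip f g ^+ 2 <= ip f f * ip g g.
  have [f0|f0] := eqVneq (ip f f) 0.
    have [->|fg0] := eqVneq (ip f g) 0; first by rewrite f0 mul0r expr0n.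
    (* When [ip f f = 0] the quadratic is affine in [a], and this [a] would give it the value
       [-1]. *)
    have := key (- (ip g g + 1) / (2 * ip f g)).
    rewrite f0 mulr0 add0r (_ : 2 * _ * _ = - (ip g g + 1)); last by field.
    by lra.
  have fp : 0 < ip f f by rewrite lt_neqAle eq_sym f0 ip_ge0.
  have := key (- ip f g / ip f f).
  rewrite -(pmulr_rge0 _ fp) [X in 0 <= X](_ : _ = ip f f * ip g g - ip f g ^+ 2); last by field.
  by rewrite subr_ge0.
rewrite -ler_sqr ?nnegrE// ?mulr_ge0 ?L2_norm_ge0//.
by rewrite exprMn !L2_norm2// real_normK// num_real.
Qed.

Lemma L2_norm_le f (M : R) : L2 f -> 0 <= M -> (L2_norm f <= M) = (ip f f <= M ^+ 2).
Proof. by move=> hf M0; rewrite -L2_norm2// ler_sqr// nnegrE L2_norm_ge0. Qed.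

Lemma L2_normZ a f : L2 f -> L2_norm (fun x => a * f x) = `|a| * L2_norm f.
Proof.
move=> hf; have hZ := L2Z a hf.
by rewrite !L2_normE// ipZl// ipZr// mulrA -expr2 sqrtrM ?sqr_ge0// sqrtr_sqr.
Qed.

Lemma L2_normN f : L2 f -> L2_norm (fun x => - f x) = L2_norm f.
Proof. by move=> hf; under eq_fun do rewrite -mulN1r; rewrite L2_normZ// normrN1 mul1r. Qed.

Lemma L2_normD f g : L2 f -> L2 g -> L2_norm (fun x => f x + g x) <= L2_norm f + L2_norm g.
Proof.
move=> hf hg; have hD := L2D hf hg.
rewrite L2_norm_le// ?addr_ge0 ?L2_norm_ge0// ipDl// !ipDr//.
have := ip_CauchySchwarz hf hg; rewrite ler_norml => /andP[_ cs].
by rewrite sqrrD !L2_norm2// (ipC g f); lra.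
Qed.

Lemma L2_normB f g : L2 f -> L2 g -> L2_norm (fun x => f x - g x) <= L2_norm f + L2_norm g.
Proof.
by move=> hf hg; rewrite -(L2_normN hg); apply: L2_normD => //; exact: L2N.
Qed.

Lemma L2_norm_distC f g : L2_norm (fun x => f x - g x) = L2_norm (fun x => g x - f x).
Proof.
rewrite /L2_norm !L2_Lnorm; congr (fine (_ `^ _)%E).
by apply: eq_integral => x _; rewrite -sqrrN opprB.
Qed.

Lemma L2_norm_dist_tri h f g : L2 f -> L2 g -> L2 h ->
  L2_norm (fun x => f x - g x) <= L2_norm (fun x => f x - h x) + L2_norm (fun x => h x - g x).
Proof.
move=> hf hg hh.
have := L2_normD (L2B hf hh) (L2B hh hg).
by under eq_fun do rewrite addrA subrK.
Qed.

Lemma L2_dom f g : measurable_fun setT f -> L2 g ->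
  (forall x, `|f x| <= `|g x|) -> L2 f.
Proof.
move=> mf hg fg; apply/L2P; split=> //.
apply: le_integrable (L2_sqr_integrable hg) => //.
  by apply/measurable_EFinP; exact: measurable_funX.
by move=> x _ /=; rewrite lee_fin !normrX lerXn2r// nnegrE.
Qed.

Lemma L2_dom_norm f g : measurable_fun setT f -> L2 g ->
  (forall x, `|f x| <= `|g x|) -> L2_norm f <= L2_norm g.
Proof.
move=> mf hg fg; have hf := L2_dom mf hg fg.
rewrite L2_norm_le// ?L2_norm_ge0// L2_norm2//.
apply: le_Rintegral => //; [exact: L2_integrableM..|].
move=> x _; rewrite -!expr2 -[f x ^+ 2]real_normK ?num_real//.
by rewrite -[g x ^+ 2]real_normK ?num_real// lerXn2r// nnegrE.
Qed.

Lemma L2_norm_eq f g : L2 f -> L2 g -> L2_norm (fun x => f x - g x) = 0 ->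
  L2_norm f = L2_norm g.
Proof.
move=> hf hg fg; have := L2_normD (L2B hf hg) hg; rewrite fg add0r.
under [X in L2_norm X]eq_fun do rewrite subrK.
have := L2_normD (L2B hg hf) hf; rewrite L2_norm_distC fg add0r.
under [X in L2_norm X]eq_fun do rewrite subrK.
by move=> gf fg'; apply/eqP; rewrite eq_le gf fg'.
Qed.

Lemma L2_ae_eq f g : L2 f -> L2 g -> {ae mu, forall x, f x = g x} ->
  L2_norm (fun x => f x - g x) = 0.
Proof.
move=> hf hg fg; have hB := L2B hf hg.
rewrite L2_normE// /ip /Rintegral (ae_eq_integral (cst 0)) ?integral0 ?sqrtr0//.
  by apply/measurable_EFinP/measurable_funM; exact: L2_measurable.
apply: filterS fg; first exact: (ae_filter_ringOfSetsType mu).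
by move=> x /= -> _; rewrite subrr mulr0.
Qed.

Lemma L2_indic_itv (a b : R) : L2 (\1_(`]a, b]%classic) : R -> R).
Proof.
apply/L2P; split; first by apply: measurable_indic; exact: measurable_itv.
rewrite (_ : _ \o _ = EFin \o \1_(`]a, b]%classic)); last first.
  by apply: funext => x /=; rewrite indicE; case: (_ \in _); rewrite ?expr1n ?expr0n.
exact: integrable_indic_itv.
Qed.

Lemma L2_bounded f (a b M : R) : measurable_fun setT f -> a <= b -> 0 <= M ->
  (forall x, `|f x| <= M) -> (forall x, ~ (a < x <= b) -> f x = 0) ->
  L2 f /\ L2_norm f <= M * Num.sqrt (b - a).
Proof.
move=> mf ab M0 fM f0.
have hi := L2Z M (L2_indic_itv a b).
have dom x : `|f x| <= `|M * \1_(`]a, b]%classic) x|.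
  rewrite indicE; have [xab|/negP xab] := boolP (x \in `]a, b]%classic).
    by rewrite mulr1 (ger0_norm M0).
  by rewrite mulr0 f0 ?normr0// => /andP xab'; apply: xab; rewrite inE/= in_itv/=; exact/andP.
split; first exact: L2_dom dom.
apply: (le_trans (L2_dom_norm mf hi dom)).
rewrite L2_normZ ?ger0_norm//; last exact: L2_indic_itv.
rewrite ler_wpM2l// L2_normE; last exact: L2_indic_itv.
apply: ler_wsqrtr; rewrite /ip.
rewrite (_ : (fun x => _) = \1_(`]a, b]%classic)); last first.
  by apply: funext => x /=; rewrite indicE; case: (_ \in _); rewrite ?mulr1 ?mulr0.
rewrite /Rintegral integral_indic//= setIT lebesgue_measure_itv/= lte_fin.
by case: ifP => /=; rewrite ?subr_ge0.
Qed.

Lemma L2_norm0 : L2_norm (fun=> 0 : R) = 0.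
Proof.
rewrite L2_normE; last exact: L2_0.
by rewrite /ip Rintegral_cst// mul0r mul0r sqrtr0.
Qed.

End L2_space.

(** * Smooth functions: flat functions and a smooth step *)

Section smooth_functions.
Context (R : realType).
Implicit Types (f g phi : R -> R).

Lemma is_derive1_eq f (x d d' : R) :
  is_derive x (1 : R) f d -> d = d' -> is_derive x (1 : R) f d'.
Proof. by move=> ? <-. Qed.

(** Only the existence of [n] successive derivatives is recorded, with no continuity of the last
    one; over all [n] this is smoothness. Peeling off the innermost derivative makes the closure
    properties plain inductions. *)
Fixpoint Cn (n : nat) f : Prop :=
  if n is m.+1 then (forall x, derivable f x 1) /\ Cn m (derive1 f) else True.

Definition smooth f := forall n, Cn n f.

Lemma Cn_deriv n f (f' : R -> R) : (forall x : R, is_derive x (1 : R) f (f' x)) -> Cn n f' -> Cn n.+1 f.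
Proof.
move=> df hf'; split; first by move=> x; have [] := df x.
rewrite (_ : (derive1 f) = f')//; apply: funext => x.
by rewrite derive1E; have [_] := df x.
Qed.

Lemma CnW n f : Cn n.+1 f -> Cn n f.
Proof. by elim: n f => // n IH f [df /IH]. Qed.

Lemma Cn_isd n f : Cn n.+1 f -> forall x : R, is_derive x (1 : R) f ((derive1 f) x).
Proof. by move=> [df _] x; rewrite derive1E; exact/derivableP. Qed.

Lemma Cn_cst n (k : R) : Cn n (cst k).
Proof.
elim: n k => // n IH k; apply: (@Cn_deriv _ _ (cst 0)) => //.
Qed.

Lemma CnD n f g : Cn n f -> Cn n g -> Cn n (fun x => f x + g x).
Proof.
elim: n f g => // n IH f g hf hg.
refine (@Cn_deriv n (fun x => f x + g x) (fun x => (derive1 f) x + (derive1 g) x) _ _).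
  by move=> x; apply: is_deriveD; [exact: (Cn_isd hf)|exact: (Cn_isd hg)].
by apply: IH; [case: hf|case: hg].
Qed.

Lemma CnM n f g : Cn n f -> Cn n g -> Cn n (fun x => f x * g x).
Proof.
elim: n f g => // n IH f g hf hg.
apply: (@Cn_deriv _ _ (fun x => f x * (derive1 g) x + g x * (derive1 f) x)).
  by move=> x; have := is_deriveM (Cn_isd hf x) (Cn_isd hg x).
by apply: CnD; apply: IH; [exact: CnW|case: hg|exact: CnW|case: hf].
Qed.

Lemma CnV n f : (forall x, f x != 0) -> Cn n f -> Cn n (fun x => (f x)^-1).
Proof.
move=> f0; elim: n => // n IH hf.
apply: (@Cn_deriv _ _ (fun x => ((-1) * ((f x)^-1 * (f x)^-1)) * (derive1 f) x)).
  move=> x; apply: (is_derive1_eq (is_deriveV (f0 x) (Cn_isd hf x))).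
  by rewrite /GRing.scale/= expr2 invfM mulN1r.
have hfi := IH (CnW hf).
by apply: CnM; [apply: CnM; [exact: Cn_cst|exact: CnM]|case: hf].
Qed.

Lemma is_derive_affine f (a b x d : R) : is_derive (a * x + b) (1 : R) f d ->
  is_derive x (1 : R) (fun y => f (a * y + b)) (d * a).
Proof.
move=> hf; apply: (@is_derive1_comp _ f (fun y => a * y + b)) => //.
have -> : (fun y => a * y + b) = (a \*: id) + cst b :> (R -> R) by [].
by apply: is_derive_eq; rewrite addr0 /GRing.scale/= mulr1.
Qed.

Lemma Cn_affine n f (a b : R) : Cn n f -> Cn n (fun x => f (a * x + b)).
Proof.
elim: n f => // n IH f hf.
apply: (@Cn_deriv n (fun x => f (a * x + b)) (fun x => (derive1 f) (a * x + b) * a)).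
  by move=> x; exact: (@is_derive_affine f a b x _ (Cn_isd hf _)).
by apply: CnM; [apply: IH; case: hf|exact: Cn_cst].
Qed.

(* The flat functions [x ^- k * exp (- 1 / x)], extended by [0], are stable under
   linear combinations of derivatives, hence smooth. *)
Definition flat (k : nat) (x : R) : R := if 0 < x then x ^- k * expR (- x^-1) else 0.

(** The exponential dominates the term of degree [k + 2] of its series at [1 / x]. The factor
    [x ^+ 2] makes the difference quotient at [0] tend to [0]. *)
Lemma flat_le k x : `|flat k x| <= (k.+2)`!%:R * x ^+ 2.
Proof.
rewrite /flat; case: ifPn => [x0|_]; last by rewrite normr0 mulr_ge0 ?sqr_ge0.
have xi0 : 0 <= x^-1 by rewrite invr_ge0 ltW.
rewrite ger0_norm; last by rewrite mulr_ge0 ?expR_ge0// invr_ge0 exprn_ge0// ltW.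
have := expR_ge1Dxn k.+1 xi0 => h.
have e0 := expR_gt0 x^-1.
have f0 : 0 < (k.+2)`!%:R :> R by rewrite ltr0n fact_gt0.
rewrite expRN -ler_pdivlMr ?invr_gt0// invrK.
have {}h : x^-1 ^+ k.+2 <= (k.+2)`!%:R * expR x^-1.
  by rewrite -ler_pdivrMl// mulrC; lra.
rewrite mulrAC -exprVn.
have -> : x^-1 ^+ k = x ^+ 2 * x^-1 ^+ k.+2.
  by rewrite !exprS; field; rewrite gt_eqF.
by rewrite mulrC ler_wpM2r ?sqr_ge0.
Qed.

Lemma is_derive1P f (x d : R) :
  is_derive x (1 : R) f d <-> h^-1 * (f (x + h) - f x) @[h --> 0^'] --> d.
Proof.
have E : (fun h => h^-1 * (f (x + h) - f x)) =
    (fun h => h^-1 *: ((f \o shift x) (h *: (1 : R)) - f x)).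
  by apply: funext => h; rewrite /= /GRing.scale/= mulr1 (addrC h).
split=> [[df <-]|fd]; first by rewrite E.
have fd' := fd; rewrite E in fd'.
split; first by apply/cvg_ex; exists d.
exact: (cvg_lim _ fd').
Qed.

Let is_derive_flat_gt0 k (x : R) : 0 < x ->
  is_derive x (1 : R) (fun y => y ^- k * expR (- y^-1))
    (x ^- k.+2 * expR (- x^-1) - k%:R * (x ^- k.+1 * expR (- x^-1))).
Proof.
move=> x0; have xN0 : x != 0 by rewrite gt_eqF.
have dV := is_deriveV xN0 (is_derive_id x (1 : R)).
elim: k => [|k IH].
  under eq_fun do rewrite expr0 invr1 mul1r.
  have h := @is_derive1_comp _ expR (fun y => - y^-1) x _ _
    (is_derive_expR (- x^-1)) (is_deriveN dV).
  by apply: (is_derive1_eq h); rewrite mul0r subr0 /GRing.scale/= mulr1 opprK mulrC.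
have h := is_deriveM dV IH; move: h.
have -> : (fun y => y^-1) * (fun y => y ^- k * expR (- y^-1)) =
    (fun y => y ^- k.+1 * expR (- y^-1)) :> (R -> R).
  apply: funext => y; rewrite -[LHS]/(y^-1 * (y ^- k * expR (- y^-1))).
  by rewrite exprS invfM mulrA.
move=> h; apply: (is_derive1_eq h); rewrite /GRing.scale/= mulr1 -natr1 !exprS expr0 mulr1.
by have X0 := expf_neq0 k xN0; field; rewrite ?xN0 ?X0.
Qed.

Lemma is_derive_flat k (x : R) :
  is_derive x (1 : R) (flat k) (flat k.+2 x - k%:R * flat k.+1 x).
Proof.
have [x0|x0|->] := ltgtP x 0.
- have near0 : {near x, cst 0 =1 flat k}.
    near=> y; rewrite /flat ifN// -leNgt ltW//; near: y; exact: lt_nbhsl.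
  rewrite /flat ltNge (ltW x0)/= mulr0 subr0.
  by apply: (near_eq_is_derive near0); exact: is_derive_cst.
- have near0 : {near x, (fun y => y ^- k * expR (- y^-1)) =1 flat k}.
    near=> y; rewrite /flat ifT//; near: y; exact: lt_nbhsr.
  apply: (near_eq_is_derive near0).
  by rewrite /flat x0; exact: is_derive_flat_gt0.
- apply/is_derive1P; rewrite /flat ltxx mulr0 !subr0 -/(flat _ _).
  apply/cvgr0Pnorm_le => e e0; near=> h.
  have h0 : h != 0 by near: h; exact: nbhs_dnbhs_neq.
  rewrite add0r subr0 -/(flat k h) normrM normfV.
  rewrite ler_pdivrMl ?normr_gt0//.
  apply: (le_trans (flat_le k h)).
  rewrite -(real_normK (num_real h)) expr2 mulrCA ler_wpM2l//.
  rewrite -ler_pdivlMl; last by rewrite ltr0n fact_gt0.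
  rewrite mulrC; near: h; apply: dnbhs0_le; rewrite divr_gt0// ltr0n fact_gt0//.
Unshelve. all: by end_near. Qed.

Lemma smooth_flat k : smooth (flat k).
Proof.
move=> n; elim: n k => // n IH k.
apply: (@Cn_deriv n (flat k) (fun x => flat k.+2 x + (- k%:R) * flat k.+1 x)).
  by move=> x; apply: (is_derive1_eq (is_derive_flat k x)); rewrite mulNr.
by apply: CnD => //; apply: CnM => //; exact: Cn_cst.
Qed.

Lemma flat0_ge0 x : 0 <= flat 0 x.
Proof. by rewrite /flat; case: ifP => // _; rewrite expr0 invr1 mul1r expR_ge0. Qed.

(** The classical smooth transition from [0] on the negative axis to [1] beyond [1]. The reflected
    argument [1 - x] is spelled as an affine image to match [Cn_affine]. *)
Definition sstep (x : R) : R := flat 0 x * (flat 0 x + flat 0 (- 1 * x + 1))^-1.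

Let sstep_den_neq0 x : flat 0 x + flat 0 (- 1 * x + 1) != 0.
Proof.
have [x0|x0] := ltP 0 x.
  rewrite gt_eqF// ltr_pwDl ?flat0_ge0//.
  by rewrite /flat x0 expr0 invr1 mul1r expR_gt0.
rewrite gt_eqF// ltr_wpDl ?flat0_ge0//.
by rewrite /flat ifT ?expr0 ?invr1 ?mul1r ?expR_gt0//; lra.
Qed.

Lemma smooth_sstep : smooth sstep.
Proof.
move=> n; apply: CnM; first exact: smooth_flat.
apply: CnV; first exact: sstep_den_neq0.
by apply: CnD; [exact: smooth_flat|apply: Cn_affine; exact: smooth_flat].
Qed.

Lemma sstep_ge0 x : 0 <= sstep x.
Proof. by rewrite mulr_ge0 ?flat0_ge0// invr_ge0 addr_ge0 ?flat0_ge0. Qed.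

Lemma sstep_le1 x : sstep x <= 1.
Proof.
rewrite /sstep ler_pdivrMr ?mul1r ?lerDl ?flat0_ge0//.
by rewrite lt_neqAle eq_sym sstep_den_neq0 addr_ge0 ?flat0_ge0.
Qed.

Lemma sstep_le0 x : x <= 0 -> sstep x = 0.
Proof. by move=> x0; rewrite /sstep {1}/flat ltNge x0 mul0r. Qed.

Lemma sstep_ge1 x : 1 <= x -> sstep x = 1.
Proof.
move=> x1; have := sstep_den_neq0 x; rewrite /sstep.
have -> : flat 0 (-1 * x + 1) = 0 by rewrite /flat ifN// -leNgt; lra.
by rewrite addr0 => ?; rewrite divff.
Qed.

End smooth_functions.

(** * Test functions and their density in L2 *)

Section test_functions.
Context (R : realType).
Implicit Types (f g phi : R -> R).
Local Notation mu := (@lebesgue_measure R).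

Lemma smoothP f : smooth f <-> forall n (x : R), derivable (derive1n n f) x 1.
Proof.
split=> [sf n|df].
  elim: n f sf => [|n IH] f sf x; first by have [] := sf 1%N.
  rewrite derive1Sn; apply: IH => k; exact: (sf k.+1).2.
move=> n; elim: n f df => // n IH f df; split; first by move=> x; exact: (df 0%N x).
by apply: IH => k x; rewrite -derive1Sn; exact: df.
Qed.

Lemma smooth_derive1 f : smooth f -> smooth (derive1 f).
Proof. by move=> sf n; exact: (sf n.+1).2. Qed.

Lemma smooth_continuous f : smooth f -> continuous f.
Proof.
move=> sf x; apply: differentiable_continuous; apply/derivable1_diffP.
by have [] := sf 1%N.
Qed.

Lemma continuous_measurableT f : continuous f -> measurable_fun setT f.
Proof. exact: continuous_measurable_fun. Qed.

Lemma test_functionP phi : test_function phi <->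
  smooth phi /\ exists M : R, 0 < M /\ forall x, M <= `|x| -> phi x = 0.
Proof.
split=> [[/smoothP sphi /compact_bounded[M [_ hM]]]|[/smoothP sphi [M [M0 hM]]]]; split=> //.
  (* The compactness bound holds for every radius above [M], in particular [|M| + 1]; the next unit
     makes the comparison strict. *)
  exists (`|M| + 2); split=> [|x Mx]; first by rewrite ltr_wpDl.
  apply/eqP/negPn/negP => phix.
  have /= := hM (`|M| + 1) _ x; rewrite leNgt ltr_pwDr ?ler_norm// => /(_ isT).
  have cx : closure [set y | phi y != 0] x by apply: subset_closure.
  by move=> /(_ cx); lra.
apply: (subclosed_compact _ (@segment_compact _ (- M) M)); first exact: closed_closure.
rewrite [X in _ `<=` X](closure_id _).1; last exact: interval_closed.
apply: closure_subset => x /= phix; rewrite in_itv/= -ler_norml.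
by rewrite leNgt; apply/negP => Mx; move: phix; rewrite hM ?eqxx// ltW.
Qed.

Lemma test_smooth phi : test_function phi -> smooth phi.
Proof. by move/test_functionP => []. Qed.

Lemma test_derive phi : test_function phi -> test_function (derive1 phi).
Proof.
move=> /test_functionP[sphi [M [M0 hM]]]; apply/test_functionP; split.
  exact: smooth_derive1.
(* The extra unit leaves a neighbourhood of [x] on which [phi] vanishes, so its derivative at [x] is
   that of a constant. *)
exists (M + 1); split=> [|x Mx]; first by rewrite addr_gt0.
have near0 : {near x, cst 0 =1 phi}.
  near=> y; rewrite hM//; near: y.
  exists 1 => //= y /=; move: Mx; have := ler_distD y x 0; rewrite !subr0; lra.
by rewrite derive1E -(near_eq_derive (1 : R) near0) derive_cst.
Unshelve. all: by end_near. Qed.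

Lemma test_isd phi : test_function phi -> forall x : R, is_derive x (1 : R) phi (derive1 phi x).
Proof. by move/test_smooth => /(_ 1%N)/Cn_isd. Qed.

Lemma test_continuous phi : test_function phi -> continuous phi.
Proof. by move/test_smooth/smooth_continuous. Qed.

Lemma test_bounded phi : test_function phi -> exists C : R, 0 <= C /\ forall x, `|phi x| <= C.
Proof.
move=> tphi; have /test_functionP[_ [M [M0 hM]]] := tphi.
have MM : - M <= M by lra.
have cphi : {within `[- M, M], continuous (fun x => `|phi x|)}.
  by apply: continuous_subspaceT => x; apply: cvg_norm; exact: test_continuous.
have [c _ hc] := EVT_max MM cphi.
exists `|phi c|; split=> // x; have [xM|/hM ->] := ltP `|x| M; last by rewrite normr0.
by apply: hc; rewrite in_itv/= -ler_norml ltW.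
Qed.

Lemma test_L2 phi : test_function phi -> L2 phi.
Proof.
move=> tphi; have [C [C0 hC]] := test_bounded tphi.
have /test_functionP[_ [M [M0 hM]]] := tphi.
apply: (proj1 (@L2_bounded R phi (- M) M C _ _ _ _ _)) => //; try lra.
  by apply: continuous_measurableT; exact: test_continuous.
move=> x xM; apply: hM; rewrite leNgt ltr_norml; apply/negP => /andP[x1 x2].
by apply: xM; rewrite x1 ltW.
Qed.

Lemma test_shift (a : R) phi : test_function phi -> test_function (fun x => phi (x + a)).
Proof.
move=> /test_functionP[sphi [M [M0 hM]]]; apply/test_functionP; split.
  move=> n; have := Cn_affine 1 a (sphi n).
  by under eq_fun do rewrite mul1r.
exists (M + `|a|); split=> [|x xM]; first by rewrite ltr_pwDl.
by apply: hM; have := ler_normB (x + a) a; rewrite addrK; lra.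
Qed.

Lemma testD phi g : test_function phi -> test_function g -> test_function (fun x => phi x + g x).
Proof.
move=> /test_functionP[sphi [M [M0 hM]]] /test_functionP[sg [N [N0 hN]]].
apply/test_functionP; split; first by move=> n; apply: CnD.
exists (M + N); split=> [|x xM]; first by rewrite addr_gt0.
by rewrite hM ?hN ?addr0//; lra.
Qed.

Lemma testZ (a : R) phi : test_function phi -> test_function (fun x => a * phi x).
Proof.
move=> /test_functionP[sphi [M [M0 hM]]]; apply/test_functionP; split.
  by move=> n; apply: CnM => //; exact: Cn_cst.
by exists M; split=> // x xM; rewrite hM ?mulr0.
Qed.

(** A smoothed indicator of []a, b]], with an ascending ramp of width [1 / k] starting at [a] and a
    descending one starting at [b]. Its derivative is the difference of two bumps that concentrate
    at [a] and at [b]. *)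
Definition trap (a b k x : R) : R := sstep (k * x + (- k * a)) - sstep (k * x + (- k * b)).

Lemma test_trap (a b k : R) : a <= b -> 0 < k -> test_function (trap a b k).
Proof.
move=> ab k0; apply/test_functionP; split.
  move=> n; rewrite /trap; apply: CnD; first exact/Cn_affine/smooth_sstep.
  under eq_fun do rewrite -mulN1r; apply: CnM; first exact: Cn_cst.
  exact/Cn_affine/smooth_sstep.
have k1 : 0 < k^-1 by rewrite invr_gt0.
exists (`|a| + `|b| + k^-1); split=> [|x]; first by rewrite ltr_wpDl// addr_ge0.
have := ler_norm a; have := ler_norm b; have := ler_norm (- a); have := ler_norm (- b).
rewrite !normrN; have [x0|x0] := leP 0 x => h1 h2 h3 h4.
  rewrite (ger0_norm x0) => hx; rewrite /trap !sstep_ge1 ?subrr//.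
    by rewrite mulNr -mulrBr -ler_pdivrMl// mulr1; lra.
  by rewrite mulNr -mulrBr -ler_pdivrMl// mulr1; lra.
rewrite (ltr0_norm x0) => hx; rewrite /trap !sstep_le0 ?subrr//.
  by rewrite mulNr -mulrBr pmulr_rle0//; lra.
by rewrite mulNr -mulrBr pmulr_rle0//; lra.
Qed.

(** The two functions can differ only on the ramps, and there by at most [1]; the L2 error is thus
    of order [k ^ (- 1 / 2)]. *)
Lemma trap_indic (a b k x : R) : a <= b -> 0 < k ->
  `|trap a b k x - \1_(`]a, b]%classic) x| <=
    `|\1_(`]a, a + k^-1]%classic) x + \1_(`]b, b + k^-1]%classic) x|.
Proof.
move=> ab k0; have k1 : 0 < k^-1 by rewrite invr_gt0.
have sle c : x <= c -> sstep (k * x + (- k * c)) = 0.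
  by move=> xc; rewrite sstep_le0// mulNr -mulrBr pmulr_rle0//; lra.
have sge c : c + k^-1 < x -> sstep (k * x + (- k * c)) = 1.
  by move=> xc; rewrite sstep_ge1// mulNr -mulrBr -ler_pdivrMl// mulr1; lra.
rewrite /trap !indicE !mem_setE !in_itv/=.
have a0 := sstep_ge0 (k * x + (- k * a)); have a1 := sstep_le1 (k * x + (- k * a)).
have b0 := sstep_ge0 (k * x + (- k * b)); have b1 := sstep_le1 (k * x + (- k * b)).
have [xa|xa] := leP x a.
  by rewrite (sle a xa) (sle b (le_trans xa ab)) !subrr normr0 normr_ge0.
have [xb|xb] /= := leP x b.
  rewrite (sle b)// !subr0 addr0.
  have [xa'|xa'] := leP x (a + k^-1).
    by rewrite normr1 ler_norml; lra.
  by rewrite sge// subrr normr0.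
have [xb'|xb'] := leP x (b + k^-1); last first.
  by rewrite subr0 (sge b)// sge ?subrr ?normr0//; lra.
rewrite subr0; apply: (@le_trans _ _ 1); first by rewrite ler_norml; lra.
by rewrite ger0_norm ?addr_ge0// lerDr.
Qed.

Lemma L2_norm_indic_itv (a b : R) : a <= b ->
  L2_norm (\1_(`]a, b]%classic) : R -> R) <= Num.sqrt (b - a).
Proof.
move=> ab; rewrite -[leRHS]mul1r; apply: (proj2 (@L2_bounded R _ a b 1 _ ab _ _ _)) => //.
- by move=> x; rewrite indicE; case: (_ \in _); rewrite ?normr1 ?normr0.
- move=> x xab; rewrite indicE; case: (boolP (_ \in _)) => // /set_mem/=.
  by rewrite in_itv.
Qed.

Lemma trap_L2_dist (a b k : R) : a <= b -> 0 < k ->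
  L2_norm (fun x => trap a b k x - \1_(`]a, b]%classic) x) <= 2 * Num.sqrt k^-1.
Proof.
move=> ab k0; have k1 : 0 <= k^-1 by rewrite invr_ge0 ltW.
have hi c d := @L2_indic_itv R c d.
apply: le_trans.
  apply: (L2_dom_norm _ (L2D (hi a (a + k^-1)) (hi b (b + k^-1)))).
    by apply: L2_measurable; apply: L2B => //; apply: test_L2; exact: test_trap.
  by move=> x; exact: trap_indic.
apply: (le_trans (L2_normD (hi _ _) (hi _ _))).
rewrite mulr2n mulrDl mul1r lerD//.
  by have := @L2_norm_indic_itv a (a + k^-1); rewrite addrAC subrr add0r lerDl; exact.
by have := @L2_norm_indic_itv b (b + k^-1); rewrite addrAC subrr add0r lerDl; exact.
Qed.

Lemma L2_dominated_cvg (f_ : nat -> R -> R) f : L2 f ->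
  (forall n, measurable_fun setT (f_ n)) -> (forall n x, `|f_ n x| <= `|f x|) ->
  (forall x, f_ n x @[n --> \oo] --> f x) ->
  L2_norm (fun x => f x - f_ n x) @[n --> \oo] --> 0.
Proof.
move=> hf mf_ dom f_f; have hf_ n := L2_dom (mf_ n) hf (dom n).
have hB n := L2B hf (hf_ n).
pose F n x := ((f x - f_ n x) ^+ 2)%:E.
have mF n : measurable_fun setT (F n).
  by apply/measurable_EFinP; apply: measurable_funX; exact: L2_measurable.
have m0 : measurable_fun setT (cst 0%E : R -> \bar R) by exact: measurable_cst.
have cF : {ae mu, forall x, setT x -> F ^~ x @ \oo --> cst 0%E x}.
  apply: aeW => x _; apply: cvg_EFin; first by apply: nearW.
  have h : f x - f_ n x @[n --> \oo] --> (0 : R).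
    by rewrite -(subrr (f x)); apply: cvgB => //; exact: cvg_cst.
  have h2 : (f x - f_ n x) ^+ 2 @[n --> \oo] --> (0 : R).
    by rewrite -(mulr0 (0 : R)); under eq_cvg do rewrite expr2; exact: cvgM.
  exact: h2.
(* Since [|f - f_ n| <= 2 |f|], the integrable function [(2 f) ^+ 2] dominates all the squared
   errors. *)
have iG := L2_sqr_integrable (L2Z 2 hf).
have dF : {ae mu, forall x n, setT x -> (`|F n x| <= ((2 * f x) ^+ 2)%:E)%E}.
  apply: aeW => x n _; rewrite abse_EFin lee_fin ger0_norm ?sqr_ge0//.
  rewrite -[leLHS]real_normK ?num_real// -[leRHS]real_normK ?num_real//.
  rewrite lerXn2r ?nnegrE// normrM (ger0_norm (ler0n _ 2)).
  by have := dom n x; have := ler_normB (f x) (f_ n x); lra.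
have [_ _] := @dominated_convergence _ _ _ mu setT measurableT F (cst 0%E) _ mF m0 cF iG dF.
rewrite integral0 => h.
have : ip (fun x => f x - f_ n x) (fun x => f x - f_ n x) @[n --> \oo] --> 0.
  apply: cvg_trans (fine_cvg h); apply: near_eq_cvg; apply: nearW => n /=.
  by congr fine; apply: eq_integral => x _; rewrite expr2.
move=> h2; rewrite -(sqrtr0 R).
under eq_cvg do rewrite L2_normE//.
by apply: (cvg_comp _ _ h2); exact: sqrt_continuous.
Qed.

Definition test_approx f := forall e : R, 0 < e ->
  exists phi, test_function phi /\ L2_norm (fun x => f x - phi x) <= e.

Lemma test_approx_test phi : test_function phi -> test_approx phi.
Proof.
move=> tphi e e0; exists phi; split=> //.
by under eq_fun do rewrite subrr; rewrite L2_norm0 ltW.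
Qed.

Lemma test_approx_cvg f : L2 f ->
  (forall e : R, 0 < e -> exists g, [/\ L2 g, test_approx g & L2_norm (fun x => f x - g x) <= e]) ->
  test_approx f.
Proof.
move=> hf fg e e0; have e20 : 0 < e / 2 by rewrite divr_gt0.
have [g [hg ag fge]] := fg _ e20; have [phi [tphi gphi]] := ag _ e20.
exists phi; split=> //; apply: (le_trans (L2_norm_dist_tri hf (test_L2 tphi) hg)).
by rewrite (splitr e) lerD.
Qed.

Lemma test_approxD f g : L2 f -> L2 g -> test_approx f -> test_approx g ->
  test_approx (fun x => f x + g x).
Proof.
move=> hf hg af ag e e0; have e20 : 0 < e / 2 by rewrite divr_gt0.
have [phi [tphi fphi]] := af _ e20; have [psi [tpsi gpsi]] := ag _ e20.
exists (fun x => phi x + psi x); split; first exact: testD.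
under eq_fun do rewrite opprD addrACA.
apply: (le_trans (L2_normD _ _)); [exact: (L2B hf (test_L2 tphi))|exact: (L2B hg (test_L2 tpsi))|].
by rewrite (splitr e) lerD.
Qed.

Lemma test_approxZ (a : R) f : L2 f -> test_approx f -> test_approx (fun x => a * f x).
Proof.
move=> hf af e e0; have a0 : 0 < `|a| + 1 by rewrite ltr_wpDl.
have [|phi [tphi fphi]] := af (e / (`|a| + 1)); first by rewrite divr_gt0.
exists (fun x => a * phi x); split; first exact: testZ.
under eq_fun do rewrite -mulrBr.
rewrite L2_normZ; last exact: (L2B hf (test_L2 tphi)).
apply: (@le_trans _ _ ((`|a| + 1) * (e / (`|a| + 1)))).
  by apply: ler_pM => //; [exact: L2_norm_ge0|rewrite lerDl].
by rewrite mulrC divfK// gt_eqF.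
Qed.

Lemma test_approx0 : test_approx (fun=> 0).
Proof.
by apply: test_approx_test; apply/test_functionP; split;
  [move=> n; exact: Cn_cst|exists 1].
Qed.

Lemma test_approx_itv (a b : R) : test_approx \1_(`]a, b]%classic).
Proof.
have [ab|ba] := leP a b; last first.
  rewrite set_itv_ge ?indic0; last by rewrite bnd_simp -leNgt ltW.
  exact: test_approx0.
(* Chosen so that the error bound [2 * sqrt (1 / k)] is exactly [e]. *)
move=> e e0; pose k := (2 / e) ^+ 2.
have k0 : 0 < k by rewrite exprn_gt0// divr_gt0.
exists (trap a b k); split; first exact: test_trap.
rewrite L2_norm_distC; apply: (le_trans (trap_L2_dist ab k0)).
rewrite -exprVn sqrtr_sqr ger0_norm; last by rewrite invr_ge0 divr_ge0// ltW.
by rewrite invf_div mulrCA mulfV ?mulr1// pnatr_eq0.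
Qed.

Lemma L2_indic_itv_setI (A : set R) (a b : R) : measurable A ->
  L2 (\1_(A `&` `]a, b]%classic) : R -> R).
Proof.
move=> mA; apply: (L2_dom _ (L2_indic_itv a b)).
  by apply: measurable_indic; apply: measurableI.
move=> x; rewrite !indicE in_setI.
by case: (x \in A) => //=; rewrite normr0.
Qed.

(** A Dynkin-class argument: half-open intervals are stable under intersection and generate the
    measurable sets, while the sets with an approximable truncation form a lambda-system. Truncating
    to []a, b]] keeps every indicator in L2. *)
Lemma test_approx_indic (A : set R) (a b : R) : measurable A ->
  test_approx \1_(A `&` `]a, b]%classic).
Proof.
pose H := [set A : set R | measurable A /\ test_approx \1_(A `&` `]a, b]%classic)].
suff sub : <<s (@ocitv R) >> `<=` H by move=> /sub[].
have mH B : H B -> measurable B by case.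
apply: (@lambda_system_subset _ (@ocitv R) (@ocitvI R) setT) => //; last first.
  move=> _ [[c d] _ <-] /=; split; first exact: measurable_itv.
  have -> : `]c, d] `&` `]a, b] = `](Num.max c a), (Num.min d b)] :> set R.
    rewrite predeqE => x /=; rewrite !in_itv/= gt_max le_min; split.
      by move=> [/andP[-> ->] /andP[-> ->]].
    by move=> /andP[/andP[-> ->] /andP[-> ->]].
  exact: test_approx_itv.
split=> //.
- by split; [exact: measurableT|rewrite setTI; exact: test_approx_itv].
- move=> B C CB [mB aB] [mC aC]; split; first exact: measurableD.
  have hB := L2_indic_itv_setI a b mB; have hC := L2_indic_itv_setI a b mC.
  have -> : \1_((B `\` C) `&` `]a, b]%classic) =
      fun x => \1_(B `&` `]a, b]%classic) x + (- 1) * \1_(C `&` `]a, b]%classic) x :> R.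
    apply: funext => x; rewrite !indicE setDE !in_setI in_setC mulN1r.
    have [xB|xB] := boolP (x \in B); have [xC|xC] := boolP (x \in C);
      rewrite /= ?andbT ?andbF ?subr0 ?subrr//.
    by exfalso; move/negP: xB; apply; rewrite inE; apply: CB; rewrite inE in xC.
  by apply: test_approxD => //; [exact: L2Z|exact: test_approxZ].
- move=> F ndF HF; have mF i := mH _ (HF i).
  have mU : measurable (\bigcup_i F i) by apply: bigcup_measurable => i _; exact: mF.
  split=> //; have hU := L2_indic_itv_setI a b mU.
  apply: test_approx_cvg => // e e0.
  have mI i : measurable_fun setT (\1_(F i `&` `]a, b]%classic) : R -> R).
    exact: (L2_measurable (L2_indic_itv_setI _ _ (mF i))).
  have dI i x : `|\1_(F i `&` `]a, b]%classic) x : R| <=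
      `|\1_(\bigcup_i F i `&` `]a, b]%classic) x|.
    rewrite !indicE !in_setI; have [xF|xF] := boolP (x \in F i); last by rewrite normr0.
    rewrite (_ : x \in \bigcup_i F i = true)//.
    by apply/mem_set; exists i => //; exact: set_mem.
  have cI x : \1_(F i `&` `]a, b]%classic) x @[i --> \oo] -->
      (\1_(\bigcup_i F i `&` `]a, b]%classic) x : R).
    apply/cvgrPdist_le => d d0; have [[i _ Fix]|nF] := pselect ((\bigcup_i F i) x).
      exists i => // j /= ij; rewrite !indicE !in_setI.
      rewrite (_ : x \in \bigcup_i F i = true); last by apply/mem_set; exists i.
      rewrite (_ : x \in F j = true); last first.
        by apply/mem_set; move/subsetPset: (ndF _ _ ij); apply.
      by rewrite subrr normr0 ltW.
    exists 0%N => // j _; rewrite !indicE !in_setI.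
    rewrite (_ : x \in \bigcup_i F i = false); last by apply/negbTE/negP => /set_mem.
    rewrite (_ : x \in F j = false); last first.
      by apply/negbTE/negP => /set_mem ?; apply: nF; exists j.
    by rewrite subrr normr0 ltW.
  have /cvgr0Pnorm_le/(_ _ e0)[N _ hN] := L2_dominated_cvg hU mI dI cI.
  exists (\1_(F N `&` `]a, b]%classic)); split; first exact: L2_indic_itv_setI.
    by have [] := HF N.
  by have := hN N (leqnn N); rewrite ger0_norm// L2_norm_ge0.
Qed.

Import HBNNSimple.

Lemma test_approx_simple (h : {nnsfun (measurableTypeR R) >-> R}) (a b : R) :
  test_approx (fun x => h x * \1_(`]a, b]%classic) x).
Proof.
have E : (fun x => h x * \1_(`]a, b]%classic) x) =
    fun x => \sum_(y <- finmap.enum_fset (fset_set (range h))) y * \1_(h @^-1` [set y] `&` `]a, b]%classic) x.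
  apply: funext => x; rewrite {1}fimfunE fsbig_finite//= mulr_suml.
  by apply: eq_bigr => y _; rewrite -mulrA !indicE in_setI; case: (_ \in _); rewrite ?mul1r ?mul0r.
have mA (y : R) : measurable (h @^-1` [set y]) by exact: measurable_sfunP.
rewrite {}E; set s := finmap.enum_fset _.
suff : L2 (fun x => \sum_(y <- s) y * \1_(h @^-1` [set y] `&` `]a, b]%classic) x) /\
  test_approx (fun x => \sum_(y <- s) y * \1_(h @^-1` [set y] `&` `]a, b]%classic) x).
  by case.
elim: s => [|y s [IH1 IH2]].
  by under eq_fun do rewrite big_nil; split; [exact: L2_0|exact: test_approx0].
under eq_fun do rewrite big_cons.
have hA := L2_indic_itv_setI a b (mA y).
split; first by apply: L2D => //; exact: L2Z.
by apply: test_approxD => //; [exact: L2Z|apply: test_approxZ => //; exact: (test_approx_indic a b (mA y))].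
Qed.

(** The standard simple approximants, cut off to []-n, n]], stay below [f] and converge pointwise,
    so dominated convergence gives L2 convergence. *)
Lemma test_approx_ge0 f : L2 f -> (forall x, 0 <= f x) -> test_approx f.
Proof.
move=> hf f0; have mf := L2_measurable hf.
have mf' : measurable_fun setT (EFin \o f) by exact/measurable_EFinP.
have ef0 x : setT x -> (0 <= (EFin \o f) x)%E by rewrite lee_fin.
pose h := @nnsfun_approx _ (measurableTypeR R) R setT measurableT (EFin \o f) mf'.
pose I n : R -> R := \1_(`]- n%:R, n%:R]%classic).
have hle n x : h n x <= f x by rewrite -lee_fin /h nnsfun_approxE; exact: le_approx.
have mh n : measurable_fun setT (fun x => h n x * I n x).
  by apply: measurable_funM => //; apply: measurable_indic; exact: measurable_itv.
have dh n x : `|h n x * I n x| <= `|f x|.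
  rewrite !ger0_norm ?mulr_ge0// /I indicE; case: (_ \in _); rewrite ?mulr1// mulr0//.
have ch x : h n x * I n x @[n --> \oo] --> f x.
  rewrite -[f x]mulr1; apply: cvgM.
    have hc : EFin \o (fun n => h n x) @ \oo --> (f x)%:E.
      exact: (@cvg_nnsfun_approx _ (measurableTypeR R) R setT measurableT (EFin \o f) mf' ef0 x Logic.I).
    exact: (fine_cvg hc).
  apply: cvg_near_cst; near=> n; rewrite /I indicE (_ : _ \in _ = true)//.
  apply/mem_set; rewrite /= in_itv/=.
  have : `|x| < n%:R by near: n; exact: nbhs_infty_gtr.
  by rewrite ltr_norml => /andP[-> /ltW ->].
apply: test_approx_cvg => // e e0.
have /cvgr0Pnorm_le/(_ _ e0)[N _ hN] := L2_dominated_cvg hf mh dh ch.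
exists (fun x => h N x * I N x); split.
- exact: (L2_dom (mh N) hf (dh N)).
- exact: test_approx_simple.
- by have := hN N (leqnn N); rewrite ger0_norm// L2_norm_ge0.
Unshelve. all: by end_near. Qed.

Theorem test_dense f : L2 f -> test_approx f.
Proof.
move=> hf; have mf := L2_measurable hf.
have hmax g : L2 g -> L2 (fun x => Num.max (g x) 0).
  move=> hg; apply: (L2_dom _ hg); first by apply: measurable_maxr; [exact: (L2_measurable hg)|exact: measurable_cst].
  by move=> x; rewrite /Num.max; case: ifP; rewrite ?normr0.
have E : f = fun x => Num.max (f x) 0 + (-1) * Num.max (- f x) 0.
  apply: funext => x; rewrite /Num.max oppr_lt0 mulN1r.
  by case: ltgtP => [||->]; rewrite ?oppr0 ?opprK ?addr0 ?add0r.
have max0 (y : R) : 0 <= Num.max y 0 by rewrite le_max lexx orbT.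
have hfp := hmax _ hf; have hfn := hmax _ (L2N hf).
rewrite {}E; apply: test_approxD => //; first exact: L2Z.
  exact: test_approx_ge0.
by apply: test_approxZ => //; exact: test_approx_ge0.
Qed.

End test_functions.

(** * Duality with test functions and translations in L2 *)

Section transport.
Context (R : realType).
Implicit Types (f g h phi psi : R -> R).
Local Notation mu := (@lebesgue_measure R).

(** By density [f] itself is almost an admissible test function: with [phi] within [e] of [f],
    splitting [ip f f] into [ip f phi + ip f (f - phi)] gives [key]. *)
Lemma L2_norm_le_test f (M : R) : L2 f -> 0 <= M ->
  (forall phi, test_function phi -> `|ip f phi| <= M * L2_norm phi) -> L2_norm f <= M.
Proof.
move=> hf M0 fM; have f0 := L2_norm_ge0 f.
have key (e : R) : 0 < e -> L2_norm f * (L2_norm f - M) <= e * (M + L2_norm f).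
  move=> e0; have [phi [tphi fphi]] := test_dense hf e0.
  have hphi := test_L2 tphi; have hB := L2B hf hphi.
  have E : L2_norm f ^+ 2 = ip f phi + ip f (fun x => f x - phi x).
    by rewrite L2_norm2// -ipDr//; congr ip; apply: funext => x; rewrite addrC subrK.
  have := le_trans (ler_norm _) (fM _ tphi).
  have := le_trans (ler_norm _) (ip_CauchySchwarz hf hB).
  have : L2_norm phi <= L2_norm f + e.
    have := L2_normB hf hB; rewrite (_ : (fun x => f x - (f x - phi x)) = phi); first by lra.
    by apply: funext => x; rewrite subKr.
  move: E fphi; set a := L2_norm (fun x => _); set b := ip f _; set c := ip f _.
  have a0 : 0 <= a by exact: L2_norm_ge0.
  by nra.
rewrite leNgt; apply/negP => Mf.
have P : 0 < L2_norm f * (L2_norm f - M) by rewrite mulr_gt0 ?subr_gt0// (le_lt_trans M0).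
have Q : 0 < M + L2_norm f by rewrite ltr_wpDl// (le_lt_trans M0).
(* With [e] half of the critical ratio, [key] would bound a positive number by its half. *)
have := key _ (divr_gt0 (divr_gt0 P Q) (ltr0n R 2)).
by rewrite mulrAC divfK ?gt_eqF//; lra.
Qed.

Lemma test_separates f g : L2 f -> L2 g ->
  (forall phi, test_function phi -> ip f phi = ip g phi) ->
  L2_norm (fun x => f x - g x) = 0.
Proof.
move=> hf hg fg; apply/eqP; rewrite eq_le L2_norm_ge0 andbT.
apply: L2_norm_le_test => //; first exact: L2B.
by move=> phi tphi; have := test_L2 tphi => hphi; rewrite ipBl// fg// subrr normr0 mul0r.
Qed.

Lemma measurable_shift (a : R) : measurable_fun setT (fun x : R => x + a).
Proof. by apply: measurable_funD => //; exact: measurable_cst. Qed.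

(** Lebesgue measure is determined by its values on half-open intervals, and these are translation
    invariant. *)
Lemma lebesgue_measure_shift (a : R) (A : set R) : measurable A ->
  pushforward mu ((fun x : R => x + a) : measurableTypeR R -> measurableTypeR R) A = mu A.
Proof.
move=> mA.
pose phi : {mfun measurableTypeR R >-> measurableTypeR R} :=
  HB.pack (fun x : R => x + a)
    (isMeasurableFun.Build _ _ (measurableTypeR R) (measurableTypeR R) _ (measurable_shift a)).
apply/esym/(@lebesgue_measure_unique R (pushforward mu phi)) => //= _ [[b c]] _ <-.
rewrite /pushforward.
have -> : phi @^-1` `]b, c]%classic = `](b - a), (c - a)]%classic.
  by rewrite predeqE => x /=; rewrite !in_itv/= ltrBlDr lerBrDr.
rewrite !lebesgue_measure_itv/= !lte_fin ltrD2r; case: ifP => // _.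
by rewrite -!EFinB; congr EFin; lra.
Qed.

Lemma near0_le (e : R) : 0 < e -> \forall k \near (0 : R), `|k| <= e.
Proof.
move=> e0; exists e => //= k /=; rewrite sub0r normrN; exact: ltW.
Qed.

Lemma ge0_integral_shift (a : R) (f : R -> \bar R) : measurable_fun setT f ->
  (forall x, (0 <= f x)%E) -> (\int[mu]_x f (x + a)%R = \int[mu]_x f x)%E.
Proof.
move=> mf f0.
have := @ge0_integral_pushforward _ _ (measurableTypeR R) (measurableTypeR R) R
  _ (measurable_shift a) mu setT f measurableT mf (fun x _ => f0 x).
rewrite preimage_setT => <-.
apply: eq_measure_integral; first exact: measurable_shift.
by move=> ? A mA _; exact: (lebesgue_measure_shift a mA).
Qed.

Lemma L2_shift (a : R) f : L2 f -> L2 (fun x => f (x + a)).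
Proof.
move=> /L2P[mf /integrableP[mf2 fi]].
have mfa : measurable_fun setT (fun x : R => f (x + a)).
  by apply: (measurableT_comp mf); exact: measurable_shift.
apply/L2P; split=> //; apply/integrableP; split.
  by apply/measurable_EFinP; exact: measurable_funX.
have := @ge0_integral_shift a (fun x => `|(f x ^+ 2)%:E|)%E.
rewrite /= => ->//.
by apply/measurable_EFinP; apply: measurableT_comp => //; exact: measurable_funX.
Qed.

Lemma ip_shift (a : R) f g : L2 f -> L2 g ->
  ip (fun x => f (x + a)) (fun x => g (x + a)) = ip f g.
Proof.
move=> hf hg; have hfa := L2_shift a hf; have hga := L2_shift a hg.
have mfg : measurable_fun setT (EFin \o (fun x => f x * g x)).
  by have /integrableP[] := L2_integrableM hf hg.
have ifg : mu.-integrable (((fun x => x + a) : R -> R) @^-1` setT)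
    ((EFin \o (fun x => f x * g x)) \o (fun x => x + a)).
  by rewrite preimage_setT; exact: (L2_integrableM hfa hga).
rewrite /ip /Rintegral; congr fine.
have := @integral_pushforward _ _ (measurableTypeR R) (measurableTypeR R) R
  _ (measurable_shift a) mu setT _ mfg ifg measurableT.
rewrite preimage_setT => /esym.
rewrite /comp => ->.
apply: eq_measure_integral; first exact: measurable_shift.
by move=> ? A mA _; exact: (lebesgue_measure_shift a mA).
Qed.

Lemma L2_norm_shift (a : R) f : L2 f -> L2_norm (fun x => f (x + a)) = L2_norm f.
Proof. by move=> hf; rewrite !L2_normE ?ip_shift//; exact: L2_shift. Qed.

(** No order between [x] and [y] is imposed: increments in space and in time have either sign, and
    only the distance of the intermediate point to [x] matters later. *)
Lemma MVT_between f (df : R -> R) (x y : R) : (forall z : R, is_derive z (1 : R) f (df z)) ->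
  exists c : R, `|c - x| <= `|y - x| /\ f y - f x = df c * (y - x).
Proof.
move=> fdf.
have cf (i : interval R) : {within [set` i], continuous f}.
  by apply: derivable_within_continuous => z _; have [] := fdf z.
have [xy|yx] := leP x y.
  have [c] := MVT_segment xy (fun z _ => fdf z) (cf _).
  rewrite in_itv/= => /andP[xc cy] ->; exists c; split=> //.
  by rewrite !ger0_norm ?subr_ge0// lerD2r.
have [c] := MVT_segment (ltW yx) (fun z _ => fdf z) (cf _).
rewrite in_itv/= => /andP[yc cx] E; exists c; split; last by lra.
by rewrite distrC (distrC y) !ger0_norm ?subr_ge0 ?(ltW yx)// lerD2l lerN2.
Qed.

Lemma test_shift_diff phi : test_function phi -> exists C : R, 0 <= C /\
  forall k : R, `|k| <= 1 -> L2_norm (fun x => phi (x + k) - phi x) <= C * `|k|.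
Proof.
move=> tphi; have [B [B0 hB]] := test_bounded (test_derive tphi).
have /test_functionP[_ [M [M0 hM]]] := tphi.
exists (B * Num.sqrt (M + 1 - - (M + 1))); split; first by rewrite mulr_ge0.
move=> k k1; rewrite mulrAC.
apply: (proj2 (@L2_bounded R _ (- (M + 1)) (M + 1) (B * `|k|) _ _ _ _ _)).
- by apply: L2_measurable; apply: L2B; apply: test_L2 => //; exact: test_shift.
- by lra.
- by rewrite mulr_ge0.
- move=> x; have [c [_ ->]] := MVT_between x (x + k) (test_isd tphi).
  by rewrite addrAC subrr add0r normrM ler_wpM2r.
- move=> x xM; have {}xM : M + 1 <= `|x|.
    rewrite leNgt ltr_norml; apply/negP => /andP[x1 x2].
    by apply: xM; rewrite x1 ltW.
  rewrite !hM ?subrr//; first by lra.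
  by have := ler_normB (x + k) k; rewrite addrK; lra.
Qed.

Lemma test_taylor phi : test_function phi -> exists C : R, 0 <= C /\
  forall k : R, `|k| <= 1 ->
    L2_norm (fun x => phi (x + k) - phi x - k * derive1 phi x) <= C * k ^+ 2.
Proof.
move=> tphi; have tphi' := test_derive tphi.
have [B [B0 hB]] := test_bounded (test_derive tphi').
have /test_functionP[_ [M [M0 hM]]] := tphi.
have /test_functionP[_ [M' [M'0 hM']]] := tphi'.
pose N := M + M' + 1.
exists (B * Num.sqrt (N - - N)); split; first by rewrite mulr_ge0.
move=> k k1; rewrite mulrAC.
have hk := L2Z k (test_L2 tphi').
apply: (proj2 (@L2_bounded R _ (- N) N (B * k ^+ 2) _ _ _ _ _)).
- apply: L2_measurable; apply: L2B => //; apply: L2B; apply: test_L2 => //; exact: test_shift.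
- by rewrite /N; lra.
- by rewrite mulr_ge0 ?sqr_ge0.
- move=> x; have [c [cx ->]] := MVT_between x (x + k) (test_isd tphi).
  rewrite addrAC subrr add0r in cx *.
  rewrite mulrC -mulrBr normrM -(real_normK (num_real k)) expr2 mulrCA ler_wpM2l//.
  have [c' [_ ->]] := MVT_between x c (test_isd tphi').
  by rewrite normrM ler_pM.
- move=> x xM; have {}xM : N <= `|x|.
    rewrite leNgt ltr_norml; apply/negP => /andP[x1 x2].
    by apply: xM; rewrite x1 ltW.
  rewrite /N in xM; rewrite !hM ?hM' ?mulr0 ?subrr//; try lra.
  by have := ler_normB (x + k) k; rewrite addrK; lra.
Qed.

(** Strong continuity of translations: clear on test functions, and it passes to L2 by density
    because translations are isometries. *)
Lemma L2_shift_cvg f : L2 f -> forall e : R, 0 < e ->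
  \forall k \near (0 : R), L2_norm (fun x => f (x + k) - f x) <= e.
Proof.
move=> hf e e0; have e4 : 0 < e / 4 by rewrite divr_gt0.
have [phi [tphi fphi]] := test_dense hf e4; have hphi := test_L2 tphi.
have [C [C0 hC]] := test_shift_diff tphi.
have C1 : 0 < C + 1 by rewrite ltr_wpDl.
near=> k.
have k1 : `|k| <= 1 by near: k; apply: near0_le.
have kC : `|k| <= e / 4 / (C + 1) by near: k; apply: near0_le; rewrite divr_gt0.
have hfk := L2_shift k hf; have hphik := L2_shift k hphi.
apply: (le_trans (L2_norm_dist_tri hfk hf hphik)).
have -> : L2_norm (fun x => f (x + k) - phi (x + k)) = L2_norm (fun x => f x - phi x).
  exact: (L2_norm_shift k (L2B hf hphi)).
have := L2_norm_dist_tri hphik hf hphi; rewrite (L2_norm_distC phi f).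
have := hC _ k1.
have : C * `|k| <= e / 4.
  apply: (@le_trans _ _ ((C + 1) * (e / 4 / (C + 1)))); last by rewrite mulrC divfK// gt_eqF.
  by rewrite ler_pM// lerDl.
by move: fphi; lra.
Unshelve. all: by end_near. Qed.

(** Free of division and valid at [h = 0], this form lets error terms be added up in full
    neighbourhoods of [0]. *)
Lemma is_derive1_leP f (t d : R) : is_derive t (1 : R) f d <->
  forall e : R, 0 < e -> \forall h \near (0 : R), `|f (t + h) - f t - h * d| <= e * `|h|.
Proof.
rewrite is_derive1P; split=> [/cvgrPdist_le fd e e0|fd].
  have := fd _ e0; rewrite near_withinE => {}fd; near=> h.
  have [->|h0] := eqVneq h 0; first by rewrite addr0 mul0r subrr subr0 normr0 mulr0.
  have : `|d - h^-1 * (f (t + h) - f t)| <= e by move: h0; near: h.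
  rewrite -(ler_pM2r (_ : 0 < `|h|)) ?normr_gt0// -normrM distrC.
  by rewrite mulrBl mulrAC mulVf// mul1r (mulrC d).
apply/cvgrPdist_le => e e0; rewrite near_withinE.
have := fd _ e0; apply: filterS => h hd h0.
rewrite distrC -(ler_pM2r (_ : 0 < `|h|)) ?normr_gt0// -normrM.
by rewrite mulrBl mulrAC mulVf// mul1r (mulrC d).
Unshelve. all: by end_near. Qed.

(** * Weak solutions of the transport equation *)

Section transport_equation.
Variables (p f : R -> R -> R) (sg : R).
Hypothesis (hp : forall t, L2 (p t)) (hf : forall t, L2 (f t)).
Hypothesis cp : forall t, L2_norm (fun x => p s x - p t x) @[s --> t] --> (0 : R).
Hypothesis cf : forall t, L2_norm (fun x => f s x - f t x) @[s --> t] --> (0 : R).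
(* The weak form of [p_t - sg * p_x = - f]. *)
Hypothesis eqp : forall phi, test_function phi -> forall t : R,
  is_derive t (1 : R) (fun s => ip (p s) phi)
    (- sg * ip (p t) (derive1 phi) - ip (f t) phi).

Let near_le0 (g : R -> R) (t : R) : g s @[s --> t] --> (0 : R) ->
  forall e : R, 0 < e -> \forall h \near (0 : R), `|g (t + h)| <= e.
Proof.
move=> /cvgr0Pnorm_le cg e e0; have [d /= d0 hd] := cg _ e0.
exists d => //= h /=; rewrite sub0r normrN => hd'; apply: hd => /=.
by rewrite opprD addNKr normrN.
Qed.

(** A test function carried along the characteristics contributes [sg * ip (p t) phi'], which
    cancels the derivative term of the weak equation and leaves only the source. *)
Lemma is_derive_characteristic phi : test_function phi -> forall t : R,
  is_derive t (1 : R) (fun s => ip (p s) (fun x => phi (x + sg * s)))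
    (- ip (f t) (fun x => phi (x + sg * t))).
Proof.
move=> tphi t; pose psi x := phi (x + sg * t).
have tpsi : test_function psi by exact: test_shift.
have hpsi := test_L2 tpsi; have hpsi' := test_L2 (test_derive tpsi).
have [C [C0 hC]] := test_shift_diff tpsi.
have [D [D0 hD]] := test_taylor tpsi.
have E (h : R) : (fun x => phi (x + sg * (t + h))) = fun x => psi (x + sg * h).
  by apply: funext => x; rewrite /psi; congr phi; lra.
apply/is_derive1_leP => e e0.
have /is_derive1_leP dp := eqp tpsi t.
pose A := C * `|sg|; pose B := L2_norm (p t) * D * sg ^+ 2.
have A0 : 0 <= A by rewrite mulr_ge0.
have B0 : 0 <= B by apply: mulr_ge0; [apply: mulr_ge0 => //; exact: L2_norm_ge0|exact: sqr_ge0].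
have s1 : 0 < `|sg| + 1 by rewrite ltr_wpDl.
near=> h.
have h1 : `|ip (p (t + h)) psi - ip (p t) psi -
    h * (- sg * ip (p t) (derive1 psi) - ip (f t) psi)| <= e / 3 * `|h|.
  by near: h; apply: dp; rewrite divr_gt0.
have h2 : `|L2_norm (fun x => p (t + h) x - p t x)| <= e / 3 / (A + 1).
  by near: h; apply: (near_le0 (cp t)); rewrite !divr_gt0// ltr_wpDl.
have h3 : `|h| <= (`|sg| + 1)^-1 by near: h; apply: near0_le; rewrite invr_gt0.
have h4 : `|h| <= e / 3 / (B + 1) by near: h; apply: near0_le; rewrite !divr_gt0// ltr_wpDl.
have sh1 : `|sg * h| <= 1.
  rewrite normrM (le_trans (ler_wpM2l (normr_ge0 _) h3))// ler_pdivrMr// mul1r lerDl//.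
have hpsih : L2 (fun x => psi (x + sg * h)) by exact: L2_shift.
have hdp := L2B (hp (t + h)) (hp t); have hdpsi := L2B hpsih hpsi.
have hZ := L2Z (sg * h) hpsi'.
rewrite E.
have -> : (fun x => phi (x + sg * t)) = psi by [].
have R1 : `|ip (p t) (fun x => psi (x + sg * h) - psi x - sg * h * derive1 psi x)|
    <= e / 3 * `|h|.
  apply: (le_trans (ip_CauchySchwarz (hp t) (L2B hdpsi hZ))).
  apply: (@le_trans _ _ (L2_norm (p t) * (D * (sg * h) ^+ 2))).
    by rewrite ler_wpM2l ?L2_norm_ge0// hD.
  have -> : L2_norm (p t) * (D * (sg * h) ^+ 2) = B * `|h| * `|h|.
    by rewrite /B -(real_normK (num_real (sg * h))) normrM -(real_normK (num_real sg)); ring.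
  rewrite ler_wpM2r//; apply: (@le_trans _ _ ((B + 1) * (e / 3 / (B + 1)))).
    by rewrite ler_pM// lerDl.
  by rewrite mulrC divfK// gt_eqF// ltr_wpDl.
have R2 : `|ip (fun x => p (t + h) x - p t x) (fun x => psi (x + sg * h) - psi x)|
    <= e / 3 * `|h|.
  apply: (le_trans (ip_CauchySchwarz hdp hdpsi)).
  apply: (@le_trans _ _ (e / 3 / (A + 1) * (A * `|h|))).
    rewrite ler_pM ?L2_norm_ge0//; first exact: le_trans (ler_norm _) h2.
    by rewrite /A -mulrA -normrM hC.
  rewrite mulrA ler_wpM2r// -[leRHS](@divfK _ (A + 1)) ?gt_eqF ?ltr_wpDl//.
  apply: ler_wpM2l; last by rewrite lerDl.
  by apply: divr_ge0; [apply: divr_ge0 => //; exact: ltW|exact: addr_ge0].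
move: R1 R2 h1; rewrite ipBr ?ipZr ?ipBr ?ipBl//.
move=> R1 R2 h1.
have := ler_normD (ip (p (t + h)) psi - ip (p t) psi -
    h * (- sg * ip (p t) (derive1 psi) - ip (f t) psi))
  (ip (p t) (fun x => psi (x + sg * h)) - ip (p t) psi - sg * h * ip (p t) (derive1 psi)).
set a := (X in `|X| <= _) => Na.
have := ler_normD a (ip (p (t + h)) (fun x => psi (x + sg * h)) -
   ip (p t) (fun x => psi (x + sg * h)) - (ip (p (t + h)) psi - ip (p t) psi)).
set b := (X in `|X| <= _) => Nb.
set c := (X in `|X| <= _).
have -> : c = b by rewrite /c /b /a; lra.
apply: (le_trans Nb); move: Na R1 R2 h1; lra.
Unshelve. all: by end_near. Qed.

(** Duhamel's formula to first order along characteristics, obtained by duality from the mean value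
    theorem for one moving test function. The intermediate time depends on the test function, hence
    the hypothesis uniform in [k]. *)
Lemma transport_increment (t h w : R) :
  (forall k : R, `|k| <= `|h| -> L2_norm (fun x => f (t + k) (x + - sg * k) - f t x) <= w) ->
  L2_norm (fun x => p (t + h) (x + - sg * h) - p t x + h * f t x) <= `|h| * w.
Proof.
move=> fw.
have w0 : 0 <= w by apply: le_trans (fw 0 _); rewrite ?normr0// L2_norm_ge0.
have hph := L2_shift (- sg * h) (hp (t + h)).
have hB := L2B hph (hp t); have hD := L2D hB (L2Z h (hf t)).
apply: L2_norm_le_test => //; first by rewrite mulr_ge0.
move=> psi tpsi; have hpsi := test_L2 tpsi.
pose phi x := psi (x + - sg * t).
have tphi : test_function phi by exact: test_shift.
have E s : (fun x => phi (x + sg * s)) = fun x => psi (x + sg * (s - t)).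
  by apply: funext => x; rewrite /phi; congr psi; lra.
have [c [ch]] := MVT_between t (t + h) (is_derive_characteristic tphi).
rewrite !E subrr mulr0 addrAC subrr add0r in ch *.
have E0 : (fun x => psi (x + 0)) = psi by apply: funext => x; rewrite addr0.
rewrite E0; set k := c - t in ch *; have -> : c = t + k by rewrite /k; lra.
have E2 (g : R -> R) (s : R) : L2 g -> ip g (fun x => psi (x + sg * s)) =
    ip (fun x => g (x + - sg * s)) psi.
  move=> hg; rewrite -(ip_shift (- sg * s) hg); last exact: L2_shift.
  by congr ip; apply: funext => x; congr psi; lra.
rewrite !E2// => E3.
have hfk := L2_shift (- sg * k) (hf (t + k)); have hBf := L2B hfk (hf t).
rewrite ipDl ?ipBl ?ipZl//; last exact: L2Z.
have -> : ip (fun x => p (t + h) (x + - sg * h)) psi - ip (p t) psi + h * ip (f t) psi =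
    - h * ip (fun x => f (t + k) (x + - sg * k) - f t x) psi.
  by rewrite ipBl//; lra.
rewrite normrM normrN -mulrA ler_wpM2l//.
apply: (le_trans (ip_CauchySchwarz hBf hpsi)).
by rewrite ler_wpM2r ?L2_norm_ge0// fw.
Qed.

(** Translating [p (t + h)] back along the characteristics preserves its norm and turns it into
    [p t - h * f t] up to [o(h)] in L2; expanding the square yields the derivative without any
    regularity of [p] in space. *)
Lemma transport_energy (t : R) :
  is_derive t (1 : R) (fun s => ip (p s) (p s)) (- 2 * ip (f t) (p t)).
Proof.
apply/is_derive1_leP => e e0.
pose P := L2_norm (p t); pose F := L2_norm (f t).
have P0 : 0 <= P by exact: L2_norm_ge0. have F0 : 0 <= F by exact: L2_norm_ge0.
(* [E] is the increment [D] along characteristics corrected by the source. The remainder is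
   [ip D D + 2 * ip E (p t)]; this [w] bounds the second term by [e / 2 * |h|], and the smallness
   [h3] does the same for the first. *)
pose w := e / (4 * (P + 1)).
have w0 : 0 < w by rewrite divr_gt0// mulr_gt0// ltr_wpDl.
have wP : 2 * w * P <= e / 2.
  rewrite /w ; apply: (@le_trans _ _ (2 * (e / (4 * (P + 1))) * (P + 1))).
    by rewrite ler_wpM2l ?lerDl// mulr_ge0// ltW.
  by rewrite le_eqVlt; apply/orP; left; apply/eqP; field; rewrite gt_eqF// ltr_wpDl.
have w2 : 0 < w / 2 by rewrite divr_gt0.
have [d1 /= d10 hd1] := near_le0 (cf t) w2.
have [d2 /= d20 hd2] := L2_shift_cvg (hf t) w2.
have s1 : 0 < `|sg| + 1 by rewrite ltr_wpDl.
near=> h.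
have h1 : `|h| <= d1 / 2 by near: h; apply: near0_le; rewrite divr_gt0.
have h2 : `|h| <= d2 / 2 / (`|sg| + 1) by near: h; apply: near0_le; rewrite !divr_gt0.
have h3 : `|h| <= e / 2 / (w + F) ^+ 2.
  by near: h; apply: near0_le; rewrite divr_gt0 ?divr_gt0// exprn_gt0// ltr_pwDl.
have hph := L2_shift (- sg * h) (hp (t + h)).
pose D x := p (t + h) (x + - sg * h) - p t x.
have hD : L2 D by exact: (L2B hph (hp t)).
have hZ := L2Z h (hf t).
pose E x := D x + h * f t x.
have hE : L2 E by exact: L2D.
have Eh : L2_norm E <= `|h| * w.
  apply: transport_increment => k kh.
  have hfk := L2_shift (- sg * k) (hf (t + k)); have hftk := L2_shift (- sg * k) (hf t).
  apply: (le_trans (L2_norm_dist_tri hfk (hf t) hftk)).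
  rewrite (splitr w) lerD//.
    have -> : L2_norm (fun x => f (t + k) (x + - sg * k) - f t (x + - sg * k)) =
        L2_norm (fun x => f (t + k) x - f t x).
      exact: (L2_norm_shift (- sg * k) (L2B (hf (t + k)) (hf t))).
    apply: le_trans (ler_norm _) _; apply: hd1 => /=.
    by rewrite sub0r normrN (le_lt_trans kh)// (le_lt_trans h1)// ltr_pdivrMr// ltr_pMr//; lra.
  apply: hd2 => /=; rewrite sub0r normrN normrM normrN.
  apply: (@le_lt_trans _ _ (`|sg| * (d2 / 2 / (`|sg| + 1)))).
    by rewrite ler_wpM2l// (le_trans kh).
  apply: (@le_lt_trans _ _ ((`|sg| + 1) * (d2 / 2 / (`|sg| + 1)))).
    by rewrite ler_wpM2r ?lerDl// !divr_ge0// ltW.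
  by rewrite mulrC divfK ?gt_eqF//; lra.
have Dh : L2_norm D <= `|h| * (w + F).
  have := L2_normB hE hZ; rewrite L2_normZ//.
  have -> : (fun x => E x - h * f t x) = D by apply: funext => x; rewrite /E addrK.
  by rewrite mulrDr; move: Eh; rewrite /F; lra.
have EP : `|ip E (p t)| <= `|h| * w * P.
  apply: (le_trans (ip_CauchySchwarz hE (hp t))).
  by rewrite ler_wpM2r.
have DD : ip D D <= e / 2 * `|h|.
  rewrite -L2_norm2//; apply: (@le_trans _ _ ((`|h| * (w + F)) ^+ 2)).
    by rewrite lerXn2r// nnegrE ?L2_norm_ge0// mulr_ge0// addr_ge0// ltW.
  rewrite exprMn expr2 mulrAC ler_wpM2r//.
  by rewrite -ler_pdivlMr// exprn_gt0// ltr_pwDl.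
have -> : ip (p (t + h)) (p (t + h)) - ip (p t) (p t) - h * (-2 * ip (f t) (p t)) =
    ip D D + 2 * ip E (p t).
  rewrite -(ip_shift (- sg * h) (hp (t + h)) (hp (t + h))).
  have -> : (fun x => p (t + h) (x + - sg * h)) = fun x => D x + p t x.
    by apply: funext => x; rewrite /D subrK.
  have hEi : ip E (p t) = ip D (p t) + h * ip (f t) (p t).
    by rewrite (ipDl hD hZ (hp t)) ipZl.
  rewrite hEi (ipDl hD (hp t) (L2D hD (hp t))).
  rewrite (ipDr hD (hp t) hD) (ipDr hD (hp t) (hp t)) (ipC (p t) D); lra.
have D0 := ip_ge0 D.
have hwP : `|h| * w * P * 2 <= e / 2 * `|h|.
  by have := ler_wpM2l (normr_ge0 h) wP; lra.
by move: EP; rewrite !ler_norml => /andP[E1 E2]; apply/andP; split; lra.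
Unshelve. all: by end_near. Qed.

End transport_equation.

End transport.

(** * Primitives of locally square integrable functions *)

Section absolute_continuity.
Context (R : realType).
Implicit Types (f g h w z phi psi : R -> R).
Local Notation mu := (@lebesgue_measure R).

Definition intI f (a b : R) : R := \int[mu]_(x in `[a, b]) f x.

Definition locL1 f := measurable_fun setT f /\
  forall a b : R, mu.-integrable `[a, b] (EFin \o f).

Definition locL2 f := measurable_fun setT f /\
  forall a b : R, mu.-integrable `[a, b] (EFin \o (fun x => f x ^+ 2)).

Lemma intI_integrable_dom f g (a b : R) : measurable_fun setT f ->
  mu.-integrable `[a, b] (EFin \o g) -> (forall x, a <= x <= b -> `|f x| <= `|g x|) ->
  mu.-integrable `[a, b] (EFin \o f).
Proof.
move=> mf ig fg; apply: (le_integrable _ _ _ ig) => //.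
by apply/measurable_EFinP; exact: measurable_funTS.
Qed.

Lemma continuous_intI_integrable f (a b : R) : continuous f ->
  mu.-integrable `[a, b] (EFin \o f).
Proof.
move=> cf; apply: continuous_compact_integrable; first exact: segment_compact.
exact: continuous_subspaceT.
Qed.

Lemma locL1_lin (c : R) f g : locL1 f -> locL1 g -> locL1 (fun x => c * f x + g x).
Proof.
move=> [mf hf] [mg hg]; split.
  by apply: measurable_funD => //; apply: measurable_funM => //; exact: measurable_cst.
move=> a b.
have h1 : mu.-integrable `[a, b] (EFin \o (fun x => c * f x)) by exact: (integrableZl _ c (hf a b)).
exact: (integrableD _ h1 (hg a b)).
Qed.

Lemma intI_lin (c : R) f g (a b : R) : locL1 f -> locL1 g ->
  intI (fun x => c * f x + g x) a b = c * intI f a b + intI g a b.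
Proof.
move=> [mf hf] [mg hg]; rewrite /intI -RintegralZl// RintegralD//.
exact: (integrableZl _ c (hf a b)).
Qed.

Lemma intI_cat f (a b c : R) : locL1 f -> a <= b -> b <= c ->
  intI f a c = intI f a b + intI f b c.
Proof.
move=> [mf hf] ab bc; rewrite /intI.
have := @Rintegral_itvB R f (BLeft a) (BRight c) b (hf a c).
rewrite !bnd_simp => /(_ ab bc).
rewrite Rintegral_itv_obnd_cbnd; last first.
  apply: integrableS (hf b c) => // x /=.
  by rewrite !in_itv/= => /andP[/ltW -> ->].
by move=> <-; rewrite addrC subrK.
Qed.

Lemma intI_le f g (a b : R) : locL1 f -> locL1 g -> (forall x, a <= x <= b -> f x <= g x) ->
  intI f a b <= intI g a b.
Proof.
by move=> [mf hf] [mg hg] fg; apply: le_Rintegral.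
Qed.

Lemma intI_cst (c a b : R) : a <= b -> intI (fun=> c) a b = c * (b - a).
Proof.
move=> ab; rewrite /intI Rintegral_cst//= lebesgue_measure_itv/= lte_fin.
have [//|ba] := ltP a b; have -> : a = b by apply/eqP; rewrite eq_le ab.
by rewrite subrr.
Qed.

Lemma intI_ge0 f (a b : R) : (forall x, a <= x <= b -> 0 <= f x) -> 0 <= intI f a b.
Proof. by move=> f0; apply: Rintegral_ge0 => x /=; rewrite in_itv/=; exact: f0. Qed.

Lemma intI_abs f (a b : R) : locL1 f -> `|intI f a b| <= intI (fun x => `|f x|) a b.
Proof. by move=> [mf hf]; exact: le_normr_Rintegral. Qed.

Lemma locL1_abs f : locL1 f -> locL1 (fun x => `|f x|).
Proof.
move=> [mf hf]; split; first exact: measurableT_comp.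
move=> a b; apply: intI_integrable_dom (hf a b) _; first exact: measurableT_comp.
by move=> x _; rewrite normr_id.
Qed.

Lemma continuous_locL1 f : continuous f -> locL1 f.
Proof.
by move=> cf; split; [exact: continuous_measurableT|move=> a b; exact: continuous_intI_integrable].
Qed.

Lemma locL2_locL1 f : locL2 f -> locL1 f.
Proof.
move=> [mf hf]; split=> // a b.
have h1 : mu.-integrable `[a, b] (EFin \o (fun x => 1 + f x ^+ 2)).
  have h0 : mu.-integrable `[a, b] (EFin \o (fun=> 1 : R)).
    by apply: continuous_intI_integrable => x; exact: cvg_cst.
  exact: (integrableD _ h0 (hf a b)).
apply: (intI_integrable_dom _ h1) => // x _.
rewrite [leRHS]ger0_norm ?addr_ge0 ?sqr_ge0// -(real_normK (num_real (f x))).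
by have := sqr_ge0 (`|f x| - 1); nra.
Qed.

Lemma locL2_sqr f : locL2 f -> locL1 (fun x => f x ^+ 2).
Proof. by move=> [mf hf]; split=> //; exact: measurable_funX. Qed.

Lemma L2_locL2 f : L2 f -> locL2 f.
Proof.
move=> hf; split; first exact: L2_measurable.
by move=> a b; apply: integrableS (L2_sqr_integrable hf) => //; exact: measurableT.
Qed.

Lemma locL2_lin (c : R) f g : locL2 f -> locL2 g -> locL2 (fun x => c * f x + g x).
Proof.
move=> [mf hf] [mg hg].
have mfg : measurable_fun setT (fun x => c * f x + g x).
  by apply: measurable_funD => //; apply: measurable_funM => //; exact: measurable_cst.
split=> // a b.
have h1 : mu.-integrable `[a, b] (EFin \o (fun x => (2 * c ^+ 2) * f x ^+ 2)).
  exact: (integrableZl _ (2 * c ^+ 2) (hf a b)).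
have h2 : mu.-integrable `[a, b] (EFin \o (fun x => 2 * g x ^+ 2)).
  exact: (integrableZl _ 2 (hg a b)).
have h3 := integrableD _ h1 h2.
apply: (intI_integrable_dom _ (h3 _)) => //; first exact: measurable_funX.
move=> x _; rewrite ger0_norm ?sqr_ge0// ger0_norm.
  by have := sqr_ge0 (c * f x - g x); nra.
by have := sqr_ge0 (c * f x); have := sqr_ge0 (g x); nra.
Qed.

Lemma locL2_mul f g : continuous g -> locL2 f -> locL2 (fun x => g x * f x).
Proof.
move=> cg [mf hf].
have mgf : measurable_fun setT (fun x => g x * f x).
  by apply: measurable_funM => //; exact: continuous_measurableT.
split=> // a b.
have [ab|ba] := leP a b; last first.
  by rewrite set_itv_ge ?bnd_simp -?ltNge//; exact: integrable_set0.
have cn : {within `[a, b], continuous (fun x => `|g x|)}.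
  by apply: continuous_subspaceT => x; apply: cvg_norm; exact: cg.
have [c _ hc] := EVT_max ab cn.
have h1 : mu.-integrable `[a, b] (EFin \o (fun x => g c ^+ 2 * f x ^+ 2)).
  exact: (integrableZl _ (g c ^+ 2) (hf a b)).
apply: (intI_integrable_dom _ h1); first exact: measurable_funX.
move=> x xab; rewrite exprMn [leLHS]normrM [leRHS]normrM ler_wpM2r// !normrX lerXn2r ?nnegrE//.
by apply: hc; rewrite in_itv.
Qed.

Lemma continuous_locL2 f : continuous f -> locL2 f.
Proof.
move=> cf; split; first exact: continuous_measurableT.
move=> a b; apply: continuous_intI_integrable => x.
by under [X in continuous_at _ X]eq_fun do rewrite expr2; apply: cvgM; exact: cf.
Qed.

Lemma intI_CauchySchwarz f (a b : R) : locL2 f -> a <= b ->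
  intI (fun x => `|f x|) a b ^+ 2 <= (b - a) * intI (fun x => f x ^+ 2) a b.
Proof.
move=> hf; rewrite le_eqVlt => /predU1P[->|ab].
  by rewrite /intI set_itv1 !Rintegral_set1 expr0n/= mulr0.
have hf1 := locL1_abs (locL2_locL1 hf); have hf2 := locL2_sqr hf.
(* [m] is the mean of [|f|]; the inequality is the nonnegativity of the integral of
   [(|f| - m) ^+ 2]. *)
set A := intI _ a b; set B := intI _ a b; set m := A / (b - a).
have ba : 0 < b - a by rewrite subr_gt0.
have c0 : locL1 (fun=> m ^+ 2) by apply: continuous_locL1 => x; exact: cvg_cst.
have hl := locL1_lin (- 2 * m) hf1 hf2.
have : 0 <= intI (fun x => 1 * (- 2 * m * `|f x| + f x ^+ 2) + m ^+ 2) a b.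
  apply: intI_ge0 => x _; rewrite -(real_normK (num_real (f x))).
  by have := sqr_ge0 (`|f x| - m); nra.
rewrite intI_lin// intI_lin// (intI_cst _ (ltW ab)) -/A -/B => h.
have : 0 <= (b - a) * (1 * (-2 * m * A + B) + m ^+ 2 * (b - a)) by rewrite mulr_ge0// ltW.
rewrite (_ : (b - a) * _ = (b - a) * B - A ^+ 2) ?subr_ge0//.
by rewrite /m; field; rewrite gt_eqF.
Qed.

(** Over [n + 1] equal pieces the bounds telescope to [(b - a) / (n + 1)] times the increment of
    [W], which tends to [0]. It stands in for almost everywhere differentiation in the chain
    rule. *)
Lemma increment_le_const (H W : R -> R) (a b : R) : a <= b ->
  (forall x y, a <= x -> x <= y -> y <= b -> `|H y - H x| <= (y - x) * (W y - W x)) ->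
  H a = H b.
Proof.
move=> ab HW; apply/eqP; rewrite -subr_eq0 -normr_le0 distrC.
have key n : `|H b - H a| <= (b - a) * (W b - W a) / n.+1%:R.
  pose s := (b - a) / n.+1%:R.
  have n0 : 0 < n.+1%:R :> R by rewrite ltr0n.
  have s0 : 0 <= s by rewrite divr_ge0// ?subr_ge0// ltW.
  have step k : (k <= n.+1)%N -> `|H (a + k%:R * s) - H a| <= s * (W (a + k%:R * s) - W a).
    elim: k => [_|k IH kn]; first by rewrite mul0r addr0 !subrr normr0 mulr0.
    have := IH (ltnW kn).
    have := HW (a + k%:R * s) (a + k.+1%:R * s) _ _ _.
    have e1 : a + k.+1%:R * s - (a + k%:R * s) = s by rewrite -natr1; lra.
    have l1 : a <= a + k%:R * s by rewrite lerDl mulr_ge0.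
    have l2 : a + k%:R * s <= a + k.+1%:R * s by rewrite -subr_ge0 e1.
    have l3 : a + k.+1%:R * s <= b.
      have : k.+1%:R * s <= n.+1%:R * s by rewrite ler_wpM2r// ler_nat.
      by rewrite [n.+1%:R * s]mulrC divfK ?gt_eqF//; lra.
    rewrite e1 => /(_ l1 l2 l3) h1 h2.
    have := ler_normD (H (a + k.+1%:R * s) - H (a + k%:R * s)) (H (a + k%:R * s) - H a).
    by rewrite addrA subrK; move: h1 h2; nra.
  have := step n.+1 (leqnn _).
  have -> : a + n.+1%:R * s = b by rewrite mulrC divfK ?gt_eqF//; lra.
  by rewrite /s mulrAC.
have hC : (b - a) * (W b - W a) / n.+1%:R @[n --> \oo] --> (0 : R).
  by rewrite -[X in _ --> X](mulr0 ((b - a) * (W b - W a))); apply: cvgMr; exact: cvg_harmonic.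
by apply: (ler_cvg_to (cvg_cst `|H b - H a|) hC); exact: nearW.
Qed.

(** The continuous representative of a function of class H1 locally, with its derivative [w] carried
    as data. Local square integrability is what makes the quadratic errors of the chain rule sum to
    zero. *)
Definition ac f w := [/\ continuous f, locL2 w &
  forall a b : R, a <= b -> f b - f a = intI w a b].

Lemma ac_lin (c : R) f g w z : ac f w -> ac g z ->
  ac (fun x => c * f x + g x) (fun x => c * w x + z x).
Proof.
move=> [cf hw fw] [cg hz gz]; split; last first.
- move=> a b ab; rewrite intI_lin; [|exact: locL2_locL1..].
  by rewrite -fw// -gz//; lra.
- exact: locL2_lin.
- by move=> x; apply: cvgD; [apply: cvgMr; exact: cf|exact: cg].
Qed.

Lemma ac_ext f g w z : ac f w -> f =1 g -> w =1 z -> ac g z.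
Proof. by move=> ? /funext <- /funext <-. Qed.

Lemma ac_C1 f g : (forall x : R, is_derive x (1 : R) f (g x)) -> continuous g -> ac f g.
Proof.
move=> fg cg; have cf : continuous f.
  by move=> x; apply: differentiable_continuous; apply/derivable1_diffP; have [] := fg x.
split=> //; first exact: continuous_locL2.
move=> a b; rewrite le_eqVlt => /predU1P[->|ab].
  by rewrite /intI set_itv1 Rintegral_set1 subrr.
rewrite /intI /Rintegral (@continuous_FTC2 _ _ f)//.
- exact: continuous_subspaceT.
- split.
  + by move=> x _; have [] := fg x.
  + exact/cvg_at_right_filter/cf.
  + exact/cvg_at_left_filter/cf.
- by move=> x _; rewrite derive1E; have [_] := fg x.
Qed.

(** The difference between [G (f x)] and the integral of the expected derivative has increments at
    most [2 * C] times the square of the integral of [|w|]; by Cauchy-Schwarz this is at most the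
    length times the increment of [W]. *)
Lemma ac_comp (G G1 : R -> R) (C : R) f w : 0 <= C -> continuous G -> continuous G1 ->
  (forall x y, `|G y - G x - G1 x * (y - x)| <= C * (y - x) ^+ 2) ->
  (forall x y, `|G1 y - G1 x| <= C * `|y - x|) ->
  ac f w -> ac (fun x => G (f x)) (fun x => G1 (f x) * w x).
Proof.
move=> C0 cG cG1 GG1 lG1 [cf hw fw].
have cGf : continuous (fun x => G (f x)).
  by move=> x; apply: (continuous_comp (cf x)); exact: cG.
have cG1f : continuous (fun x => G1 (f x)).
  by move=> x; apply: (continuous_comp (cf x)); exact: cG1.
have hGw : locL2 (fun x => G1 (f x) * w x) by exact: locL2_mul.
split=> // a b ab.
have hw1 := locL2_locL1 hw; have hwa := locL1_abs hw1; have hw2 := locL2_sqr hw.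
have hGw1 := locL2_locL1 hGw.
pose H x := G (f x) - intI (fun s => G1 (f s) * w s) a x.
pose W x := 2 * C * intI (fun s => w s ^+ 2) a x.
have : H a = H b.
  apply: (@increment_le_const H W a b ab) => x y ax xy yb.
  set A := intI (fun s => `|w s|) x y.
  have A0 : 0 <= A by apply: intI_ge0.
  have fA s : x <= s <= y -> `|f s - f x| <= A.
    move=> /andP[xs sy]; rewrite fw//; apply: (le_trans (intI_abs _ _ hw1)).
    by rewrite /A (intI_cat hwa xs sy) lerDl; apply: intI_ge0.
  (* [G1] is frozen at [f x]: what remains is a Taylor remainder of [G] and an integral against the
     variation of [G1]. *)
  have E1 : H y - H x = (G (f y) - G (f x) - G1 (f x) * (f y - f x)) -
      intI (fun s => (- G1 (f x)) * w s + G1 (f s) * w s) x y.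
    by rewrite /H (intI_cat hGw1 ax xy) intI_lin// -fw//; lra.
  have L1 := GG1 (f x) (f y).
  have L2' : `|f y - f x| <= A by apply: fA; rewrite xy lexx.
  have L3 : `|intI (fun s => (- G1 (f x)) * w s + G1 (f s) * w s) x y| <= C * A ^+ 2.
    have hl := locL1_lin (- G1 (f x)) hw1 hGw1.
    apply: (le_trans (intI_abs _ _ hl)).
    have -> : C * A ^+ 2 = intI (fun s => C * A * `|w s| + 0) x y.
      rewrite intI_lin//; last by apply: continuous_locL1 => ?; exact: cvg_cst.
      by rewrite intI_cst// -/A; lra.
    apply: intI_le.
    - exact: locL1_abs.
    - by apply: locL1_lin => //; apply: continuous_locL1 => ?; exact: cvg_cst.
    - move=> s sxy; rewrite addr0 mulNr addrC -mulrBl normrM ler_wpM2r//.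
      by apply: (le_trans (lG1 _ _)); rewrite ler_wpM2l// fA.
  have L4 : C * (f y - f x) ^+ 2 <= C * A ^+ 2.
    by rewrite ler_wpM2l// -(real_normK (num_real (f y - f x))) lerXn2r// nnegrE.
  have L5 := intI_CauchySchwarz hw xy.
  rewrite /W (intI_cat hw2 ax xy) E1.
  apply: (le_trans (ler_normB _ _)); rewrite -/A in L5.
  have := ler_wpM2l C0 L5; lra.
rewrite /H /intI set_itv1 Rintegral_set1; lra.
Qed.

Lemma ac_sqr f w : ac f w -> ac (fun x => f x ^+ 2) (fun x => 2 * f x * w x).
Proof.
apply: (@ac_comp (fun x => x ^+ 2) (fun x => 2 * x) 2) => //.
- by move=> x; under [X in continuous_at _ X]eq_fun do rewrite expr2; apply: cvgM.
- by move=> x; apply: cvgMr.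
- move=> x y; rewrite (_ : _ - _ - _ = (y - x) ^+ 2); last by lra.
  by rewrite ger0_norm ?sqr_ge0//; have := sqr_ge0 (y - x); lra.
- by move=> x y; rewrite -mulrBr normrM ger0_norm.
Qed.

(** By polarization from [ac_sqr]: [f * g] is a quarter of the difference of the squares of [f + g]
    and [g - f]. *)
Lemma ac_mul f g w z : ac f w -> ac g z ->
  ac (fun x => f x * g x) (fun x => w x * g x + f x * z x).
Proof.
move=> hf hg.
have h1 := ac_sqr (ac_lin 1 hf hg); have h2 := ac_sqr (ac_lin (- 1) hf hg).
have h0 : ac (fun=> 0 : R) (fun=> 0 : R).
  by apply: ac_C1 => x; exact: cvg_cst.
have h3 := ac_lin (1 / 4) h1 (ac_lin (- 1 / 4) h2 h0).
by apply: (ac_ext h3) => x /=; field.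
Qed.

Lemma compact_support_integral f (a b : R) : continuous f ->
  (forall x, ~ (a <= x <= b) -> f x = 0) ->
  mu.-integrable setT (EFin \o f) /\ \int[mu]_x f x = intI f a b.
Proof.
move=> cf f0.
have E x : (f \_ `[a, b]) x = f x.
  rewrite patchE; case: ifPn => // /negP xab; rewrite f0// => xab'.
  by apply: xab; rewrite inE/= in_itv.
split; last by rewrite /intI [RHS]Rintegral_mkcond; apply: eq_Rintegral => x _; rewrite E.
have := continuous_intI_integrable a b cf; rewrite integrable_mkcond// restrict_EFin.
by apply: eq_integrable => // x _ /=; rewrite E.
Qed.

Lemma sstep_derive0 (x : R) : (x < 0) || (1 < x) -> derive1 (@sstep R) x = 0.
Proof.
move=> x01; have [c hc] : exists c : R, {near x, cst c =1 @sstep R}.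
  case/orP: x01 => hx.
    exists 0; near=> y; rewrite sstep_le0// ltW//; near: y; exact: lt_nbhsl.
  exists 1; near=> y; rewrite sstep_ge1// ltW//; near: y; exact: lt_nbhsr.
by rewrite derive1E -(near_eq_derive (1 : R) hc) derive_cst.
Unshelve. all: by end_near. Qed.

Lemma sstep_derive_bounded : exists B : R, 0 <= B /\ forall x : R, `|derive1 (@sstep R) x| <= B.
Proof.
have cs : continuous (derive1 (@sstep R)).
  exact/smooth_continuous/smooth_derive1/smooth_sstep.
have cn : {within `[0, 1], continuous (fun x => `|derive1 (@sstep R) x|)}.
  by apply: continuous_subspaceT => x; apply: cvg_norm; exact: cs.
have [c _ hc] := EVT_max ler01 cn.
exists `|derive1 (@sstep R) c|; split; first exact: normr_ge0.
move=> x.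
have [x0|x0] := ltP x 0; first by rewrite sstep_derive0 ?x0// normr0.
have [x1|x1] := ltP 1 x; first by rewrite sstep_derive0 ?x1 ?orbT// normr0.
by apply: hc; rewrite in_itv/= x0.
Qed.

(* The functions [k * sstep' (k * (x - a))] are an approximate identity at [a]. *)
Lemma sstep_mollifier f (a : R) : continuous f -> forall e : R, 0 < e ->
  exists K : R, 0 < K /\ forall k : R, K <= k ->
  mu.-integrable setT (EFin \o (fun x => f x * (derive1 (@sstep R) (k * x + (- k * a)) * k))) /\
  `|\int[mu]_x (f x * (derive1 (@sstep R) (k * x + (- k * a)) * k)) - f a| <= e.
Proof.
move=> cf e e0; have [B [B0 hB]] := sstep_derive_bounded.
have cs : continuous (derive1 (@sstep R)).
  exact/smooth_continuous/smooth_derive1/smooth_sstep.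
(* The kernel is bounded by [B * k] and integrated over a length [3 / k], so this oscillation of [f]
   gives an error below [e]. *)
have e1 : 0 < e / (3 * (B + 1)) by rewrite divr_gt0// mulr_gt0// ltr_wpDl.
have /cvgrPdist_le/(_ _ e1)[d /= d0 hd] := cf a.
exists (3 / d); split; first by rewrite divr_gt0.
move=> k dk; have k0 : 0 < k by rewrite (lt_le_trans _ dk)// divr_gt0.
have ki0 : 0 < k^-1 by rewrite invr_gt0.
have kd : 3 * k^-1 <= d by rewrite ler_pdivrMr// mulrC -ler_pdivrMr.
pose D x := derive1 (@sstep R) (k * x + (- k * a)) * k.
have cD : continuous D.
  move=> x; apply: cvgMl; apply: continuous_comp; last exact: cs.
  by apply: cvgD; [apply: cvgMr; exact: cvg_id|exact: cvg_cst].
have aff : continuous (fun x => f x * D x) by move=> x; apply: cvgM; [exact: cf|exact: cD].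
(* The interval strictly contains the support of the kernel, with a margin [1 / k] on each side; all
   of it lies within [d] of [a]. *)
have D0 x : ~ (a - k^-1 <= x <= a + 2 * k^-1) -> D x = 0.
  move=> hx; rewrite /D sstep_derive0 ?mul0r//.
  rewrite mulNr -mulrBr pmulr_rlt0// -ltr_pdivrMl// mulr1.
  have [h1|h1] := ltP x a; first by rewrite subr_lt0 h1.
  rewrite orbC; apply/orP; left; rewrite ltNge; apply/negP => h2; apply: hx.
  by apply/andP; split; lra.
have ki3 : a - k^-1 <= a + 2 * k^-1 by lra.
have fD0 x : ~ (a - k^-1 <= x <= a + 2 * k^-1) -> f x * D x = 0.
  by move=> hx; rewrite D0// mulr0.
have [hi hI] := compact_support_integral aff fD0.
split=> //; rewrite -/(D _).
have acs : ac (fun x => sstep (k * x + (- k * a))) D.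
  apply: ac_C1 cD => x; apply: is_derive_affine.
  by apply: Cn_isd; exact: (smooth_sstep R 1).
have D1 : intI D (a - k^-1) (a + 2 * k^-1) = 1.
  have [_ _ /(_ _ _ ki3) <-] := acs.
  rewrite sstep_ge1 ?sstep_le0 ?subr0// !mulNr -mulrBr.
    by rewrite pmulr_rle0//; lra.
  by rewrite -ler_pdivrMl// mulr1; lra.
have hfD := continuous_locL1 aff; have hD := continuous_locL1 cD.
have hl := locL1_lin (- f a) hD hfD.
have hc : locL1 (fun=> e / (3 * (B + 1)) * (B * k)).
  by apply: continuous_locL1 => ?; exact: cvg_cst.
have -> : \int[mu]_x (f x * D x) - f a =
    intI (fun x => - f a * D x + f x * D x) (a - k^-1) (a + 2 * k^-1).
  by rewrite hI intI_lin// D1; lra.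
apply: (le_trans (intI_abs _ _ hl)).
apply: (@le_trans _ _ (intI (fun=> e / (3 * (B + 1)) * (B * k)) (a - k^-1) (a + 2 * k^-1))).
  apply: intI_le => //; first exact: locL1_abs.
  move=> x hx; rewrite mulNr addrC -mulrBl normrM ler_pM//.
    rewrite distrC; apply: hd => /=; rewrite distrC ltr_norml.
    by move: hx => /andP[hx1 hx2]; apply/andP; split; lra.
  by rewrite /D normrM (ger0_norm (ltW k0)) ler_wpM2r// ltW.
rewrite intI_cst//.
have -> : e / (3 * (B + 1)) * (B * k) * (a + 2 / k - (a - k^-1)) = e * (B / (B + 1)).
  by field; rewrite ?gt_eqF// ltr_wpDl.
by rewrite ler_piMr ?(ltW e0)// ler_pdivrMr ?ltr_wpDl// mul1r lerDl.
Qed.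

Lemma is_derive_trap (a b k x : R) : is_derive x (1 : R) (trap a b k)
  (derive1 (@sstep R) (k * x + (- k * a)) * k - derive1 (@sstep R) (k * x + (- k * b)) * k).
Proof.
have h c := @is_derive_affine R (@sstep R) k (- k * c) x _ (Cn_isd (smooth_sstep R 1) _).
exact: (is_deriveB (h a) (h b)).
Qed.

(** Tested against a steep trapezoid, the left-hand side of the weak formula tends to [f a - f b] by
    mollification at the two ends, while the right-hand side tends to minus the integral of [w] over
    [[a, b]]. *)
Lemma weak_derivative_ac f w : continuous f -> L2 w -> is_weak_derivative f w -> ac f w.
Proof.
move=> cf hw fw; split=> //; first exact: L2_locL2.
move=> a b ab; apply/eqP; rewrite -subr_eq0 -normr_le0.
have hI := L2_indic_itv a b.
have Iw : intI w a b = ip w \1_(`]a, b]%classic).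
  rewrite /intI -Rintegral_itv_obnd_cbnd; last first.
    by have [_ /(_ a b)] := locL2_locL1 (L2_locL2 hw); apply: integrableS => // x /=;
      rewrite !in_itv/= => /andP[/ltW -> ->].
  rewrite Rintegral_mkcond /ip; apply: eq_Rintegral => x _.
  by rewrite patchE indicE; case: ifPn => _; rewrite ?mulr1 ?mulr0.
have W0 := L2_norm_ge0 w.
apply/ler_addgt0Pr => e e0; rewrite add0r.
have e3 : 0 < e / 3 by rewrite divr_gt0.
have [Ka [Ka0 hKa]] := sstep_mollifier a cf e3.
have [Kb [Kb0 hKb]] := sstep_mollifier b cf e3.
(* As [k >= d ^- 2], the trapezoid is within [2 * d] of the indicator in L2, and [2 * d] times the
   norm of [w] is at most [e / 3]. *)
pose d := e / (6 * (L2_norm w + 1)).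
have d0 : 0 < d by rewrite divr_gt0// mulr_gt0// ltr_wpDl.
pose k := Ka + Kb + d ^- 2.
have d2 : 0 < d ^- 2 by rewrite invr_gt0 exprn_gt0.
have k0 : 0 < k by rewrite !addr_gt0.
have [kKa kKb] : Ka <= k /\ Kb <= k by rewrite /k; split; lra.
have tt := test_trap ab k0; have ht := test_L2 tt.
pose ga c x := f x * (derive1 (@sstep R) (k * x + (- k * c)) * k).
have E : \int[mu]_x (ga a x - ga b x) = - ip w (trap a b k).
  rewrite -(fw _ tt); apply: eq_Rintegral => x _.
  by rewrite derive1E; have [_ ->] := is_derive_trap a b k x; rewrite mulrBr.
have [ia ha] : mu.-integrable setT (EFin \o ga a) /\ `|\int[mu]_x ga a x - f a| <= e / 3.
  exact: (hKa k kKa).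
have [ib hb] : mu.-integrable setT (EFin \o ga b) /\ `|\int[mu]_x ga b x - f b| <= e / 3.
  exact: (hKb k kKb).
clearbody ga; rewrite (RintegralB measurableT ia ib) in E.
have R1 : `|ip w (trap a b k) - intI w a b| <= e / 3.
  rewrite Iw -ipBr//; apply: (le_trans (ip_CauchySchwarz hw (L2B ht hI))).
  apply: (@le_trans _ _ (L2_norm w * (2 * d))).
    rewrite ler_wpM2l//; apply: (le_trans (trap_L2_dist ab k0)); rewrite ler_wpM2l//.
    rewrite -[leRHS](ger0_norm (ltW d0)) -sqrtr_sqr ler_wsqrtr//.
    rewrite -[leRHS]invrK lef_pV2 ?posrE ?invr_gt0 ?exprn_gt0// /k; lra.
  rewrite /d; apply: (@le_trans _ _ ((L2_norm w + 1) * (2 * (e / (6 * (L2_norm w + 1)))))).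
    by rewrite ler_wpM2r ?lerDl// mulr_ge0// ltW.
  by rewrite le_eqVlt; apply/orP; left; apply/eqP; field; rewrite gt_eqF// ltr_wpDl.
move: ha hb R1; rewrite !ler_norml => /andP[? ?] /andP[? ?] /andP[? ?].
by apply/andP; split; lra.
Qed.

(** The product rule integrated over an interval so large that [phi] vanishes at both endpoints. *)
Lemma ac_weak_derivative f w : ac f w -> L2 w -> is_weak_derivative f w.
Proof.
move=> hf hw phi tphi; have [cf hlw _] := hf.
have tphi' := test_derive tphi.
have hphi : ac phi (derive1 phi).
  by apply: ac_C1; [exact: test_isd|exact: test_continuous].
have [_ hl E] := ac_mul hf hphi.
have /test_functionP[_ [M [M0 hM]]] := tphi.
have /test_functionP[_ [N [N0 hN]]] := tphi'.
pose L := M + N; have L0 : 0 < L by rewrite addr_gt0.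
have cfphi : continuous (fun x => f x * derive1 phi x).
  by move=> x; apply: cvgM; [exact: cf|exact: test_continuous].
have out x : ~ (- L <= x <= L) -> L <= `|x|.
  by move=> hx; rewrite leNgt; apply/negP; rewrite ltr_norml => /andP[? ?]; apply: hx; rewrite !ltW.
have fphi0 x : ~ (- L <= x <= L) -> f x * derive1 phi x = 0.
  by move=> /out Lx; rewrite hN ?mulr0//; move: Lx; rewrite /L; lra.
have [_ ->] := compact_support_integral cfphi fphi0.
have wphi : \int[mu]_x (w x * phi x) = intI (fun x => w x * phi x) (- L) L.
  rewrite /intI [RHS]Rintegral_mkcond; apply: eq_Rintegral => x _.
  rewrite patchE; case: ifPn => // /negP hx; rewrite hM ?mulr0//.
  have := out x; rewrite /L => h; have : L <= `|x|; last by rewrite /L; lra.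
  by apply: out => hx'; apply: hx; rewrite inE/= in_itv.
have hwphi : locL1 (fun x => w x * phi x).
  apply: locL2_locL1; have := locL2_mul (test_continuous tphi) hlw.
  by under eq_fun do rewrite mulrC.
have LL : - L <= L by lra.
have := E _ _ LL; rewrite !hM ?mulr0 ?subrr; try by rewrite ?normrN gtr0_norm// /L; lra.
have := intI_lin 1 (- L) L hwphi (continuous_locL1 cfphi).
rewrite mul1r; under [X in intI X]eq_fun do rewrite mul1r.
by move=> -> ; rewrite wphi; lra.
Qed.

End absolute_continuity.

(** * The space H1 and integrals over the whole line *)

Section H1_space.
Context (R : realType).
Implicit Types (f g h w z phi psi : R -> R).
Local Notation mu := (@lebesgue_measure R).

Lemma H1_L2 f : H1 f -> L2 f.
Proof. by case. Qed.

Lemma weak_derivativeP f : H1 f ->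
  L2 (weak_derivative f) /\ is_weak_derivative f (weak_derivative f).
Proof.
move=> [_ [w hw]]; rewrite /weak_derivative.
exact: (@xgetPex _ (cst 0) [set w | L2 w /\ is_weak_derivative f w] (ex_intro _ w hw)).
Qed.

Lemma weak_derivative_unique f w z : L2 w -> L2 z ->
  is_weak_derivative f w -> is_weak_derivative f z -> L2_norm (fun x => w x - z x) = 0.
Proof.
move=> hw hz fw fz; apply: test_separates => // phi tphi.
by apply: oppr_inj; rewrite /ip -(fw _ tphi) -(fz _ tphi).
Qed.

(** The chosen [weak_derivative] is determined only up to null sets, so an explicit derivative can
    be compared with it through its norm only. *)
Lemma H1_norm_weak_derivative f w : H1 f -> L2 w -> is_weak_derivative f w ->
  L2_norm (weak_derivative f) = L2_norm w.
Proof.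
move=> /weak_derivativeP[hd fd] hw fw; apply: L2_norm_eq => //.
exact: weak_derivative_unique fd fw.
Qed.

Lemma H1_lin (c : R) f g : H1 f -> H1 g -> H1 (fun x => c * f x + g x).
Proof.
move=> [hf [w [hw fw]]] [hg [z [hz gz]]]; split; first exact: L2_lin.
exists (fun x => c * w x + z x); split; first exact: L2_lin.
move=> phi tphi; have hphi := test_L2 tphi; have hphi' := test_L2 (test_derive tphi).
rewrite -/(ip (fun x => c * f x + g x) (derive1 phi)) -/(ip (fun x => c * w x + z x) phi).
by rewrite !ip_linl// /ip fw// gz//; lra.
Qed.

Lemma H1D f g : H1 f -> H1 g -> H1 (fun x => f x + g x).
Proof. by move=> hf hg; have := H1_lin 1 hf hg; under eq_fun do rewrite mul1r. Qed.

Lemma H1_ac f : continuous f -> H1 f -> ac f (weak_derivative f).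
Proof. by move=> cf /weak_derivativeP[hw fw]; exact: weak_derivative_ac. Qed.

Lemma ac_H1 f w : ac f w -> L2 f -> L2 w -> H1 f /\ L2_norm (weak_derivative f) = L2_norm w.
Proof.
move=> acf hf hw; have fw := ac_weak_derivative acf hw.
have h1f : H1 f by split=> //; exists w.
by split=> //; exact: H1_norm_weak_derivative.
Qed.

Lemma H1L2_closeP (u v u' v' w : R -> R) (r : R) : 0 <= r ->
  ac (fun x => u x - u' x) w -> L2 (fun x => u x - u' x) -> L2 w ->
  L2 (fun x => v x - v' x) ->
  L2_norm (fun x => u x - u' x) ^+ 2 + L2_norm w ^+ 2 +
    L2_norm (fun x => v x - v' x) ^+ 2 <= r ^+ 2 ->
  H1L2_close (u, v) (u', v') r.
Proof.
move=> r0 acw hu hw hv le_r; have [h1 h2] := ac_H1 acw hu hw.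
split; first by split.
rewrite /H1L2_norm /= -[leRHS]ger0_norm// -sqrtr_sqr ler_wsqrtr//.
by rewrite h2.
Qed.

Lemma H1L2_norm_ge (z : (R -> R) * (R -> R)) :
  [/\ L2_norm z.1 <= H1L2_norm z, L2_norm (weak_derivative z.1) <= H1L2_norm z &
      L2_norm z.2 <= H1L2_norm z].
Proof.
have a0 := sqr_ge0 (L2_norm z.1); have b0 := sqr_ge0 (L2_norm (weak_derivative z.1)).
have c0 := sqr_ge0 (L2_norm z.2).
by split; rewrite -[leLHS]ger0_norm ?L2_norm_ge0// -sqrtr_sqr ler_wsqrtr//; lra.
Qed.

Lemma itv_nat_bigcup : \bigcup_n `[- n%:R, n%:R]%classic = [set: R].
Proof.
rewrite -subTset => x _; exists (Num.bound `|x|) => //=.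
have : `|x| < (Num.bound `|x|)%:R by exact: archi_boundP.
by rewrite in_itv/= ltr_norml => /andP[/ltW -> /ltW ->].
Qed.

Lemma itv_nat_nd : nondecreasing_seq (fun n => `[- n%:R, n%:R]%classic : set R).
Proof.
move=> m n mn; apply/subsetPset => x /=; rewrite !in_itv/= => /andP[h1 h2].
have : m%:R <= n%:R :> R by rewrite ler_nat.
by move=> ?; apply/andP; split; lra.
Qed.

(** Monotone convergence on growing intervals; it converts a bound uniform in the interval into
    membership in L2, which is not known beforehand for the distance to a kink. *)
Lemma L2_of_bounded_intI f (M : R) : locL2 f ->
  (forall n : nat, intI (fun x => f x ^+ 2) (- n%:R) n%:R <= M) ->
  L2 f /\ L2_norm f ^+ 2 <= M.
Proof.
move=> [mf hf] fM; pose F n := `[- n%:R, n%:R]%classic : set R.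
have mf2 : measurable_fun setT (fun x => f x ^+ 2) by exact: measurable_funX.
have mF i : measurable (F i) by exact: measurable_itv.
have cv : (\int[mu]_(x in F i) (f x ^+ 2)%:E)%E @[i --> \oo] --> (\int[mu]_x (f x ^+ 2)%:E)%E.
  rewrite -itv_nat_bigcup; apply: ge0_nondecreasing_set_cvg_integral => //.
  - exact: itv_nat_nd.
  - by move=> i; apply/measurable_EFinP; exact: measurable_funTS.
  - by move=> n x _; rewrite lee_fin sqr_ge0.
have leM : (\int[mu]_x (f x ^+ 2)%:E <= M%:E)%E.
  rewrite -(cvg_lim _ cv)//; apply: lime_le; first by apply/cvg_ex; eexists; exact: cv.
  apply: nearW => n; have := fM n; rewrite -lee_fin /intI /Rintegral fineK//.
  exact: integrable_fin_num.
have hL : L2 f.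
  apply/L2P; split=> //; apply/integrableP; split; first exact/measurable_EFinP.
  under eq_integral do rewrite gee0_abs ?lee_fin ?sqr_ge0//.
  by rewrite (le_lt_trans leM)// ltry.
split=> //; rewrite L2_norm2// /ip /Rintegral -lee_fin fineK.
  by under eq_integral do rewrite -expr2.
by apply: integrable_fin_num => //; exact: L2_integrableM.
Qed.

Lemma intI_cvg_integral w : mu.-integrable setT (EFin \o w) ->
  intI w (- n%:R) n%:R @[n --> \oo] --> \int[mu]_x w x.
Proof.
move=> iw; have mw := measurable_int mu iw.
pose F n x := ((w \_ `[- n%:R, n%:R]) x)%:E.
have mF n : measurable_fun setT (F n).
  apply/measurable_EFinP; apply/(measurable_restrictT _ _).1 => //.
  by apply/measurable_EFinP; exact: measurable_funTS.
have cF : {ae mu, forall x, setT x -> F ^~ x @ \oo --> (EFin \o w) x}.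
  apply: aeW => x _; apply: cvg_near_cst; near=> n.
  rewrite /F patchE ifT//; apply/mem_set; rewrite /= in_itv/=.
  have : `|x| < n%:R by near: n; exact: nbhs_infty_gtr.
  by rewrite ltr_norml => /andP[/ltW -> /ltW ->].
have dF : {ae mu, forall x n, setT x -> (`|F n x| <= `|(EFin \o w) x|)%E}.
  apply: aeW => x n _; rewrite /F patchE; case: ifP => // _.
  by rewrite abse0 abse_ge0.
have [_ _ h] := @dominated_convergence _ _ _ mu setT measurableT F (EFin \o w)
  (fun x => `|(EFin \o w) x|%E) mF mw cF (integrable_abse iw) dF.
have fin : (\int[mu]_x (w x)%:E)%E \is a fin_num by exact: integrable_fin_num.
rewrite /Rintegral; apply: fine_cvg; rewrite fineK//.
apply: cvg_trans h; apply: near_eq_cvg; apply: nearW => n /=.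
by rewrite [RHS]integral_mkcond; apply: eq_integral => x _; rewrite restrict_EFin.
Unshelve. all: by end_near. Qed.

Lemma cvgn_pinfty (f : R -> R) (l : R) : f x @[x --> +oo] --> l -> f n%:R @[n --> \oo] --> l.
Proof. by move=> fl; apply: (cvg_comp _ _ _ fl); exact: cvgr_idn. Qed.

Lemma cvgn_ninfty (f : R -> R) (l : R) : f x @[x --> -oo] --> l -> f (- n%:R) @[n --> \oo] --> l.
Proof.
move=> /cvgNy_compNP fl.
exact: (@cvgn_pinfty (f \o -%R)).
Qed.

Lemma ac_integral f w (l m : R) : ac f w -> mu.-integrable setT (EFin \o w) ->
  f x @[x --> -oo] --> l -> f x @[x --> +oo] --> m -> \int[mu]_x w x = m - l.
Proof.
move=> [_ _ fw] iw /cvgn_ninfty fl /cvgn_pinfty fm.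
have h := intI_cvg_integral iw.
have h2 : f n%:R - f (- n%:R) @[n --> \oo] --> m - l by exact: cvgB.
have h3 : intI w (- n%:R) n%:R @[n --> \oo] --> m - l.
  apply: cvg_trans h2; apply: near_eq_cvg; apply: nearW => n /=.
  by rewrite fw//; have : 0 <= n%:R :> R by []; lra.
by rewrite -(cvg_lim (@Rhausdorff R) h) (cvg_lim (@Rhausdorff R) h3).
Qed.

Lemma taylor1_lipschitz (f df : R -> R) : (forall x : R, is_derive x (1 : R) f (df x)) ->
  (forall x y, `|df y - df x| <= `|y - x|) ->
  forall x y, `|f y - f x - df x * (y - x)| <= (y - x) ^+ 2.
Proof.
move=> fdf ldf x y; have [c [cx ->]] := MVT_between x y fdf.
rewrite -mulrBl normrM -(real_normK (num_real (y - x))) expr2 ler_wpM2r//.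
exact: le_trans (ldf _ _) cx.
Qed.

Lemma sin_lipschitz (x y : R) : `|sin y - sin x| <= `|y - x|.
Proof.
have [c [_ ->]] := MVT_between x y (@is_derive_sin R).
by rewrite normrM ler_piMl// ler_norml cos_geN1 cos_le1.
Qed.

Lemma cos_lipschitz (x y : R) : `|cos y - cos x| <= `|y - x|.
Proof.
have [c [_ ->]] := MVT_between x y (@is_derive_cos R).
by rewrite normrM normrN ler_piMl// ler_norml sin_geN1 sin_le1.
Qed.

Lemma sin_taylor (x y : R) : `|sin y - sin x - cos x * (y - x)| <= (y - x) ^+ 2.
Proof. have h := @taylor1_lipschitz sin cos (@is_derive_sin R) cos_lipschitz.
exact: h. Qed.

Lemma cos_taylor (x y : R) : `|cos y - cos x + sin x * (y - x)| <= (y - x) ^+ 2.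
Proof.
rewrite -[X in `|_ + X|]opprK -mulNr.
have h := @taylor1_lipschitz cos (fun x => - sin x) (@is_derive_cos R).
apply: h; move=> a b; by rewrite opprK addrC (distrC b a) sin_lipschitz.
Qed.

End H1_space.

(** * Half-angle formulas *)

Section half_angle.
Context (R : realType).

Lemma sin_half_angle (x : R) : sin x = 2 * (sin (x / 2) * cos (x / 2)).
Proof. by rewrite {1}(splitr x) sinD; ring. Qed.

Lemma cos_half_angle (x : R) : cos x = 1 - 2 * sin (x / 2) ^+ 2.
Proof. by rewrite {1}(splitr x) cosD -!expr2 cos2sin2; ring. Qed.

End half_angle.

(** * Conservation laws along the flow *)

Section sine_gordon_flow.
Context (R : realType).
Implicit Types (f g h z phi psi : R -> R).
Local Notation mu := (@lebesgue_measure R).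
Variables (u v : R -> R -> R) (K K1 : R -> R).
Hypothesis sol : sine_gordon_solution u v.
Hypotheses (acK : ac K K1) (hK1 : L2 K1) (uK : forall t, H1 (fun x => u t x - K x)).

(** The front [u t] is not in L2, so its derivative is taken relative to a reference profile [K]
    with the same limits: [K1], the derivative of [K], plus the weak derivative of the H1 function
    [u t - K]. *)
Definition space_derivative (t x : R) : R := K1 x + weak_derivative (fun y => u t y - K y) x.
Local Notation w := space_derivative.

Let uX t : X1 (u t, v t). Proof. by case: sol. Qed.
Let cu t : continuous (u t). Proof. by case: (uX t). Qed.
Let hv t : L2 (v t). Proof. by case: (uX t). Qed.
Let s t x := sin (u t x / 2).
Let hs t : L2 (s t). Proof. by case: (uX t) => _ []. Qed.

Lemma L2_space_derivative t : L2 (w t).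
Proof. by apply: L2D => //; have [] := weak_derivativeP (uK t). Qed.
Local Notation hw := L2_space_derivative.

Lemma ac_space_derivative t : ac (u t) (w t).
Proof.
have [cK _ _] := acK.
have cuK : continuous (fun x => u t x - K x).
  by move=> x; apply: cvgB; [exact: cu|exact: cK].
have := ac_lin 1 acK (H1_ac cuK (uK t)).
by move=> h; apply: (ac_ext h) => x; rewrite mul1r// addrC subrK.
Qed.

Lemma ac_continuous_comp (G G1 : R -> R) t : (forall x : R, is_derive x (1 : R) G (G1 x)) ->
  continuous G1 -> (forall x y, `|G1 y - G1 x| <= `|y - x|) ->
  ac (fun x => G (u t x)) (fun x => G1 (u t x) * w t x).
Proof.
move=> dG cG1 lG1; apply: (@ac_comp R G G1 1) => //.
- by move=> x; apply: differentiable_continuous; apply/derivable1_diffP; have [] := dG x.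
- by move=> x y; rewrite mul1r; exact: taylor1_lipschitz.
- by move=> x y; rewrite mul1r.
- exact: ac_space_derivative.
Qed.

Let f t x := sin (u t x).

Lemma L2_sin t : L2 (f t).
Proof.
apply: (L2_dom _ (L2Z 2 (hs t))).
  apply: continuous_measurableT => x.
  by apply: (@continuous_comp _ _ _ (u t) sin); [exact: cu|exact: continuous_sin].
move=> x; rewrite /f sin_half_angle !normrM ler_wpM2l// ler_piMr//.
by rewrite ler_norml cos_geN1 cos_le1.
Qed.
Local Notation hf := L2_sin.

Let udiff (a b : R) : L2 (fun x => u a x - u b x).
Proof. by have [_ /(_ a b) []] := sol. Qed.

(** Both sides are norms of derivatives of [u a - u b]. It transfers the H1 continuity of the curve
    to the L2 continuity of [t |-> w t]. *)
Let udiff_weak (a b : R) :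
  L2_norm (weak_derivative (u a \- u b)) = L2_norm (fun x => w a x - w b x).
Proof.
have hd : L2 (fun x => w a x - w b x) by apply: L2B; exact: hw.
have acd : ac (fun x => u a x - u b x) (fun x => w a x - w b x).
  have := ac_lin (-1) (ac_space_derivative b) (ac_space_derivative a).
  by move=> h; apply: (ac_ext h) => x; rewrite mulN1r addrC.
by have [] := ac_H1 acd (udiff a b) hd.
Qed.

Let cuvw t :
  [/\ L2_norm (fun x => u a x - u t x) @[a --> t] --> (0 : R),
      L2_norm (fun x => w a x - w t x) @[a --> t] --> (0 : R) &
      L2_norm (fun x => v a x - v t x) @[a --> t] --> (0 : R)].
Proof.
have [_ _ /(_ t) h _ _] := sol.
have sq (g : R -> R) : (forall a, 0 <= g a <= H1L2_norm (u a \- u t, v a \- v t)) ->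
    g a @[a --> t] --> (0 : R).
  move=> g0; apply: (squeeze_cvgr _ _ h); last exact: cvg_cst.
  exact: nearW.
split; apply: sq => a; have [h1 h2 h3] := H1L2_norm_ge (u a \- u t, v a \- v t).
- by rewrite L2_norm_ge0.
- by rewrite L2_norm_ge0 -udiff_weak.
- by rewrite L2_norm_ge0.
Qed.

Let cf t : L2_norm (fun x => f a x - f t x) @[a --> t] --> (0 : R).
Proof.
have [h _ _] := cuvw t; apply: (squeeze_cvgr _ _ h); last exact: cvg_cst.
apply: nearW => a; rewrite L2_norm_ge0/=; apply: L2_dom_norm => //.
  by apply: L2_measurable; apply: L2B; exact: hf.
by move=> x; exact: sin_lipschitz.
Qed.

Let u_increment t (e : R) : 0 < e -> \forall h \near (0 : R),
  L2_norm (fun x => u (t + h) x - u t x - h * v t x) <= e * `|h|.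
Proof.
move=> e0; have [_ _ _ /(_ t) /cvgr0Pnorm_le/(_ _ e0) + _] := sol.
rewrite near_withinE => hd; near=> h.
have [->|h0] := eqVneq h 0.
  under eq_fun do rewrite addr0 subrr mul0r subr0.
  by rewrite L2_norm0 normr0 mulr0.
have : `|L2_norm (fun x => (u (t + h) x - u t x) / h - v t x)| <= e by move: h0; near: h.
rewrite ger0_norm ?L2_norm_ge0//.
rewrite -(ler_pM2r (_ : 0 < `|h|)) ?normr_gt0// mulrC -L2_normZ; last first.
  by apply: L2B => //; under eq_fun do rewrite mulrC; exact: L2Z.
have -> // : (fun x => h * ((u (t + h) x - u t x) / h - v t x)) =
  (fun x => u (t + h) x - u t x - h * v t x).
by apply: funext => x; field.
Unshelve. all: by end_near. Qed.

(** This is [w_t = v_x] in weak form. The L2 differentiability of [u] is paired with [derive1 phi],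
    and integration by parts moves the derivative onto the increment of [u]. *)
Let w_weak t phi : test_function phi ->
  is_derive t (1 : R) (fun a => ip (w a) phi) (- ip (v t) (derive1 phi)).
Proof.
move=> tphi; have hphi := test_L2 tphi; have hphi' := test_L2 (test_derive tphi).
apply/is_derive1_leP => e e0; set C := L2_norm (derive1 phi).
have C0 : 0 < C + 1 by rewrite ltr_wpDl// L2_norm_ge0.
near=> h.
have hd : L2_norm (fun x => u (t + h) x - u t x - h * v t x) <= e / (C + 1) * `|h|.
  by near: h; apply: u_increment; rewrite divr_gt0.
have acd : ac (fun x => u (t + h) x - u t x) (fun x => w (t + h) x - w t x).
  have := ac_lin (-1) (ac_space_derivative t) (ac_space_derivative (t + h)).
  by move=> hh; apply: (ac_ext hh) => x; rewrite mulN1r addrC.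
have E : ip (w (t + h)) phi - ip (w t) phi =
    - ip (fun x => u (t + h) x - u t x) (derive1 phi).
  rewrite -ipBl//; [|exact: hw..].
  by rewrite /ip (ac_weak_derivative acd) ?opprK//; apply: L2B; exact: hw.
rewrite E mulrN opprK addrC.
have -> : h * ip (v t) (derive1 phi) - ip (fun x => u (t + h) x - u t x) (derive1 phi) =
    - ip (fun x => u (t + h) x - u t x - h * v t x) (derive1 phi).
  by rewrite [in RHS](ipBl (udiff (t + h) t) (L2Z h (hv t)) hphi') [in RHS](ipZl h (hv t) hphi') opprB.
have hdL : L2 (fun x => u (t + h) x - u t x - h * v t x) by apply: L2B => //; exact: L2Z.
rewrite normrN; apply: (le_trans (ip_CauchySchwarz hdL hphi')).
apply: (@le_trans _ _ (e / (C + 1) * `|h| * (C + 1))).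
  by rewrite ler_pM ?L2_norm_ge0// lerDl.
by rewrite mulrAC divfK// gt_eqF.
Unshelve. all: by end_near. Qed.

Let v_weak t phi : test_function phi ->
  is_derive t (1 : R) (fun a => ip (v a) phi) (- ip (w t) (derive1 phi) - ip (f t) phi).
Proof.
move=> tphi; have [_ _ _ _ /(_ phi tphi t)] := sol.
by rewrite (ac_weak_derivative (ac_space_derivative t) (hw t) (test_derive tphi)).
Qed.

(** Adding [sg] times [w_t = v_x] to [v_t = w_x - sin u] gives [p_t = sg * p_x - sin u] for
    [p = sg * w + v], because [sg ^+ 2 = 1]; then [transport_energy] applies. *)
Let energy_derivative (sg t : R) : sg ^+ 2 = 1 ->
  is_derive t (1 : R) (fun a => ip (fun x => sg * w a x + v a x) (fun x => sg * w a x + v a x))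
    (- 2 * (sg * ip (f t) (w t) + ip (f t) (v t))).
Proof.
move=> sg2; pose p a x := sg * w a x + v a x.
have hp a : L2 (p a) by apply: L2_lin => //; exact: hw.
have -> : sg * ip (f t) (w t) + ip (f t) (v t) = ip (f t) (p t).
  by rewrite (ipC (f t) (p t)) (ip_linl sg (hw t) (hv t) (hf t)) (ipC (w t)) (ipC (v t)).
apply: (@transport_energy R p f sg hp hf _ cf).
  move=> a; have [_ cw cv] := cuvw a.
  have cd : `|sg| * L2_norm (fun x => w b x - w a x) + L2_norm (fun x => v b x - v a x)
      @[b --> a] --> (0 : R).
    by rewrite -[X in _ --> X](addr0 0) -{1}(mulr0 `|sg|); apply: cvgD => //; apply: cvgMr.
  apply: (squeeze_cvgr _ _ cd); last exact: cvg_cst.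
  apply: nearW => b; rewrite L2_norm_ge0/= -L2_normZ; last by apply: L2B; exact: hw.
  have hd : L2 (fun x => w b x - w a x) by apply: L2B; exact: hw.
  apply: le_trans (L2_normD (L2Z sg hd) (L2B (hv b) (hv a))).
  rewrite le_eqVlt; apply/orP; left; apply/eqP; congr L2_norm.
  by apply: funext => x; rewrite /p; ring.
move=> phi tphi a; have hphi := test_L2 tphi; have hphi' := test_L2 (test_derive tphi).
have h1 := is_deriveZ sg (w_weak a tphi).
have h2 := is_deriveD h1 (v_weak a tphi).
have -> : (fun b => ip (p b) phi) =
    (sg \*: (fun a => ip (w a) phi)) + (fun a => ip (v a) phi) :> (R -> R).
  by apply: funext => b; rewrite /p (ip_linl sg (hw b) (hv b) hphi).
apply: (is_derive1_eq h2); rewrite /p (ip_linl sg (hw a) (hv a) hphi').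
rewrite /GRing.scale/=; move: sg2; rewrite expr2 => sg2.
set X := ip (w a) _; set Y := ip (v a) _; set Z := ip (f a) _.
have -> : - sg * (sg * X + Y) = - (sg * sg) * X - sg * Y by ring.
rewrite sg2; lra.
Qed.

(** Since [sin (u / 2) ^+ 2 = (1 - cos u) / 2], a second-order Taylor bound for the cosine reduces
    the increment to its linear part, and [u (t + h) - u t] is [h * v t] up to [o(h)] in L2. *)
Let potential_derivative (t : R) :
  is_derive t (1 : R) (fun a => ip (s a) (s a)) (ip (f t) (v t) / 2).
Proof.
apply/is_derive1_leP => e e0.
pose V := L2_norm (v t); pose F := L2_norm (f t).
have V0 : 0 <= V by exact: L2_norm_ge0. have F0 : 0 <= F by exact: L2_norm_ge0.
have V1 : 0 < V + 1 by rewrite ltr_wpDl. have F1 : 0 < F + 1 by rewrite ltr_wpDl.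
near=> h.
have h1 : L2_norm (fun x => u (t + h) x - u t x - h * v t x) <= e / (F + 1) * `|h|.
  by near: h; apply: u_increment; rewrite divr_gt0.
have h2 : L2_norm (fun x => u (t + h) x - u t x - h * v t x) <= 1 * `|h|.
  by near: h; exact: u_increment.
have h3 : `|h| <= e / 2 / (V + 1) ^+ 2.
  by near: h; apply: near0_le; rewrite !divr_gt0// exprn_gt0.
pose d x := u (t + h) x - u t x.
have hd : L2 d by exact: udiff.
have hE : L2 (fun x => d x - h * v t x) by apply: L2B => //; exact: L2Z.
have dh : L2_norm d <= `|h| * (V + 1).
  have := L2_normD hE (L2Z h (hv t)); rewrite L2_normZ// -/V.
  by under eq_fun do rewrite subrK; move: h2; rewrite -/d; lra.
have i1 := L2_integrableM (hs (t + h)) (hs (t + h)); have i2 := L2_integrableM (hs t) (hs t).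
have i3 := L2_integrableM (L2Z (1 / 2) (hf t)) hd; have i4 := L2_integrableM hd hd.
(* Up to the factor [- 1 / 2] this is the Taylor remainder of the cosine; writing it with the
   half-angle sines makes each term integrable separately. *)
pose D x := s (t + h) x * s (t + h) x - s t x * s t x - 1 / 2 * f t x * d x.
have iD : mu.-integrable setT (EFin \o D).
  exact: (integrableB measurableT (integrableB measurableT i1 i2) i3).
have ED : \int[mu]_x D x = ip (s (t + h)) (s (t + h)) - ip (s t) (s t) - 1 / 2 * ip (f t) d.
  rewrite (RintegralB measurableT (integrableB measurableT i1 i2) i3).
  by rewrite (RintegralB measurableT i1 i2) -(ipZl (1 / 2) (hf t) hd).
have RD : `|\int[mu]_x D x| <= L2_norm d ^+ 2.
  apply: (le_trans (le_normr_Rintegral measurableT iD)).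
  rewrite L2_norm2//; apply: le_Rintegral => //; first exact: (integrable_abse iD).
  move=> x _; have := cos_taylor (u t x) (u (t + h) x).
  rewrite !cos_half_angle -/(s _ _) -/(s _ _) -/(f _ _) -/(d _) => hc.
  have -> : D x = - (1 / 2) * (1 - 2 * s (t + h) x ^+ 2 - (1 - 2 * s t x ^+ 2) + f t x * d x).
    by rewrite /D; field.
  have := sqr_ge0 (d x); move: hc; rewrite !ler_norml => /andP[? ?] ?.
  by apply/andP; split; lra.
have -> : ip (s (t + h)) (s (t + h)) - ip (s t) (s t) - h * (ip (f t) (v t) / 2) =
    \int[mu]_x D x + 1 / 2 * ip (f t) (fun x => d x - h * v t x).
  rewrite ED (ipBr hd (L2Z h (hv t)) (hf t)) (ipZr h (hv t) (hf t)); lra.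
have B1 : L2_norm d ^+ 2 <= e / 2 * `|h|.
  apply: (@le_trans _ _ ((`|h| * (V + 1)) ^+ 2)).
    by rewrite lerXn2r// nnegrE ?L2_norm_ge0// mulr_ge0// ltW.
  have -> : (`|h| * (V + 1)) ^+ 2 = `|h| * (V + 1) ^+ 2 * `|h| by ring.
  by rewrite ler_wpM2r// -ler_pdivlMr// exprn_gt0.
have B2 : `|ip (f t) (fun x => d x - h * v t x)| <= e * `|h|.
  apply: (le_trans (ip_CauchySchwarz (hf t) hE)).
  apply: (@le_trans _ _ ((F + 1) * (e / (F + 1) * `|h|))).
    by rewrite ler_pM ?L2_norm_ge0// lerDl.
  by rewrite mulrA (mulrC (F + 1)) divfK// gt_eqF.
have gen (I J y : R) : `|J| <= e * y -> `|I| <= e / 2 * y -> `|I + 1 / 2 * J| <= e * y.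
  by rewrite !ler_norml => /andP[? ?] /andP[? ?]; apply/andP; split; lra.
exact: gen B2 (le_trans RD B1).
Unshelve. all: by end_near. Qed.

Let is_derive_cos_comp (x : R) : is_derive x (1 : R) (fun y => - cos y) (sin x).
Proof. by apply: (is_derive1_eq (is_deriveN (is_derive_cos x))); rewrite opprK. Qed.

Let u_ninfty t : u t x @[x --> -oo] --> (0 : R). Proof. by case: (uX t). Qed.
Let u_pinfty t : u t x @[x --> +oo] --> 2 * pi. Proof. by case: (uX t). Qed.

(** The integrand is the derivative of [- cos u], which has the same limit at both ends: this is the
    conservation of momentum. *)
Lemma integral_sin_space_derivative t : ip (f t) (w t) = 0.
Proof.
have cosl : continuous (fun x : R => - cos x : R).
  by move=> x; apply: cvgN; exact: continuous_cos.
have := @ac_continuous_comp (fun x => - cos x) sin t is_derive_cos_comp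
  (@continuous_sin R) (@sin_lipschitz R).
move=> /ac_integral/(_ (L2_integrableM (hf t) (hw t))) h.
have cl (F : set_system R) (FF : Filter F) (l : R) : u t x @[x --> F] --> l ->
    - cos (u t x) @[x --> F] --> - cos l.
  by move=> ul; exact: (cvg_comp _ _ ul (cosl l)).
rewrite /ip (h (- cos 0) (- cos (2 * pi))).
- by rewrite mulr_natl cos2pi cos0 subrr.
- exact: cl.
- exact: cl.
Qed.

(** The primitive [- 2 * cos (u / 2)] runs from [-2] to [2] as [u] goes from [0] to [2 * pi], a
    topological constant. *)
Lemma integral_sin_half_space_derivative t : ip (s t) (w t) = 4.
Proof.
pose G x : R := - 2 * cos (1 / 2 * x + 0).
have dG (x : R) : is_derive x (1 : R) G (sin (x / 2)).
  have h := @is_derive_affine R cos (1 / 2) 0 x _ (is_derive_cos _).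
  have h2 : is_derive x (1 : R) G (- 2 * (- sin (1 / 2 * x + 0) * (1 / 2))).
    exact: (is_deriveZ (- 2) h).
  apply: (is_derive1_eq h2); rewrite addr0 mulrC (mulrC (1 / 2) x) !mul1r.
  by field.
have cG : continuous G.
  by move=> x; apply: differentiable_continuous; apply/derivable1_diffP; have [] := dG x.
have cs : continuous (fun x : R => sin (x / 2)).
  move=> x; apply: (@continuous_comp R R R (fun x : R => x / 2) sin); last exact: continuous_sin.
  by apply: cvgMl; exact: cvg_id.
have ls (x y : R) : `|sin (y / 2) - sin (x / 2)| <= `|y - x|.
  apply: (le_trans (sin_lipschitz _ _)); rewrite -mulrBl normrM ler_piMr//.
  by rewrite ger0_norm//; lra.
have := ac_continuous_comp t dG cs ls.
move=> /ac_integral/(_ (L2_integrableM (hs t) (hw t))) h.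
have cl (F : set_system R) (FF : Filter F) (l : R) : u t x @[x --> F] --> l ->
    G (u t x) @[x --> F] --> G l.
  by move=> ul; exact: (cvg_comp _ _ ul (cG l)).
rewrite /ip (h (G 0) (G (2 * pi))).
- rewrite /G !addr0 mulr0 cos0 mul1r mulrA mulVf// mul1r cospi; lra.
- exact: cl.
- exact: cl.
Qed.

Variables (c k : R).
Hypothesis ck : k ^+ 2 = 1 - c ^+ 2.

Definition bogomolny (t : R) : R :=
  L2_norm (fun x => v t x + c * w t x) ^+ 2 +
  L2_norm (fun x => k * w t x - 2 * sin (u t x / 2)) ^+ 2.

(* The expansion of the squares, with [w] and [v] regrouped into the characteristic
   variables; the constant is the cross term. *)
Let total (t : R) : R :=
  (1 + c) / 2 * ip (fun x => 1 * w t x + v t x) (fun x => 1 * w t x + v t x) +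
  (1 - c) / 2 * ip (fun x => - 1 * w t x + v t x) (fun x => - 1 * w t x + v t x) +
  4 * ip (s t) (s t) - 16 * k.

Let bogomolnyE t : bogomolny t = total t.
Proof.
have hwt := hw t; have hvt := hv t; have hst := hs t.
have E (a b : R) (g z : R -> R) : L2 g -> L2 z ->
    ip (fun x => a * g x + b * z x) (fun x => a * g x + b * z x) =
    a ^+ 2 * ip g g + 2 * a * b * ip g z + b ^+ 2 * ip z z.
  move=> hg hz; have hbz := L2Z b hz; have hag := L2Z a hg.
  have hl := L2_lin a hg hbz.
  rewrite (ip_linl a hg hbz hl) (ipZl b hz hl) (ipDr hag hbz hg) (ipDr hag hbz hz).
  rewrite (ipZr a hg hg) (ipZr b hz hg) (ipZr a hg hz) (ipZr b hz hz) (ipC z g).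
  ring.
rewrite /bogomolny /total L2_norm2; last by apply: L2D => //; exact: L2Z.
rewrite L2_norm2; last by apply: L2B; exact: L2Z.
have E1 := E 1 c _ _ hvt hwt; have E2 := E k (- 2) _ _ hwt hst.
have E3 := E 1 1 _ _ hwt hvt; have E4 := E (- 1) 1 _ _ hwt hvt.
have F1 : (fun x => 1 * v t x + c * w t x) = (fun x => v t x + c * w t x).
  by apply: funext => x; rewrite mul1r.
have F2 : (fun x => k * w t x + - 2 * s t x) = (fun x => k * w t x - 2 * sin (u t x / 2)).
  by apply: funext => x; rewrite mulNr.
have F3 (a : R) : (fun x => a * w t x + 1 * v t x) = (fun x => a * w t x + v t x).
  by apply: funext => x; rewrite mul1r.
rewrite F1 in E1; rewrite F2 in E2; rewrite F3 in E3; rewrite F3 in E4.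
rewrite E1 E2 E3 E4 (ipC (w t) (s t)) integral_sin_half_space_derivative ck (ipC (v t)).
move: (ip _ _) (ip _ _) (ip _ _) (ip _ _) => A B C D; by field.
Qed.

(** The weights [(1 + c) / 2] and [(1 - c) / 2] make the two transport energies contribute
    [- 2 * ip f v - 2 * c * ip f w]; the potential cancels the first term, and the second is
    zero. *)
Lemma bogomolny_conserved (t t' : R) : bogomolny t = bogomolny t'.
Proof.
apply: is_derive_0_is_cst => a.
have -> : bogomolny = total by apply: funext => b; exact: bogomolnyE.
have one2 : (1 : R) ^+ 2 = 1 by rewrite expr1n.
have mone2 : (- 1 : R) ^+ 2 = 1 by rewrite sqrrN expr1n.
have h1 := is_deriveZ ((1 + c) / 2) (energy_derivative a one2).
have h2 := is_deriveZ ((1 - c) / 2) (energy_derivative a mone2).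
have h3 := is_deriveZ 4 (potential_derivative a).
have h4 := is_deriveB (is_deriveD (is_deriveD h1 h2) h3) (is_derive_cst (16 * k) a (1 : R)).
apply: (is_derive1_eq h4); rewrite integral_sin_space_derivative /GRing.scale/=.
by field.
Qed.

End sine_gordon_flow.

(** * The kink and its first-order equation *)

Section kink_profile.
Context (R : realType).
Variables (c delta : R).
Hypothesis hc : -1 < c < 1.

Local Notation k := (Num.sqrt (1 - c ^+ 2)).
Local Notation U := (kink c delta).

Lemma speed_factor2 : k ^+ 2 = 1 - c ^+ 2.
Proof.
rewrite sqr_sqrtr//; have /andP[h1 h2] := hc.
have : 0 <= (1 - c) * (1 + c) by apply: mulr_ge0; lra.
by lra.
Qed.

Lemma speed_factor_gt0 : 0 < k.
Proof.
rewrite sqrtr_gt0; have /andP[h1 h2] := hc.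
have : 0 < (1 - c) * (1 + c) by apply: mulr_gt0; lra.
by lra.
Qed.

Lemma speed_factor_le1 : k <= 1.
Proof. by rewrite -[leRHS]sqrtr1 ler_wsqrtr// lerBlDr lerDl sqr_ge0. Qed.

Let E (x : R) := expR ((x - delta) / k).

Let E_gt0 x : 0 < E x. Proof. exact: expR_gt0. Qed.

Let sin_cos_atan (y : R) : sin (atan y) = y * cos (atan y) /\ cos (atan y) ^+ 2 = (1 + y ^+ 2)^-1.
Proof.
have c0 : cos (atan y) != 0.
  by rewrite gt_eqF// cos_gt0_pihalf// atan_gtNpi2 atan_ltpi2.
have S : sin (atan y) = y * cos (atan y).
  by rewrite -[X in X * _]atanK /tan divfK.
split=> //; have := cos2Dsin2 (atan y); rewrite S exprMn => h.
have y1 : 1 + y ^+ 2 != 0 by rewrite gt_eqF// ltr_pwDl// sqr_ge0.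
apply: (mulfI y1); rewrite mulfV// -{2}h; ring.
Qed.

Let half_kink x : U x / 2 = 2 * atan (E x).
Proof. by rewrite /kink -/(E x); field. Qed.

Lemma sin_half_kink x : sin (U x / 2) = 2 * E x / (1 + E x ^+ 2).
Proof.
rewrite half_kink mulr_natl sin_mulr2n; have [-> c2] := sin_cos_atan (E x).
by rewrite mulrCA -expr2 c2; lra.
Qed.

Lemma cos_half_kink x : - cos (U x / 2) = 1 - 2 / (1 + E x ^+ 2).
Proof.
rewrite half_kink mulr_natl cos_mulr2n; have [_ ->] := sin_cos_atan (E x).
lra.
Qed.

(** The equality case of the Bogomolny square. As [U / 2] is twice an arctangent, the double-angle
    formula gives [sin (U / 2) = 2 * E / (1 + E ^+ 2)], which matches the derivative of the
    arctangent. *)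
Lemma is_derive_kink (x : R) : is_derive x (1 : R) U (2 / k * sin (U x / 2)).
Proof.
have k0 := speed_factor_gt0; have kN0 : k != 0 by rewrite gt_eqF.
have h1 : is_derive x (1 : R) E (E x / k).
  have h := @is_derive_affine R (@expR R) k^-1 (- delta / k) x _ (is_derive_expR _).
  have Ex y : k^-1 * y + - delta / k = (y - delta) / k by field.
  rewrite Ex in h.
  by move: h; under [X in is_derive _ _ X]eq_fun do rewrite Ex.
have h2 := is_derive1_comp (is_derive1_atan (E x)) h1.
have h3 := is_deriveZ 4 h2.
apply: (is_derive1_eq h3); rewrite /GRing.scale/= sin_half_kink.
by field; rewrite kN0 /= gt_eqF// ltr_pwDl// sqr_ge0.
Qed.

Lemma kink_continuous : continuous U.
Proof.
by move=> x; apply: differentiable_continuous; apply/derivable1_diffP; have [] := is_derive_kink x.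
Qed.

Lemma kink_center : U delta = pi.
Proof. by rewrite /kink subrr mul0r expR0 atan1; field. Qed.

(** Linearized at [U], the first-order equation has coefficient [cos (U / 2) / k]; these signs say
    that it contracts when leaving [delta] in either direction. *)
Lemma cos_half_kink_sign (x : R) :
  (delta <= x -> 0 <= - cos (U x / 2)) /\ (x <= delta -> - cos (U x / 2) <= 0).
Proof.
have k0 := speed_factor_gt0; have e0 := E_gt0 x.
have D0 : 0 < 1 + E x ^+ 2 by rewrite ltr_pwDl// sqr_ge0.
rewrite cos_half_kink; split=> hx.
  have : 1 <= E x by rewrite /E -expR0 ler_expR divr_ge0// ?subr_ge0// ltW.
  move=> E1; rewrite subr_ge0 ler_pdivrMr// mul1r.
  have : 1 <= E x ^+ 2 by rewrite exprn_ege1.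
  by lra.
have : E x <= 1 by rewrite /E -expR0 ler_expR mulr_le0_ge0// ?subr_le0// invr_ge0 ltW.
move=> E1; rewrite subr_le0 ler_pdivlMr// mul1r.
have : E x ^+ 2 <= 1 by rewrite exprn_ile1// ltW.
by lra.
Qed.

Lemma derive1_kink x : derive1 U x = 2 / k * sin (U x / 2).
Proof. by rewrite derive1E; have [_ ->] := is_derive_kink x. Qed.

Lemma continuous_sin_half (f : R -> R) : continuous f -> continuous (fun x => sin (f x / 2)).
Proof.
move=> cf x; apply: (@continuous_comp R R R (fun x => f x / 2) sin); last exact: continuous_sin.
by apply: cvgMl; exact: cf.
Qed.

Lemma ac_kink : ac U (fun x => 2 / k * sin (U x / 2)).
Proof.
apply: ac_C1; first exact: is_derive_kink.
by move=> x; apply: cvgMr; exact: (continuous_sin_half kink_continuous).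
Qed.

Lemma is_derive_cos_half_kink (x : R) :
  is_derive x (1 : R) (fun y => - cos (U y / 2)) (sin (U x / 2) ^+ 2 / k).
Proof.
have kN0 : k != 0 by rewrite gt_eqF// speed_factor_gt0.
have h := @is_derive_affine R cos (1 / 2) 0 (U x) _ (is_derive_cos _).
have h2 := is_deriveN (is_derive1_comp h (is_derive_kink x)).
have Ex (y : R) : 1 / 2 * y + 0 = y / 2 by field.
rewrite Ex in h2.
move: h2; have -> : - ((fun y => cos (1 / 2 * y + 0)) \o U) = (fun y => - cos (U y / 2)) :> (R -> R).
  by apply: funext => y; rewrite -[LHS]/(- cos (1 / 2 * U y + 0)) Ex.
by move=> h2; apply: (is_derive1_eq h2); field.
Qed.

End kink_profile.

(** * A continuation principle *)

Section continuation.
Context (R : realType).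

(** At the infimum of the points where [f] reaches [r], continuity forces the value [r] exactly,
    whereas [step] improves the weak bound up to there to a strict one. *)
Lemma continuation (f : R -> R) (r : R) : continuous f -> f 0 < r ->
  (forall b, 0 <= b -> (forall y, 0 <= y <= b -> f y <= r) -> f b < r) ->
  forall b, 0 <= b -> f b < r.
Proof.
move=> cf f0 step b b0; rewrite ltNge; apply/negP => fb.
pose A := [set y | 0 <= y /\ r <= f y].
have A0 : has_inf A by split; [exists b|exists 0 => y []].
pose m := inf A.
have m_le y : A y -> m <= y by move=> Ay; apply: ge_inf Ay; case: A0.
have m0 : 0 <= m by apply: lb_le_inf; [case: A0|move=> y []].
have below y : 0 <= y < m -> f y < r.
  move=> /andP[y0 ym]; rewrite ltNge; apply/negP => ry.
  by have := m_le y (conj y0 ry); rewrite leNgt ym.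
have fm : r <= f m.
  rewrite leNgt; apply/negP => fmr.
  have /nbhs_ballP[e /= e0 he] : \forall y \near m, f y < r by exact: cvgr_lt (cf m) _ fmr.
  have [a [a0 ra] am] := inf_adherent e0 A0.
  have : f a < r.
    apply: he; rewrite /ball/= distrC ger0_norm ?subr_ge0 ?m_le//.
    by rewrite -/m in am; lra.
  by rewrite ltNge ra.
have mp : 0 < m.
  by rewrite lt_neqAle m0 andbT; apply/eqP => m0'; move: fm f0; rewrite -m0'; lra.
have fm' : f m <= r.
  rewrite leNgt; apply/negP => rfm.
  have /nbhs_ballP[e /= e0 he] : \forall y \near m, r < f y by exact: cvgr_gt (cf m) _ rfm.
  pose y := Num.max 0 (m - e / 2).
  have y0 : 0 <= y by rewrite le_max lexx.
  have ym : y < m by rewrite gt_max mp; lra.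
  have ye : m - e / 2 <= y by rewrite le_max lexx orbT.
  have : r < f y by apply: he; rewrite /ball/= ger0_norm; lra.
  by have := below y; rewrite y0 ym => /(_ isT); lra.
have : f m < r.
  apply: step => // y /andP[y0]; rewrite le_eqVlt => /predU1P[->//|ym].
  by apply: ltW; apply: below; rewrite y0.
by rewrite ltNge fm.
Qed.

End continuation.

(** * Distance to a kink in terms of the first-order defect *)

Section coercivity.
Context (R : realType).
Local Notation mu := (@lebesgue_measure R).

(* The left-hand side is [sg] times the derivative of [(2 - sg * th) * d ^+ 2]. *)
Lemma weighted_square_derivative_le (sg th s d rho g k : R) :
  sg ^+ 2 = 1 -> 0 <= sg * th -> s ^+ 2 + th ^+ 2 = 1 -> 0 < k -> `|d| <= 1 / 8 ->
  `|rho| <= (d / 2) ^+ 2 ->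
  sg * (- sg * (s ^+ 2 / k) * d ^+ 2 +
    (2 - sg * th) * (2 * d * (2 / k * (- th * (d / 2) + rho) + g))) <=
  - (1 / (2 * k)) * d ^+ 2 + 16 * k * g ^+ 2.
Proof.
move=> sg2 t0 st k0 dr rhod.
have sgN : `|sg| = 1.
  have : (`|sg| - 1) * (`|sg| + 1) = 0.
    by rewrite -[LHS]/(_) mulrDr mulr1 mulrBl -expr2 real_normK ?num_real// sg2; lra.
  move=> /eqP; rewrite mulf_eq0 => /orP[|] /eqP; first by lra.
  by have := normr_ge0 sg; lra.
pose t := sg * th; rewrite -/t in t0 *.
have t2 : t ^+ 2 = th ^+ 2 by rewrite /t exprMn sg2 mul1r.
have t1 : t <= 1.
  rewrite leNgt; apply/negP => t1.
  have : 1 < t ^+ 2 by rewrite exprn_egt1.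
  by have := sqr_ge0 s; rewrite t2; lra.
pose X := 2 / k * rho + g.
(* With [s ^+ 2 = 1 - t ^+ 2], the contraction gives [2 * t * (2 - t)] and the derivative of the
   weight gives [1 - t ^+ 2]; their sum is at least [1], even at the centre where [t = 0]. *)
have E : sg * (- sg * (s ^+ 2 / k) * d ^+ 2 +
    (2 - t) * (2 * d * (2 / k * (- th * (d / 2) + rho) + g))) =
    - (d ^+ 2 / k) * (1 + t * (4 - 3 * t)) + 2 * (2 - t) * (sg * d * X).
  have -> : s ^+ 2 = 1 - t ^+ 2 by rewrite t2; lra.
  have -> : sg * (- sg * ((1 - t ^+ 2) / k) * d ^+ 2 +
      (2 - t) * (2 * d * (2 / k * (- th * (d / 2) + rho) + g))) =
      - sg ^+ 2 * ((1 - t ^+ 2) / k) * d ^+ 2 - (2 - t) * (2 * d ^+ 2 / k * t) +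
      2 * (2 - t) * (sg * d * X).
    by rewrite /X /t; field; rewrite gt_eqF.
  by rewrite sg2; field; rewrite gt_eqF.
rewrite {}E.
have k1 : 0 < k^-1 by rewrite invr_gt0.
have D0 := sqr_ge0 d.
have A1 : 0 <= d ^+ 2 / k * (t * (4 - 3 * t)).
  by rewrite mulr_ge0 ?divr_ge0 ?(ltW k0)// mulr_ge0//; lra.
have A2 : 2 * (2 - t) * (sg * d * X) <= 4 * (`|d| * `|X|).
  apply: (le_trans (ler_norm _)); rewrite !normrM sgN mul1r (ger0_norm (ler0n R 2)).
  rewrite (ger0_norm (_ : 0 <= 2 - t)); last by lra.
  by apply: ler_wpM2r; [rewrite mulr_ge0|lra].
have A3 : `|X| <= 2 / k * (d / 2) ^+ 2 + `|g|.
  apply: (le_trans (ler_normD _ _)); rewrite lerD// normrM ger0_norm; last by rewrite divr_ge0// ltW.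
  by apply: ler_wpM2l => //; rewrite divr_ge0// ltW.
have nd0 := normr_ge0 d; have ng0 := normr_ge0 g.
have A4 : 4 * (`|d| * `|X|) <= 4 * (`|d| * (2 / k * (d / 2) ^+ 2 + `|g|)).
  by rewrite ler_wpM2l// ler_wpM2l.
(* The bound [1 / 8] on [d] makes the cubic term at most a quarter of [d ^+ 2 / k]; Young's
   inequality in [A6] costs another quarter, leaving the half in the statement. *)
have A5 : 4 * (`|d| * (2 / k * (d / 2) ^+ 2)) <= 1 / 4 * (d ^+ 2 / k).
  have -> : 4 * (`|d| * (2 / k * (d / 2) ^+ 2)) = 2 * (d ^+ 2 / k) * `|d| by field; rewrite gt_eqF.
  have : d ^+ 2 / k * `|d| <= d ^+ 2 / k * (1 / 8) by rewrite ler_wpM2l// divr_ge0// ltW.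
  by lra.
have A6 : 4 * (`|d| * `|g|) <= 1 / 4 * (d ^+ 2 / k) + 16 * k * g ^+ 2.
  rewrite -(real_normK (num_real d)) -(real_normK (num_real g)) -subr_ge0.
  have -> : 1 / 4 * (`|d| ^+ 2 / k) + 16 * k * `|g| ^+ 2 - 4 * (`|d| * `|g|) =
     k * (`|d| / (2 * k) - 4 * `|g|) ^+ 2 by field; rewrite gt_eqF.
  by rewrite mulr_ge0 ?sqr_ge0// ltW.
have -> : - (1 / (2 * k)) * d ^+ 2 = - (1 / 2) * (d ^+ 2 / k) by field; rewrite gt_eqF.
by move: A1 A2 A4 A5 A6; set Y := d ^+ 2 / k; rewrite mulrDr; lra.
Qed.

Lemma intI_sqr_le (f : R -> R) (a b : R) : L2 f -> intI (fun x => f x ^+ 2) a b <= L2_norm f ^+ 2.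
Proof.
move=> hf; have i2 := L2_sqr_integrable hf.
rewrite L2_norm2// /ip /intI /Rintegral.
under [X in _ <= fine X]eq_integral do rewrite -expr2.
rewrite fine_le//.
- apply: integrable_fin_num => //; exact: integrableS i2.
- exact: integrable_fin_num.
apply: ge0_subset_integral => //.
- by move/integrableP: i2 => [].
- by move=> x _; rewrite lee_fin sqr_ge0.
Qed.

Variables (c delta : R) (u w g : R -> R).
Hypothesis hc : -1 < c < 1.
Local Notation k := (Num.sqrt (1 - c ^+ 2)).
Local Notation U := (kink c delta).
Hypothesis acu : ac u w.
Hypothesis wE : forall x, w x = 2 / k * sin (u x / 2) + g x.
Hypothesis hg : L2 g.
Hypothesis u_center : u delta = pi.
Hypothesis g_small : L2_norm g < 1 / 32.

Let d x := u x - U x.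
Let wd x := w x - 2 / k * sin (U x / 2).
Let th x := - cos (U x / 2).
Let k0 : 0 < k := speed_factor_gt0 hc.
Let k1 : k <= 1 := speed_factor_le1 c.

Let acd : ac d wd.
Proof.
have h := ac_lin (-1) (ac_kink delta hc) acu.
by apply: (ac_ext h) => x; rewrite mulN1r addrC.
Qed.

Let d_center : d delta = 0.
Proof. by rewrite /d u_center kink_center subrr. Qed.

Let lld2 : locL1 (fun x => d x ^+ 2).
Proof. by apply: continuous_locL1; have [h _ _] := ac_sqr acd. Qed.

(** The pointwise inequality integrated over [[a, b]]; [sg = 1] serves to the right of the centre
    and [sg = -1] to the left. *)
Let half_estimate (sg a b : R) : sg ^+ 2 = 1 -> a <= b ->
  (forall x, a <= x <= b -> 0 <= sg * th x) -> (forall x, a <= x <= b -> `|d x| <= 1 / 8) ->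
  sg * ((2 - sg * th b) * d b ^+ 2 - (2 - sg * th a) * d a ^+ 2) <=
  - (1 / (2 * k)) * intI (fun x => d x ^+ 2) a b + 16 * k * L2_norm g ^+ 2.
Proof.
move=> sg2 ab thp dp.
have ac1 : ac (fun x => 2 - sg * th x) (fun x => - sg * (sin (U x / 2) ^+ 2 / k)).
  apply: ac_C1 => [x|].
    have h1 := is_deriveZ (- sg) (is_derive_cos_half_kink delta hc x).
    have h2 := is_deriveD (is_derive_cst (2 : R) x 1) h1.
    move: h2; rewrite add0r;
    have -> : cst (2 : R) + - sg *: (fun y => - cos (U y / 2)) = (fun x => 2 - sg * th x) :> (R -> R).
      by apply: funext => y; rewrite -mulNr.
    by [].
  move=> x; apply: cvgMr; apply: cvgMl.
  have h : (fun x => sin (U x / 2)) @ x --> sin (U x / 2).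
    have cU : continuous U by apply: kink_continuous.
    by have /(_ x) := continuous_sin_half cU.
  exact: (cvg_trans _ (cvgM h h)).
have acF := ac_mul ac1 (ac_sqr acd).
have [_ llF ->//] := acF.
have {}llF := locL2_locL1 llF.
set Fw := (F in intI F a b) in llF *.
have ll0 : locL1 (fun=> 0 : R) by apply: continuous_locL1 => x; exact: cvg_cst.
have -> : sg * intI Fw a b = intI (fun x => sg * Fw x + 0) a b.
  by rewrite (intI_lin sg a b llF ll0) intI_cst// mul0r addr0.
have llg := locL2_sqr (L2_locL2 hg).
have ll1 := locL1_lin (16 * k) llg ll0.
apply: (@le_trans _ _ (intI (fun x => - (1 / (2 * k)) * d x ^+ 2 + (16 * k * g x ^+ 2 + 0)) a b)).
  apply: intI_le.
  - exact: locL1_lin.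
  - exact: locL1_lin.
  move=> x xab; rewrite !addr0 /Fw.
  (* The Taylor remainder of the sine at [U / 2], which is quadratic in [d / 2]; the linear part
     carries the contraction. *)
  pose rho := sin (u x / 2) - sin (U x / 2) - cos (U x / 2) * (u x / 2 - U x / 2).
  have ud : u x / 2 - U x / 2 = d x / 2 by rewrite /d mulrBl.
  have -> : wd x = 2 / k * (- th x * (d x / 2) + rho) + g x.
    by rewrite /wd wE /rho ud /th; ring.
  apply: weighted_square_derivative_le => //; first exact: thp.
  - by rewrite /th sqrrN addrC cos2Dsin2.
  - exact: dp.
  - by rewrite -ud; exact: sin_taylor.
rewrite (intI_lin _ _ _ lld2 ll1) (intI_lin _ _ _ llg ll0) intI_cst// mul0r addr0 lerD2l.
by rewrite ler_wpM2l ?intI_sqr_le// mulr_ge0// ltW.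
Qed.

Let th_le1 x : `|th x| <= 1.
Proof. by rewrite /th normrN ler_norml cos_geN1 cos_le1. Qed.

Let B := 16 * k * L2_norm g ^+ 2.

(** The threshold [1 / 32] on [g] is tuned so that [B] falls below the square of the radius
    [1 / 8]. *)
Let B_small : B < 1 / 64.
Proof.
have g0 := L2_norm_ge0 g.
have : L2_norm g ^+ 2 < (1 / 32) ^+ 2 by rewrite ltrXn2r// ?nnegrE.
have -> : (1 / 32) ^+ 2 = 1 / 1024 :> R by field.
move=> h; have : 16 * k * L2_norm g ^+ 2 <= 16 * 1 * L2_norm g ^+ 2.
  by rewrite ler_wpM2r ?sqr_ge0// ler_wpM2l.
by rewrite /B; lra.
Qed.

Let d_lt (y : R) : d y ^+ 2 <= B -> `|d y| < 1 / 8.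
Proof.
move=> h; rewrite -(ltr_pXn2r (n := 2))// ?nnegrE// real_normK ?num_real//.
by apply: (le_lt_trans h); apply: (lt_le_trans B_small); rewrite expr2; lra.
Qed.

(** The boundary term at the centre vanishes because [d delta = 0], and the weight at the far end is
    at least [1]. *)
Let right_half (b : R) : 0 <= b -> (forall y, 0 <= y <= b -> `|d (delta + y)| <= 1 / 8) ->
  d (delta + b) ^+ 2 + 1 / (2 * k) * intI (fun x => d x ^+ 2) delta (delta + b) <= B.
Proof.
move=> b0 hb.
have h : 1 * ((2 - 1 * th (delta + b)) * d (delta + b) ^+ 2 - (2 - 1 * th delta) * d delta ^+ 2)
    <= - (1 / (2 * k)) * intI (fun x => d x ^+ 2) delta (delta + b) + B.
  apply: half_estimate; [by rewrite expr1n|by rewrite lerDl| |] => x /andP[x1 x2].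
    by rewrite mul1r; apply: (cos_half_kink_sign delta hc x).1.
  by have := hb (x - delta); rewrite (addrC delta) subrK; apply; lra.
rewrite d_center in h.
have : 1 * d (delta + b) ^+ 2 <= (2 - th (delta + b)) * d (delta + b) ^+ 2.
  rewrite ler_wpM2r ?sqr_ge0//; have := th_le1 (delta + b).
  by rewrite ler_norml => /andP[]; lra.
by lra.
Qed.

Let left_half (b : R) : 0 <= b -> (forall y, 0 <= y <= b -> `|d (delta - y)| <= 1 / 8) ->
  d (delta - b) ^+ 2 + 1 / (2 * k) * intI (fun x => d x ^+ 2) (delta - b) delta <= B.
Proof.
move=> b0 hb.
have h : -1 * ((2 - -1 * th delta) * d delta ^+ 2 - (2 - -1 * th (delta - b)) * d (delta - b) ^+ 2)
    <= - (1 / (2 * k)) * intI (fun x => d x ^+ 2) (delta - b) delta + B.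
  apply: half_estimate; [by rewrite sqrrN expr1n|by rewrite gerBl| |] => x /andP[x1 x2].
    by rewrite mulN1r oppr_ge0; apply: (cos_half_kink_sign delta hc x).2.
  by have := hb (delta - x); rewrite subKr; apply; lra.
rewrite d_center in h.
have : 1 * d (delta - b) ^+ 2 <= (2 + th (delta - b)) * d (delta - b) ^+ 2.
  rewrite ler_wpM2r ?sqr_ge0//; have := th_le1 (delta - b).
  by rewrite ler_norml => /andP[]; lra.
by lra.
Qed.

Let cd : continuous d. Proof. by have [] := acd. Qed.

(** As long as [|d| <= 1 / 8], the half-line estimates give [d ^+ 2 <= B < 1 / 64], a strict
    improvement; continuation starts from [d delta = 0] and runs in each direction. *)
Let d_small x : `|d x| <= 1 / 8.
Proof.
have cn (s : R) : continuous (fun y => `|d (delta + s * y)|).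
  move=> y; apply: (@continuous_comp R R R (fun y => d (delta + s * y)) (@Num.norm R R));
    last exact: norm_continuous.
  apply: (@continuous_comp R R R (fun y => delta + s * y) d); last exact: cd.
  by apply: cvgD; [exact: cvg_cst|apply: cvgMr; exact: cvg_id].
have i0 (a b : R) : 0 <= 1 / (2 * k) * intI (fun x => d x ^+ 2) a b.
  apply: mulr_ge0; first by rewrite divr_ge0// mulr_ge0// ltW.
  by apply: intI_ge0 => y _; exact: sqr_ge0.
have n0 s : `|d (delta + s * 0)| < 1 / 8 by rewrite mulr0 addr0 d_center normr0; lra.
case: (lerP delta x) => hx.
  have h := @continuation _ _ (1 / 8) (cn 1) (n0 1) _ (x - delta).
  rewrite (_ : delta + 1 * (x - delta) = x) in h; last by ring.
  apply/ltW/h; last by lra.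
  move=> b b0 hb; rewrite mul1r; apply: d_lt.
  have := right_half b0; have := i0 delta (delta + b).
  move=> ? h1.
  have : d (delta + b) ^+ 2 + 1 / (2 * k) * intI (fun x => d x ^+ 2) delta (delta + b) <= B.
    by apply: h1 => y hy; rewrite -[y]mul1r; exact: hb.
  by lra.
have h := @continuation _ _ (1 / 8) (cn (-1)) (n0 (-1)) _ (delta - x).
rewrite (_ : delta + -1 * (delta - x) = x) in h; last by ring.
apply/ltW/h; last by lra.
move=> b b0 hb; rewrite mulN1r; apply: d_lt.
have := left_half b0; have := i0 (delta - b) delta.
move=> ? h1.
have : d (delta - b) ^+ 2 + 1 / (2 * k) * intI (fun x => d x ^+ 2) (delta - b) delta <= B.
  by apply: h1 => y hy; rewrite -mulN1r; exact: hb.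
by lra.
Qed.

(** Adding the two half-line bounds gives at most [4 * k * B = 64 * k ^+ 2 * L2_norm g ^+ 2] for the
    integral of [d ^+ 2] on any interval; the equation then controls the derivative by [d] and
    [g]. *)
Lemma kink_coercive : [/\ ac d wd, L2 d, L2 wd,
  L2_norm d <= 8 * L2_norm g & L2_norm wd <= 9 * L2_norm g].
Proof.
have g0 := L2_norm_ge0 g; have d0 := L2_norm_ge0 d.
have [hd nd] : L2 d /\ L2_norm d ^+ 2 <= 64 * k ^+ 2 * L2_norm g ^+ 2.
  apply: L2_of_bounded_intI; first exact: continuous_locL2.
  (* [[-m, m]] contains both [[-n, n]] and the centre, so the half-line estimates can be glued at
     [delta]. *)
  move=> n; pose m := Num.max (n%:R : R) `|delta|.
  have nm : n%:R <= m by rewrite le_max lexx.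
  have dm : `|delta| <= m by rewrite le_max lexx orbT.
  have n0 : 0 <= n%:R :> R by exact: ler0n.
  move: dm; rewrite ler_norml => /andP[dm1 dm2].
  have i0 (a b : R) : 0 <= intI (fun x => d x ^+ 2) a b.
    by apply: intI_ge0 => y _; exact: sqr_ge0.
  have r1 := @right_half (m - delta); have r2 := @left_half (m + delta).
  rewrite (addrC m) opprD addrA subrr sub0r in r2; rewrite (addrC delta) subrK in r1.
  have {}r1 : d m ^+ 2 + 1 / (2 * k) * intI (fun x => d x ^+ 2) delta m <= B.
    by apply: r1 => [|y _]; [lra|exact: d_small].
  have {}r2 : d (- m) ^+ 2 + 1 / (2 * k) * intI (fun x => d x ^+ 2) (- m) delta <= B.
    by apply: r2 => [|y _]; [lra|exact: d_small].
  have c1 : intI (fun x => d x ^+ 2) (- m) m =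
      intI (fun x => d x ^+ 2) (- m) delta + intI (fun x => d x ^+ 2) delta m.
    by apply: intI_cat => //; lra.
  have c2 : intI (fun x => d x ^+ 2) (- m) m =
      intI (fun x => d x ^+ 2) (- m) (- n%:R) + intI (fun x => d x ^+ 2) (- n%:R) m.
    by apply: intI_cat => //; lra.
  have c3 : intI (fun x => d x ^+ 2) (- n%:R) m =
      intI (fun x => d x ^+ 2) (- n%:R) n%:R + intI (fun x => d x ^+ 2) n%:R m.
    by apply: intI_cat => //; lra.
  have := i0 (- m) (- n%:R); have := i0 n%:R m.
  have : 1 / (2 * k) * intI (fun x => d x ^+ 2) (- m) m <= 2 * B.
    by rewrite c1 mulrDr; have := sqr_ge0 (d m); have := sqr_ge0 (d (- m)); lra.
  rewrite mul1r mulrC ler_pdivrMr; last by rewrite mulr_gt0.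
  have -> : 2 * B * (2 * k) = 64 * k ^+ 2 * L2_norm g ^+ 2 by rewrite /B; ring.
  by lra.
(* The factor [k] is kept: it cancels the Lipschitz constant [1 / k] of the equation, whence
   [8 + 1 = 9] for the derivative. *)
have nd1 : L2_norm d <= 8 * k * L2_norm g.
  rewrite -(ler_pXn2r (n := 2))// ?nnegrE//; first by rewrite !exprMn; apply: (le_trans nd); lra.
  by rewrite !mulr_ge0// ltW.
have k10 : 0 <= k^-1 by rewrite invr_ge0 ltW.
pose ks x := k^-1 * `|d x| + `|g x|.
have hs1 : L2 (fun x => `|d x|).
  by apply: (L2_dom _ hd) => [|x]; [exact: (measurableT_comp _ (L2_measurable hd))|rewrite normr_id].
have hs2 : L2 (fun x => `|g x|).
  by apply: (L2_dom _ hg) => [|x]; [exact: (measurableT_comp _ (L2_measurable hg))|rewrite normr_id].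
have hks : L2 ks by exact: L2_lin.
have mwd : measurable_fun setT wd by have [_ [? _] _] := acd.
have wdks x : `|wd x| <= `|ks x|.
  rewrite [leRHS]ger0_norm; last by rewrite addr_ge0// mulr_ge0.
  have -> : wd x = 2 / k * (sin (u x / 2) - sin (U x / 2)) + g x.
    by rewrite /wd wE; ring.
  apply: (le_trans (ler_normD _ _)); rewrite lerD2r normrM (ger0_norm (_ : 0 <= 2 / k));
    last by rewrite mulr_ge0.
  have := sin_lipschitz (U x / 2) (u x / 2); rewrite -mulrBl normrM.
  rewrite (ger0_norm (_ : 0 <= 2^-1)); last by rewrite invr_ge0.
  move=> h; apply: (le_trans (ler_wpM2l _ h)); first by rewrite mulr_ge0.
  by rewrite le_eqVlt /d; apply/orP; left; apply/eqP; field; rewrite gt_eqF.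
split=> //; first exact: L2_dom mwd hks wdks.
  apply: (le_trans nd1); rewrite ler_wpM2r//; have := k1; rewrite -(ler_pM2l (ltr0n R 8)); lra.
apply: (le_trans (L2_dom_norm mwd hks wdks)).
apply: (le_trans (L2_normD (L2Z k^-1 hs1) hs2)).
have e1 : L2_norm (fun x => `|d x|) <= L2_norm d.
  by apply: (L2_dom_norm _ hd) => [|x]; [exact: L2_measurable|rewrite normr_id].
have e2 : L2_norm (fun x => `|g x|) <= L2_norm g.
  by apply: (L2_dom_norm _ hg) => [|x]; [exact: L2_measurable|rewrite normr_id].
rewrite L2_normZ// (ger0_norm k10).
have : k^-1 * L2_norm (fun x => `|d x|) <= k^-1 * (8 * k * L2_norm g).
  by rewrite ler_wpM2l//; lra.
have -> : k^-1 * (8 * k * L2_norm g) = 8 * L2_norm g by field; rewrite gt_eqF.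
by lra.
Qed.

End coercivity.

(** * Orbital stability of the kink *)

Section stability.
Context (R : realType).
Local Notation mu := (@lebesgue_measure R).

Lemma state_at_kink (c delta : R) (ubar : R -> R -> R) : -1 < c < 1 ->
  (forall t x, ubar t x = kink c delta (x - c * t)) -> state_at ubar 0 = kink_state c delta.
Proof.
move=> hc h; rewrite /state_at /kink_state; congr (_, _); apply: funext => x.
  by rewrite h mulr0 subr0.
have h1 : is_derive (- c * 0 + x) (1 : R) (kink c delta) (derive1 (kink c delta) x).
  by rewrite mulr0 add0r derive1_kink//; exact: is_derive_kink.
have h2 := @is_derive_affine R (kink c delta) (- c) x 0 _ h1.
rewrite derive1E; have -> : ubar ^~ x = (fun y => kink c delta (- c * y + x)).
  by apply: funext => t; rewrite h addrC mulNr.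
by have [_ ->] := h2; rewrite mulrC.
Qed.

Variable c : R.
Hypothesis hc : -1 < c < 1.
Local Notation k := (Num.sqrt (1 - c ^+ 2)).
Let k0 : 0 < k := speed_factor_gt0 hc.
Let k1 : k <= 1 := speed_factor_le1 c.

Let c1 : `|c| <= 1.
Proof. by move: hc => /andP[h1 h2]; rewrite ler_norml !ltW. Qed.

Let kink_slope delta x := 2 / k * sin (kink c delta x / 2).

Lemma limits_IVT (f : R -> R) (l m y : R) : continuous f ->
  f x @[x --> -oo] --> l -> f x @[x --> +oo] --> m -> l < y < m -> exists x, f x = y.
Proof.
move=> cf fl fm /andP[ly ym].
have [a fa] : exists a, f a < y.
  have : \forall x \near -oo, f x < y by exact: cvgr_lt fl _ ly.
  by move=> /filter_ex[a fa]; exists a.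
have [b fb] : exists b, y < f b.
  have : \forall x \near +oo, y < f x by exact: cvgr_gt fm _ ym.
  by move=> /filter_ex[b fb]; exists b.
have cw (a' b' : R) : {within `[a', b'], continuous f} by exact: continuous_subspaceT.
case: (leP a b) => ab.
  have h : Num.min (f a) (f b) <= y <= Num.max (f a) (f b).
    by rewrite ge_min le_max (ltW fa) (ltW fb) orbT.
  by have [x _ <-] := IVT ab (cw a b) h; exists x.
have h : Num.min (f b) (f a) <= y <= Num.max (f b) (f a).
  by rewrite ge_min le_max (ltW fa) (ltW fb) orbT.
by have [x _ <-] := IVT (ltW ab) (cw b a) h; exists x.
Qed.

(** The kink is centred where [u] takes the value [pi], and the defect [g] is the second square
    divided by [k], so [rho < k / 32] meets the smallness required for coercivity. The constant is
    [245 = 8 ^+ 2 + 9 ^+ 2 + 10 ^+ 2], for [u], its derivative and the velocity. *)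
Lemma near_kink (u u1 v : R -> R) (rho : R) : X1 (u, v) -> ac u u1 -> L2 u1 -> 0 <= rho < k / 32 ->
  L2_norm (fun x => v x + c * u1 x) ^+ 2 +
  L2_norm (fun x => k * u1 x - 2 * sin (u x / 2)) ^+ 2 <= rho ^+ 2 ->
  exists delta : R, forall r, 0 <= r -> 245 * (rho / k) ^+ 2 <= r ^+ 2 ->
    H1L2_close (u, v) (kink_state c delta) r.
Proof.
move=> [cu /H1_L2 hs hv ul um] acu hu1 /andP[rho0 rhok] le_rho; rewrite /= in cu hs hv ul um.
have [delta hdelta] : exists x, u x = pi.
  by apply: (limits_IVT cu ul um); have := @pi_gt0 R; lra.
have hp := L2D hv (L2Z c hu1); have hq := L2B (L2Z k hu1) (L2Z 2 hs).
have small f : L2_norm f ^+ 2 <= rho ^+ 2 -> L2_norm f <= rho.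
  by rewrite ler_sqr ?nnegrE ?L2_norm_ge0.
have np := small _ (le_trans _ le_rho); have nq := small _ (le_trans _ le_rho).
have {}np := np (fun x => v x + c * u1 x) (ler_wpDr (sqr_ge0 _) (lexx _)).
have {}nq := nq (fun x => k * u1 x - 2 * sin (u x / 2)) (ler_wpDl (sqr_ge0 _) (lexx _)).
pose g x := k^-1 * (k * u1 x - 2 * sin (u x / 2)).
have hg : L2 g by exact: L2Z.
have ng : L2_norm g <= rho / k.
  rewrite L2_normZ// gtr0_norm ?invr_gt0// mulrC ler_pM2r ?invr_gt0//.
have gE x : u1 x = 2 / k * sin (u x / 2) + g x by rewrite /g; field; rewrite gt_eqF.
have g_small : L2_norm g < 1 / 32.
  apply: (le_lt_trans ng); rewrite ltr_pdivrMr//; lra.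
have [acd hd hwd nd nwd] := kink_coercive hc acu gE hg hdelta g_small.
exists delta => r r0 hr.
set wd := (fun x => u1 x - _) in acd hwd nwd.
(* The velocity error is the first Bogomolny term corrected by [c] times the error in the
   derivative: at most [rho + 9 * (rho / k)], hence [10 * (rho / k)] as [k <= 1]. *)
have Ev x : v x - - c * derive1 (kink c delta) x = (v x + c * u1 x) - c * wd x.
  by rewrite derive1_kink// /wd; ring.
have hcw := L2Z c hwd.
have L : 0 <= rho / k by rewrite divr_ge0// ltW.
have rho_le : rho <= rho / k by rewrite ler_pdivlMr// -[leRHS]mulr1 ler_wpM2l.
have nv : L2_norm (fun x => v x - - c * derive1 (kink c delta) x) <= 10 * (rho / k).
  rewrite (funext Ev); apply: (le_trans (L2_normB hp hcw)); rewrite L2_normZ//.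
  have : `|c| * L2_norm wd <= 1 * L2_norm wd by rewrite ler_wpM2r// L2_norm_ge0.
  by lra.
apply: (H1L2_closeP r0 acd) => //; first by rewrite (funext Ev); exact: L2B.
apply: (le_trans _ hr).
have sq (x m : R) : 0 <= x -> x <= m * (rho / k) -> x ^+ 2 <= m ^+ 2 * (rho / k) ^+ 2.
  by move=> x0 xm; rewrite -exprMn; rewrite ler_sqr ?nnegrE//; exact: le_trans xm.
have s1 : L2_norm (fun x => u x - kink c delta x) ^+ 2 <= 8 ^+ 2 * (rho / k) ^+ 2.
  by apply: sq; [exact: L2_norm_ge0|lra].
have s2 : L2_norm wd ^+ 2 <= 9 ^+ 2 * (rho / k) ^+ 2.
  by apply: sq; [exact: L2_norm_ge0|lra].
have s3 := sq _ _ (L2_norm_ge0 _) nv.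
by lra.
Qed.

Section initial.
Variables (delta eps : R) (u0 v0 : R -> R).
Hypothesis hX : X1 (u0, v0).
Hypothesis close : H1L2_close (u0, v0) (kink_state c delta) eps.
Local Notation K := (kink c delta).
Local Notation K1 := (kink_slope delta).
Let D x := u0 x - K x.

Let half_sin_dist x : `|sin (u0 x / 2) - sin (K x / 2)| <= `|D x|.
Proof.
apply: (le_trans (sin_lipschitz _ _)); rewrite -mulrBl normrM (ger0_norm (_ : 0 <= 2^-1)) ?invr_ge0//.
by have := normr_ge0 (u0 x - K x); rewrite /D; lra.
Qed.

Let hD : L2 D. Proof. by have [[h _] _] := close; exact: H1_L2. Qed.

Let cu0 : continuous u0. Proof. by have [] := hX. Qed.

Let hs0 : L2 (fun x => sin (u0 x / 2)).
Proof. by have [_ /H1_L2] := hX. Qed.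

Let mdist : measurable_fun setT (fun x => sin (u0 x / 2) - sin (K x / 2)).
Proof.
apply: continuous_measurableT => x; apply: cvgB.
  exact: continuous_sin_half.
by apply: continuous_sin_half; exact: kink_continuous.
Qed.

Let hdist : L2 (fun x => sin (u0 x / 2) - sin (K x / 2)).
Proof. exact: L2_dom mdist hD half_sin_dist. Qed.

(** No decay of the kink is computed: [sin (K / 2)] differs from the L2 function [sin (u0 / 2)] by
    at most [|u0 - K|], which is in L2 by closeness. *)
Lemma L2_kink_slope : L2 K1.
Proof.
apply: L2Z; have := L2B hs0 hdist.
by under eq_fun do rewrite subKr.
Qed.

Let w x := K1 x + weak_derivative D x.

(** Both expressions vanish on the kink state, so each is bounded linearly by the distance to it. A
    separate [v] appears because the velocity of the solution at time [0] agrees with [v0] only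
    almost everywhere. *)
Lemma initial_bogomolny (v : R -> R) : L2 v -> {ae mu, forall x, v x = v0 x} ->
  L2_norm (fun x => v x + c * w x) ^+ 2 +
  L2_norm (fun x => k * w x - 2 * sin (u0 x / 2)) ^+ 2 <= 16 * eps ^+ 2.
Proof.
move=> hv vv0; have [[hH hV] hle] := close.
have [n1 n2 n3] := H1L2_norm_ge (u0 \- (kink_state c delta).1, v0 \- (kink_state c delta).2).
have {}n1 := le_trans n1 hle; have {}n2 := le_trans n2 hle; have {}n3 := le_trans n3 hle.
rewrite /= in n1 n2 n3 hH hV.
have [hw _] := weak_derivativeP hH.
have hv0 : L2 v0 by have [] := hX.
have Ev x : v0 x - - c * derive1 K x = v0 x + c * K1 x.
  by rewrite derive1_kink// mulNr opprK.
rewrite (funext Ev : v0 \- _ = _) in n3 hV.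
have e0 : 0 <= eps by exact: le_trans (L2_norm_ge0 _) n1.
have p1 : L2_norm (fun x => v x + c * w x) <= 2 * eps.
  have E x : v x + c * w x = (v x - v0 x) + ((v0 x + c * K1 x) + c * weak_derivative D x).
    by rewrite /w; ring.
  rewrite (funext E); have hcw := L2Z c hw.
  apply: (le_trans (L2_normD (L2B hv hv0) (L2D hV hcw))).
  rewrite (L2_ae_eq hv hv0 vv0) add0r; apply: (le_trans (L2_normD hV hcw)).
  rewrite L2_normZ//; have : `|c| * L2_norm (weak_derivative D) <= 1 * L2_norm (weak_derivative D).
    by rewrite ler_wpM2r// L2_norm_ge0.
  by move: n2; rewrite -/D; lra.
have p2 : L2_norm (fun x => k * w x - 2 * sin (u0 x / 2)) <= 3 * eps.
  have E x : k * w x - 2 * sin (u0 x / 2) =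
      k * weak_derivative D x + -2 * (sin (u0 x / 2) - sin (K x / 2)).
    by rewrite /w /kink_slope; field; rewrite gt_eqF.
  rewrite (funext E); apply: (le_trans (L2_normD (L2Z k hw) (L2Z (-2) hdist))).
  rewrite !L2_normZ// (ger0_norm (ltW k0)) normrN (ger0_norm (ler0n R 2)).
  have : k * L2_norm (weak_derivative D) <= 1 * L2_norm (weak_derivative D).
    by rewrite ler_wpM2r// L2_norm_ge0.
  have := L2_dom_norm mdist hD half_sin_dist.
  by move: n1 n2; rewrite -/D; lra.
(* The sum is at most [(4 + 9) * eps ^+ 2], rounded up to [16 * eps ^+ 2] so that [4 * eps] can
   serve as the radius in [near_kink]. *)
have q1 : L2_norm (fun x => v x + c * w x) ^+ 2 <= (2 * eps) ^+ 2.
  by rewrite ler_sqr ?nnegrE ?L2_norm_ge0// mulr_ge0.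
have q2 : L2_norm (fun x => k * w x - 2 * sin (u0 x / 2)) ^+ 2 <= (3 * eps) ^+ 2.
  by rewrite ler_sqr ?nnegrE ?L2_norm_ge0// mulr_ge0.
by move: q1 q2 (sqr_ge0 eps); rewrite !exprMn; lra.
Qed.

End initial.

End stability.

Theorem theorem3p1 (R : realType) (c : R) (hc : -1 < c < 1)
    (ubar : R -> R -> R) (hubar : is_kink_solution c ubar) :
  forall eta : R, 0 < eta ->
  exists eps0 : R, 0 < eps0 /\
  forall eps : R, 0 < eps < eps0 ->
  forall u0 v0 : R -> R,
    X1 (u0, v0) ->
    H1L2_close (u0, v0) (state_at ubar 0) eps ->
  forall u v : R -> R -> R,
    sine_gordon_evolution u0 v0 u v ->
  exists c' : R, [/\ -1 < c' < 1, `|c' - c| < eta &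
    forall t : R, exists delta : R,
      H1L2_close (u t, v t) (kink_state c' delta) (Num.sqrt eps)].
Proof.
move=> eta eta0; have [delta0 hU] := hubar.
pose k := Num.sqrt (1 - c ^+ 2).
have k0 : 0 < k := speed_factor_gt0 hc.
have k1 : k <= 1 := speed_factor_le1 c.
(* Two demands are met: [4 * eps < k / 32] for coercivity, and [245 * (4 * eps / k) ^+ 2 <= eps],
   that is, [3920 * eps <= k ^+ 2], where [3920 < 64 ^+ 2]. *)
exists (k ^+ 2 / 64 ^+ 2); split; first by rewrite divr_gt0 ?exprn_gt0.
move=> eps /andP[eps0]; rewrite ltr_pdivlMr ?exprn_gt0// => epsk.
move=> u0 v0 hX; rewrite (state_at_kink hc hU) => close u v [sol u00 v00].
exists c; rewrite subrr normr0; split=> // t.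
have hK1 := L2_kink_slope hc hX close.
have acK := ac_kink delta0 hc.
(* The reference profile is the initial kink: [u s - K] is the H1 increment of the curve since time
   [0] plus the initial perturbation. *)
have uK s : H1 (fun x => u s x - kink c delta0 x).
  have [_ h _ _ _] := sol; have [[h1 _] _] := close.
  have := H1D (h s 0) h1; rewrite u00 /=; congr H1; apply: funext => x /=.
  by rewrite addrA subrK.
have [hsX _ _ _ _] := sol.
have hv0 : L2 (v 0) by have [] := hsX 0.
have E0 := initial_bogomolny hc hX close hv0 v00.
have ck := speed_factor2 hc.
have Et := bogomolny_conserved sol acK hK1 uK ck t 0.
have eps_k : eps < k / 128.
  have : k ^+ 2 <= k by rewrite expr2 ger_pMr.
  by lra.
have [||delta hdelta] := near_kink hc (rho := 4 * eps) (hsX t)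
    (ac_space_derivative sol acK uK t) (L2_space_derivative hK1 uK t).
- by rewrite -/k; apply/andP; split; lra.
- rewrite -[leLHS]/(bogomolny u v _ _ c k t) Et /bogomolny /space_derivative u00 exprMn.
  by apply: (le_trans E0); lra.
exists delta; apply: hdelta; first exact: sqrtr_ge0.
rewrite sqr_sqrtr; last exact: ltW.
have k2 : 0 < k ^+ 2 by rewrite exprn_gt0.
(* Here [62 * 64 - 48 = 3920 = 245 * 16]; one factor [eps] is isolated so as to be cancelled against
   the right-hand side. *)
have -> : 245 * (4 * eps / k) ^+ 2 = eps * (62 * 64 - 48) * eps / k ^+ 2 by field; rewrite gt_eqF.
rewrite ler_pdivrMr// -mulrA ler_pM2l//.
by lra.
Qed.
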